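(* Suppose that $\mu_1,\mu_2,\mu_3$ are three continuous, finite, non-negative Borel measures defined on $\mathbb{R}^5$. Then there exist three hyperplanes $h_1,h_2,h_3$ in $\mathbb{R}^5$ that form an equipartition for the measures $\mu_1$ and $\mu_2$ and such that, for some $i\in\{1,2,3\}$, the hyperplane $h_i$ is a bisector of $\mu_3$ in the sense that $\mu_3(h_i^+)=\mu_3(h_i^-)$.
   Context: Hyperplanes are affine hyperplanes. A Borel measure on $\mathbb{R}^d$ is called continuous if every hyperplane has measure zero. For an oriented hyperplane $h$ in $\mathbb{R}^d$, $h^+$ and $h^-$ denote the two closed half-spaces bounded by $h$ (reversing the orientation interchanges them). For a $k$-tuple $h_1,\dots,h_k$ of oriented hyperplanes, the associated $2^k$ hyperorthants are the sets $O_\epsilon=h_1^{\epsilon_1}\cap\dots\cap h_k^{\epsilon_k}$, $\epsilon\in\{+,-\}^k$. The hyperplanes $h_1,\dots,h_k$ form an equipartition for a finite measure $\mu$ if $\mu(O_\epsilon)=\frac{1}{2^k}\mu(\mathbb{R}^d)$ for every $\epsilon\in\{+,-\}^k$ (this does not depend on the chosen orientations), and they form an equipartition for a collection of measures if they form an equipartition for each measure in the collection. *)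

(* Defs.v *)
(* The real line is an arbitrary R : realType. *)
From HB Require Import structures.
From mathcomp Require Import all_boot all_order all_algebra.
From mathcomp Require Import all_classical all_reals all_analysis.

Set Implicit Arguments.
Unset Strict Implicit.
Unset Printing Implicit Defensive.

Import Order.TTheory GRing.Theory Num.Theory.
Import numFieldNormedType.Exports.

Local Open Scope classical_set_scope.
Local Open Scope ring_scope.

(* The library puts no sigma-algebra on row vectors; the topology of 'rV[R]_d
   is the product topology, so this is R^d with its Borel sigma-algebra. *)
Notation borel_rV R d := (g_sigma_algebraType (@open 'rV[R]_d)).

Definition dotp (R : realType) (d : nat) (u x : 'rV[R]_d) : R :=
  \sum_(i < d) u 0 i * x 0 i.

(* The affine hyperplane {x | <normal, x> = offset}, oriented by its normal.
   Opposite pairs (u, c) and (- u, - c) give the two orientations of the same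
   hyperplane; positively proportional pairs give the same oriented one. *)
Record oriented_hyperplane (R : realType) (d : nat) := OrientedHyperplane {
  normal : 'rV[R]_d;
  offset : R;
  normal_neq0 : normal != 0 }.

Definition hyperplane_set (R : realType) (d : nat)
    (h : oriented_hyperplane R d) : set (borel_rV R d) :=
  [set x | dotp (normal h) x = offset h].

(* h^+ for s = true, h^- for s = false; both half-spaces are closed. *)
Definition halfspace (R : realType) (d : nat) (h : oriented_hyperplane R d)
    (s : bool) : set (borel_rV R d) :=
  if s then [set x | offset h <= dotp (normal h) x]
  else [set x | dotp (normal h) x <= offset h].

Definition hyperorthant (R : realType) (d k : nat)
    (h : 'I_k -> oriented_hyperplane R d) (e : 'I_k -> bool) :
    set (borel_rV R d) :=
  \bigcap_(i in [set: 'I_k]) halfspace (h i) (e i).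

Definition continuous_measure (R : realType) (d : nat)
    (mu : {measure set (borel_rV R d) -> \bar R}) : Prop :=
  forall h : oriented_hyperplane R d, mu (hyperplane_set h) = 0%E.

Definition equipartition (R : realType) (d k : nat)
    (mu : {finite_measure set (borel_rV R d) -> \bar R})
    (h : 'I_k -> oriented_hyperplane R d) : Prop :=
  forall e : 'I_k -> bool,
    mu (hyperorthant h e) = ((1 / 2 ^+ k)%:E * mu setT)%E.

Definition bisector (R : realType) (d : nat)
    (mu : {finite_measure set (borel_rV R d) -> \bar R})
    (h : oriented_hyperplane R d) : Prop :=
  mu (halfspace h true) = mu (halfspace h false).

(* The sets above are Borel, so that their measures are meaningful. *)
Lemma dotp_continuous (R : realType) (d : nat) (u : 'rV[R]_d) :
  continuous (dotp u : 'rV[R]_d -> R).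
Proof.
apply: continuous_big => [|i _]; first exact: add_continuous.
move=> x; apply: (@continuous_comp _ _ _ (fun y : 'rV[R]_d => y 0 i)).
  exact: coord_continuous.
exact: mulrl_continuous.
Qed.

Lemma measurable_closed_rV (R : realType) (d : nat) (A : set (borel_rV R d)) :
  closed (A : set 'rV[R]_d) -> measurable A.
Proof.
move=> cA; rewrite -(setCK A); apply: measurableC.
by apply: sub_sigma_algebra; exact: closed_openC.
Qed.

Lemma measurable_halfspace (R : realType) (d : nat)
    (h : oriented_hyperplane R d) (s : bool) : measurable (halfspace h s).
Proof.
have cf x : {for x, continuous (dotp (normal h) : 'rV[R]_d -> R)}.
  exact: dotp_continuous.
apply: measurable_closed_rV; case: s => /=.
- by apply: (closed_comp _ (@closed_ge _ (offset h))) => x _; exact: cf.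
- by apply: (closed_comp _ (@closed_le _ (offset h))) => x _; exact: cf.
Qed.

Lemma measurable_hyperplane_set (R : realType) (d : nat)
    (h : oriented_hyperplane R d) : measurable (hyperplane_set h).
Proof.
suff -> : hyperplane_set h = halfspace h true `&` halfspace h false.
  by apply: measurableI; exact: measurable_halfspace.
apply/seteqP; split=> x /=; first by move=> ->.
by case=> h1 h2; apply/le_anti/andP.
Qed.

Lemma measurable_hyperorthant (R : realType) (d k : nat)
    (h : 'I_k -> oriented_hyperplane R d) (e : 'I_k -> bool) :
  measurable (hyperorthant h e).
Proof.
apply: fin_bigcap_measurable => [|i _]; last exact: measurable_halfspace.
exact: finite_finset.
Qed.

(* Main.v *)
(* The conditions on three hyperplanes, i.e. on three points x0, x1, z of the
   sphere of nonzero vectors (normal, offset) of R^6 up to positive scaling, are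
   15 equations on the 15-dimensional space S^5 x S^5 x S^5: for each of the two
   measures the 7 integrals of products of the signs of the three affine forms,
   and for the third measure the product of the three integrals of single signs.
   They are equivariant under sign changes and permutations of the hyperplanes,
   and have no zero with x0 = +-x1, because there the equation of the pair
   (x0, x1) for the first measure is +- its total mass. Hence the number of orbits
   of zeros under the group of order 16 generated by the sign changes and the
   exchange of x0 and x1 (a Sylow 2-subgroup of the full symmetry group) has a
   parity that does not change along homotopies respecting that pair equation.

   It is computed on a model. Up to thresholds, the model asks x0, x1, z to lie in
   the quaternions, x0 and x1 to be orthogonal to z and i z, then to be orthogonal
   to each other with <x0, j z> <x1, j z> = 0, so that {x0, x1} = {j z, k z} up to
   scaling, and finally the i, j, k components of z to vanish: one orbit of zeros.

   The parity is discrete. The spheres are boundaries of cubes with a fine grid;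
   the two maps are put at the two ends of a time interval, and maps on the
   barycentric subdivision (flags of cells) are extended affinely and perturbed
   equivariantly into general position. Among n + 2 vectors in general position in
   R^n, exactly 0 or 2 of the n + 2 subfamilies of n + 1 vectors capture the
   origin, and each inner facet lies in two flags, so the number of facets at the
   two ends that capture the origin is 0 modulo 32. The model end contributes 16,
   so for every mesh the other end contributes some facet; let the mesh tend
   to 0. *)

Require Import Defs.
From HB Require Import structures.
From mathcomp Require Import all_boot all_order all_algebra.
From mathcomp Require Import all_classical all_reals all_analysis.
From mathcomp Require Import measurable_realfun.
From mathcomp Require Import zify ring lra.

Set Implicit Arguments.
Unset Strict Implicit.
Unset Printing Implicit Defensive.

Import numFieldNormedType.Exports.
Import Order.TTheory GRing.Theory Num.Theory.

(** * Capturing the origin by facets of a simplex *)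

Section Door.
Local Open Scope ring_scope.
Variables (R : realFieldType) (n : nat).
Implicit Types (v : 'I_n.+2 -> 'rV[R]_n) (l : 'I_n.+2 -> R).

(** The facet opposite [v i] captures the origin. The weights are only required to be nonnegative
    and not all zero, since rescaling gives a convex combination. *)
Definition zero_facet v (i : 'I_n.+2) : Prop :=
  exists l, [/\ forall j, 0 <= l j, l i = 0, exists j, 0 < l j &
    \sum_j l j *: v j = 0].

(* No n of the n + 2 vectors have the origin in their convex hull. *)
Definition general_position v : Prop := forall (i j : 'I_n.+2) l,
  i != j -> (forall k, 0 <= l k) -> l i = 0 -> l j = 0 ->
  \sum_k l k *: v k = 0 -> forall k, l k = 0.

Lemma zero_facet_pos v i l : general_position v ->
  (forall j, 0 <= l j) -> l i = 0 -> (exists j, 0 < l j) ->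
  \sum_j l j *: v j = 0 -> forall j, j != i -> 0 < l j.
Proof.
move=> gv l0 li [q lq] lv j ji; rewrite lt0r l0 andbT; apply/eqP => lj.
by have := gv i j l; rewrite eq_sym ji => /(_ isT l0 li lj lv q) e; rewrite e ltxx in lq.
Qed.

(** The ratio test of linear programming: the smallest ratio [l' j / - k' j] is the first time at
    which a decreasing coordinate reaches zero. *)
Lemma first_hit (I : finType) (P : pred I) (q : I) (l' k' : I -> R) :
  P q -> (forall j, P j -> k' j < 0 /\ 0 < l' j) ->
  exists t j, [/\ P j, 0 < t, l' j + t * k' j = 0 &
    forall j, P j -> 0 <= l' j + t * k' j].
Proof.
move=> Pq H.
pose f j := l' j / - k' j.
have [j Pj jm] := @arg_minP _ R I q P f Pq.
have [kj lj] := H j Pj.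
exists (f j), j; split => //.
- by rewrite /f divr_gt0 // oppr_gt0.
- by rewrite /f invrN mulrN mulNr divfK ?subrr // lt_eqF.
- move=> i Pi; have [ki li] := H i Pi.
  have := jm i Pi; rewrite {2}/f ler_pdivlMr ?oppr_gt0 // mulrN.
  by rewrite -subr_ge0 opprK.
Qed.

(** Moving from [l] along [k] until a coordinate first vanishes gives a nonnegative relation that is
    zero at two indices. General position makes it trivial, although its weight at [p] is still
    positive. *)
Lemma no_flat_relation v i l k p q : general_position v ->
  (forall j, j != i -> 0 < l j) -> l i = 0 -> \sum_j l j *: v j = 0 ->
  \sum_j k j *: v j = 0 -> k i = 0 -> p != i -> 0 <= k p -> k q < 0 -> False.
Proof.
move=> gv lp li lv kv ki pi kp kq.
have [||t [j [kj t0 j0 tj]]] := @first_hit _ (fun j => k j < 0) q l k.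
- by [].
- move=> j kj; split => //; apply: lp; apply/eqP => ji.
  by rewrite ji ki ltxx in kj.
have ij : i != j by apply/eqP => ij; rewrite -ij ki ltxx in kj.
have l0 j' : 0 <= l j' by case: (eqVneq j' i) => [->|/lp/ltW//]; rewrite li.
pose r j' := l j' + t * k j'.
have := gv i j r ij _ _ _ _ p.
rewrite /r li ki mulr0 addr0 => H.
have: l p + t * k p = 0.
  apply: H => //.
  - move=> j'; case: (ltrP (k j') 0) => [/tj//|kj'].
    by rewrite addr_ge0 // mulr_ge0 // ltW.
  - under eq_bigr do rewrite scalerDl -scalerA.
    by rewrite big_split /= -scaler_sumr lv kv scaler0 addr0.
have: 0 < l p + t * k p by rewrite ltr_pwDl ?lp // mulr_ge0 // ltW.
by move=> /[swap] ->; rewrite ltxx.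
Qed.

Lemma dependent_rows v p : exists k : 'I_n.+2 -> R,
  [/\ k p = 0, exists q, k q != 0 & \sum_j k j *: v j = 0].
Proof.
(* The extra last column is the indicator of [p], which forces the coefficient at [p] to vanish;
   there is still one row more than there are columns. *)
pose A : 'M[R]_(n.+2, n.+1) :=
  \matrix_(i, j) (if unlift ord_max j is Some j' then v i 0 j' else (i == p)%:R).
have nfree : ~~ row_free A.
  by rewrite /row_free neq_ltn ltnS rank_leq_col.
rewrite -kermx_eq0 -nz_row_eq0 in nfree.
pose u := nz_row (kermx A).
have uA : u *m A = 0 by apply/sub_kermxP; exact: nz_row_sub.
exists (fun j => u 0 j); split.
- have /matrixP/(_ 0 ord_max) := uA; rewrite !mxE (bigD1 p) //= big1 => [|j jp].
    by rewrite mxE unlift_none eqxx mulr1 addr0.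
  by rewrite mxE unlift_none (negPf jp) mulr0.
- by apply/rV0Pn.
- apply/rowP => j; have /matrixP/(_ 0 (lift ord_max j)) := uA.
  rewrite mxE [RHS]mxE => uAj; rewrite summxE mxE -[RHS]uAj.
  by apply: eq_bigr => i _; rewrite !mxE liftK.
Qed.

(** A pivot step: raise the weight of [v i] from 0, keeping a relation, until another weight first
    drops to 0. *)
Lemma second_zero_facet v i : general_position v -> zero_facet v i ->
  exists2 j, j != i & zero_facet v j.
Proof.
move=> gv [l [l0 li lex lv]].
have lp := zero_facet_pos gv l0 li lex lv.
have [p pi] : exists p : 'I_n.+2, p != i.
  case: (eqVneq ord0 i) => [<-|?]; last by exists ord0.
  by exists ord_max.
have [k [kp [q kq] kv]] := dependent_rows v p.
have ki : k i != 0.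
  apply/eqP => ki.
  case: (ltrgtP (k q) 0) => [kq0|kq0|kq0]; last by rewrite kq0 eqxx in kq.
  - by apply: (no_flat_relation gv lp li lv kv ki pi _ kq0); rewrite kp.
  - apply: (@no_flat_relation v i l (fun j => - k j) p q gv lp li lv) => //.
    + by under eq_bigr do rewrite scaleNr; rewrite sumrN kv oppr0.
    + by rewrite ki oppr0.
    + by rewrite kp oppr0.
    + by rewrite oppr_lt0.
(* Subtracting this large a multiple of [l] makes every coefficient other than the one at [i]
   negative, as [first_hit] requires. *)
pose s := 1 + \sum_(j | j != i) `|k j / k i| / l j.
have sP j : j != i -> k j / k i < s * l j.
  move=> ji; rewrite mulrDl mul1r mulr_suml (bigD1 j) //= divfK ?gt_eqF ?lp //.
  rewrite addrCA -[ltLHS]addr0; apply: ler_ltD; first exact: ler_norm.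
  rewrite ltr_pwDl ?lp //; apply: sumr_ge0 => j' /andP[j'i _].
  by rewrite !mulr_ge0 ?invr_ge0 ?l0.
pose k' j := k j / k i - s * l j.
have k'i : k' i = 1 by rewrite /k' li mulr0 subr0 divff.
have k'v : \sum_j k' j *: v j = 0.
  under eq_bigr do rewrite scalerBl mulrC -!scalerA.
  by rewrite sumrB -!scaler_sumr kv lv !scaler0 subr0.
have [||t [j [ji t0 j0 tj]]] := @first_hit _ (predC1 i) p l k'; first by [].
  by move=> j ji; split; [rewrite subr_lt0 sP|rewrite lp].
exists j => //; exists (fun j => l j + t * k' j); split => //.
- by move=> j'; case: (eqVneq j' i) => [->|/tj//]; rewrite li k'i mulr1 add0r ltW.
- by exists i; rewrite li k'i mulr1 add0r.
- under eq_bigr do rewrite scalerDl -scalerA.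
  by rewrite big_split /= -scaler_sumr lv k'v scaler0 addr0.
Qed.

(** Scale the relations of [j] and [k] to weight 1 at [i] and subtract: the difference vanishes at
    [i], is nonnegative at [k] and negative at [j], which [no_flat_relation] excludes. *)
Lemma third_zero_facet v i j k : general_position v ->
  zero_facet v i -> zero_facet v j -> zero_facet v k ->
  j != i -> k != i -> j = k.
Proof.
move=> gv [l [l0 li lex lv]] [lj [lj0 ljj ljex ljv]] [lk [lk0 lkk lkex lkv]] ji ki.
have lp := zero_facet_pos gv l0 li lex lv.
have pj := zero_facet_pos gv lj0 ljj ljex ljv.
have pk := zero_facet_pos gv lk0 lkk lkex lkv.
apply/eqP; apply: boolp.contrapT => /negP jk.
have lji : 0 < lj i by apply: pj; rewrite eq_sym.
have lki : 0 < lk i by apply: pk; rewrite eq_sym.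
pose d q := lj q / lj i - lk q / lk i.
apply: (@no_flat_relation v i l d k j gv lp li lv) => //.
- under eq_bigr do rewrite scalerBl mulrC (mulrC (lk _)) -!scalerA.
  by rewrite sumrB -!scaler_sumr ljv lkv !scaler0 subr0.
- by rewrite /d !divff ?gt_eqF // subrr.
- by rewrite /d lkk mul0r subr0 divr_ge0 ?ltW // pj // eq_sym.
- by rewrite /d ljj mul0r sub0r oppr_lt0 divr_gt0 // pk.
Qed.

Lemma card_zero_facets v : general_position v ->
  (exists i, zero_facet v i) -> #|[pred i | `[< zero_facet v i >]]| = 2%N.
Proof.
move=> gv [i zi]; have [j ji zj] := second_zero_facet gv zi.
have -> : 2%N = #|pred2 i j| by rewrite card2 eq_sym ji.
apply: eq_card => k; rewrite !inE; apply/asboolP/orP => [zk|[/eqP->//|/eqP->//]].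
case: (eqVneq k i) => [|ki]; first by left.
by right; apply/eqP; rewrite (@third_zero_facet v i j k).
Qed.
End Door.

(** * Flags of cells of the cubical grid *)

(** Doubled coordinates run from 0 to twice this number. It is even, so that the centre of the cube
    is a grid point, where the zeros of the model have most of their coordinates. *)
Definition half_width (m : nat) : nat := m.+1.*2.
Arguments half_width m : simpl never.
(** [Some (b, k)] is coordinate [k] in the cube of hyperplane [b], and [None] is time. *)
Definition idx : finType := option ('I_3 * 'I_6).
(* A cell of the cubical grid, given by the doubled coordinates of its
   barycentre: an even value is a grid point, an odd one an open unit
   interval. *)
Definition cell (m : nat) : finType := {ffun idx -> 'I_(half_width m).*2.+1}.

Section Cells.
Variable m : nat.
Implicit Types (a b c : cell m) (i j k : idx).

(** [c] is a facet of the cell [c'], and [i] is the direction fixed in [c] and free in [c']. *)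
Definition frees c c' i : bool :=
  [&& ~~ odd (c i), (c' i == (c i).+1 :> nat) || (c i == (c' i).+1 :> nat) &
      [forall j, (j != i) ==> (c' j == c j)]].

Definition cover c c' : bool := [exists i, frees c c' i].

Definition setc c i (x : 'I_(half_width m).*2.+1) : cell m :=
  [ffun j => if j == i then x else c j].

Definition odd_set c : {set idx} := [set i | odd (c i)]%SET.

Definition boundary_at c (i : idx) : bool :=
  (c i == 0 :> nat) || (c i == (half_width m).*2 :> nat).

(* The spheres are the boundaries of three cubes; time is an interval. *)
Definition valid c : bool :=
  [forall b : 'I_3, exists k : 'I_6, boundary_at c (Some (b, k))] && (c None <= 2).

Lemma freesP c c' i : reflect
  [/\ ~~ odd (c i), odd (c' i), (c' i = (c i).+1 :> nat) \/ (c i = (c' i).+1 :> nat) &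
      forall j, j != i -> c' j = c j] (frees c c' i).
Proof.
apply: (iffP and3P) => [[ci /orP ci' /forallP H]|[ci _ ci' H]]; split => //.
- by move: ci ci'; case=> /eqP; lia.
- by case: ci' => /eqP; [left|right].
- by move=> j ji; apply/eqP; exact: (implyP (H j)).
- by apply/orP; case: ci' => ->; rewrite eqxx; [left|right].
- by apply/forallP => j; apply/implyP => /H->.
Qed.

Lemma frees_odd_set c c' i : frees c c' i -> odd_set c' = (i |: odd_set c)%SET.
Proof.
case/freesP => ci ci' _ H; apply/setP => j; rewrite !inE.
by case: eqVneq => [->|/H->].
Qed.

Lemma frees_card c c' i : frees c c' i -> #|odd_set c'| = #|odd_set c|.+1.
Proof.
move=> f; rewrite (frees_odd_set f) cardsU1 inE.
by case/freesP: f => -> _ _ _; rewrite add1n.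
Qed.

Lemma frees_inj c c' c'' i : frees c c' i -> frees c c'' i -> c' i = c'' i -> c' = c''.
Proof.
move=> /freesP[_ _ _ H] /freesP[_ _ _ H'] e; apply/ffunP => j.
by case: (eqVneq j i) => [->//|ji]; rewrite H ?H'.
Qed.

Lemma cover_card c c' : cover c c' -> #|odd_set c'| = #|odd_set c|.+1.
Proof. by move=> /existsP[i /frees_card]. Qed.

(** The diamond property of the face order: the two directions freed between [a] and [c] can be
    freed in either order. *)
Lemma middle a b c : cover a b -> cover b c ->
  exists b', [/\ b' != b, cover a b', cover b' c &
    forall b'', cover a b'' -> cover b'' c -> b'' = b \/ b'' = b'].
Proof.
move=> /existsP[i fi] /existsP[j fj].
have [ai bi abi Hi] := freesP _ _ _ fi; have [bj cj bcj Hj] := freesP _ _ _ fj.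
have ij : i != j by apply: contraL bi => /eqP ->.
have ji : j != i by rewrite eq_sym.
have aj : b j = a j by rewrite Hi.
have ci : c i = b i by rewrite Hj.
exists (setc a j (c j)); split.
- by apply/eqP => /ffunP/(_ i); rewrite ffunE (negPf ij) => e; rewrite -e in bi; rewrite bi in ai.
- apply/existsP; exists j; apply/freesP; rewrite ffunE eqxx -aj; split => //.
  by move=> k kj; rewrite ffunE (negPf kj).
- apply/existsP; exists i; apply/freesP; rewrite ffunE (negPf ij) ci; split => //.
  move=> k ki; rewrite ffunE; case: (eqVneq k j) => [->//|kj].
  by rewrite Hj ?Hi.
- move=> b'' /existsP[i' /freesP[ai' b''i' ab'' Hi']] /existsP[j' /freesP[b''j' cj' bc'' Hj']].
  have i'j' : i' != j' by apply: contraNneq b''j' => <-.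
  have ci' : c i' = b'' i' by rewrite Hj'.
  have i'ij : (i' == i) || (i' == j).
    apply/negP => /negP; rewrite negb_or => /andP[i'i i'j].
    by move: ci'; rewrite Hj ?Hi // => e; rewrite -e in b''i'; rewrite b''i' in ai'.
  case/orP: i'ij => /eqP e; [left|right]; apply/ffunP => k; rewrite ?ffunE.
  + case: (eqVneq k i) => [->|ki]; first by rewrite -ci -e -ci'.
    by rewrite Hi' ?Hi // e.
  + case: (eqVneq k j) => [->|kj]; first by rewrite -e ci'.
    by rewrite Hi' // e.
Qed.

(** An edge has exactly two end points. *)
Lemma bottom a b : odd_set a = finset.set0 -> cover a b -> valid b ->
  exists a', [/\ a' != a, odd_set a' = finset.set0, cover a' b &
    forall a'', odd_set a'' = finset.set0 -> cover a'' b -> a'' = a \/ a'' = a'].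
Proof.
move=> a0 /existsP[i fi] vb; have [ai bi abi Hi] := freesP _ _ _ fi.
have bo : odd_set b = [set i]%SET by rewrite (frees_odd_set fi) a0 finset.setU0.
have lt1 : (b i).-1 < (half_width m).*2.+1 by have := ltn_ord (b i); lia.
have lt2 : (b i).+1 < (half_width m).*2.+1 by have := ltn_ord (b i); move: bi; lia.
pose x : 'I_(half_width m).*2.+1 :=
  if (a i == (b i).+1 :> nat) then Ordinal lt1 else Ordinal lt2.
have [xa bx] : (x : nat) <> a i /\ ((b i = x.+1 :> nat) \/ (x = (b i).+1 :> nat)).
  rewrite /x; case: eqP => e /=.
    by split; [|left]; move: bi e; move: (nat_of_ord (b i)) (nat_of_ord (a i)) => u v; lia.
  by split; [move: abi e; move: (nat_of_ord (b i)) (nat_of_ord (a i)) => u v; lia|right].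
have ex : ~~ odd x by case: bx; move: bi; lia.
have even_a'' a'' j : odd_set a'' = finset.set0 -> ~~ odd (a'' j).
  by move=> /setP/(_ j); rewrite !inE => ->.
have eb j : j != i -> ~~ odd (b j).
  by move=> ji; have /setP/(_ j) := bo; rewrite !inE (negPf ji) => ->.
exists (setc b i x); split.
- by apply/eqP => /ffunP/(_ i); rewrite ffunE eqxx => e; apply: xa; rewrite e.
- apply/setP => j; rewrite !inE ffunE; case: (eqVneq j i) => [_|/eb/negPf//].
  by rewrite (negPf ex).
- apply/existsP; exists i; apply/freesP; rewrite ffunE eqxx; split => //.
  by move=> j ji; rewrite ffunE (negPf ji).
- move=> a'' a''0 /existsP[j fj]; have [a''j bj abj Hj] := freesP _ _ _ fj.
  have ji : j = i by apply/eqP; apply: contraLR bj => /eb.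
  rewrite ji in abj Hj a''j.
  have : a'' i = a i \/ a'' i = x.
    case: (eqVneq (a'' i) (a i)) => [|n]; [by left|right].
    have {}n : (a'' i : nat) <> a i by move=> /val_inj e; rewrite e eqxx in n.
    apply/val_inj => /=; move: xa n abj abi bx.
    by move: (nat_of_ord x) (nat_of_ord (a'' i)) (nat_of_ord (a i)) (nat_of_ord (b i)); lia.
  by case=> e; [left|right]; apply/ffunP => k; rewrite ?ffunE;
    case: (eqVneq k i) => [->//|ki]; rewrite -Hj // ?Hi.
Qed.

Lemma valid_cover a b : cover a b -> valid b -> valid a.
Proof.
move=> /existsP[i /freesP[ai bi ab H]] /andP[/forallP vb tb]; apply/andP; split.
- apply/forallP => β; have /existsP[k bk] := vb β; apply/existsP; exists k.
  rewrite /boundary_at -H //; apply: contraTneq bi => <-.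
  by case/orP: bk => /eqP->; rewrite ?odd_double.
- case: (eqVneq None i) => [e|ni]; last by rewrite -H.
  rewrite -e in ab bi; move: tb ab bi.
    by move: (nat_of_ord (a None)) (nat_of_ord (b None)); lia.
Qed.

Lemma card_idx : #|idx| = 19.
Proof. by rewrite card_option card_prod !card_ord. Qed.

(** A top cell has 19 - 16 = 3 even coordinates, and each of the three blocks already needs one of
    them to lie on the boundary of its cube. *)
Lemma top_even b : valid b -> #|odd_set b| = 16 -> exists e : 'I_3 -> 'I_6,
  (forall β, boundary_at b (Some (β, e β))) /\
  forall i, ~~ odd (b i) -> exists β, i = Some (β, e β).
Proof.
move=> /andP[/forallP vb _] cb.
pose e β := xchoose (existsP (vb β)).
have eP β : boundary_at b (Some (β, e β)) by exact: (xchooseP (existsP (vb β))).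
exists e; split => //.
have ev β : ~~ odd (b (Some (β, e β))).
  by case/orP: (eP β) => /eqP->; rewrite ?odd_double.
pose E : {set idx} := [set Some (β, e β) | β in 'I_3]%SET.
have cE : #|E| = 3.
  by rewrite card_imset ?card_ord // => β β' [].
have sE : E \subset ~: odd_set b.
  by apply/fintype.subsetP => i /imsetP[β _ ->]; rewrite !inE.
have EE : E = (~: odd_set b)%SET.
  by apply/eqP; rewrite eqEcard sE cE cardsCs finset.setCK card_idx cb.
move=> i bi; have : i \in E by rewrite EE !inE.
by case/imsetP => β _ ->; exists β.
Qed.

(** Over a cell of dimension 15 at a fixed time the only direction left to free is time, and the
    time interval has the single inner value 1. *)
Lemma top_time a b b' : #|odd_set a| = 15 -> ~~ odd (a None) ->
  cover a b -> valid b -> cover a b' -> valid b' -> b = b'.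
Proof.
move=> ca aN.
have H c : cover a c -> valid c -> frees a c None /\ c None = 1 :> nat.
  move=> /existsP[i fi] vc; have cc : #|odd_set c| = 16 by rewrite (frees_card fi) ca.
  have [e [_ ee]] := top_even vc cc.
  have oN : odd (c None) by apply/negP => /negP/ee[].
  have iN : i = None.
    by apply/eqP; case/freesP: fi => _ _ _ Hi; apply: contraNT aN; rewrite eq_sym => /Hi <-.
  rewrite iN in fi; split => //.
  by case/andP: vc => _; move: oN; case: (c None : nat) => [|[|[|]]].
move=> cb vb cb' vb'; have [fb b1] := H _ cb vb; have [fb' b1'] := H _ cb' vb'.
by apply: (frees_inj fb fb'); apply/val_inj; rewrite /= b1 b1'.
Qed.

Lemma boundary_even c i : boundary_at c i -> ~~ odd (c i).
Proof. by case/orP => /eqP->; rewrite ?odd_double. Qed.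

Lemma top_other a b i (e : 'I_3 -> 'I_6) : frees a b i -> valid b ->
  (forall β, boundary_at b (Some (β, e β))) ->
  forall j (x : 'I_(half_width m).*2.+1) β, j != None -> odd x ->
  (x = (a j).+1 :> nat) \/ (a j = x.+1 :> nat) -> ~~ odd (a j) ->
  (forall γ, γ != β -> j != Some (γ, e γ)) ->
  (exists2 k, j != Some (β, k) & boundary_at a (Some (β, k))) ->
  cover a (setc a j x) /\ valid (setc a j x).
Proof.
move=> fi vb eb j x β jN ox ajx aj jγ [k jk kb]; split.
  apply/existsP; exists j; apply/freesP; rewrite ffunE eqxx; split => //.
  by move=> l lj; rewrite ffunE (negPf lj).
have va : valid a by apply: valid_cover vb; apply/existsP; exists i.
apply/andP; split; last by rewrite ffunE [_ == j]eq_sym (negPf jN); case/andP: va.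
apply/forallP => γ; apply/existsP; case: (eqVneq γ β) => [->|γβ].
  by exists k; rewrite /boundary_at ffunE [_ == j]eq_sym (negPf jk).
exists (e γ); rewrite /boundary_at ffunE [_ == j]eq_sym (negPf (jγ _ γβ)).
have [ai bi abi Hi] := freesP _ _ _ fi.
have := eb γ; rewrite /boundary_at -Hi //.
by apply: contraNneq (boundary_even (eb γ)) => ->.
Qed.

Lemma inward_unique (W a x y : nat) : (a == 0) || (a == W.*2) ->
  x < W.*2.+1 -> y < W.*2.+1 -> x = a.+1 \/ a = x.+1 -> y = a.+1 \/ a = y.+1 -> x = y.
Proof. lia. Qed.

(** The product of the three cube boundaries with the time interval is a manifold: away from the two
    ends, a cell of codimension one lies in exactly two top cells. *)
Lemma top a b : #|odd_set a| = 15 -> odd (a None) -> cover a b -> valid b ->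
  exists b', [/\ b' != b, cover a b', valid b' &
    forall b'', cover a b'' -> valid b'' -> b'' = b \/ b'' = b'].
Proof.
move=> ca aN /existsP[i fi] vb.
have [ai bi abi Hi] := freesP _ _ _ fi.
have cb : #|odd_set b| = 16 by rewrite (frees_card fi) ca.
have [e [eb ee]] := top_even vb cb.
have iN : i != None by apply: contraNneq ai => ->.
case: i iN fi ai bi abi Hi => [[β k]|//] _ fi ai bi abi Hi.
set i := Some (β, k) in fi ai bi abi Hi *.
set j := Some (β, e β).
have ij : i != j.
  by apply: contraTneq bi => ->; exact: boundary_even (eb β).
have ji : j != i by rewrite eq_sym.
have aj : b j = a j by rewrite Hi.
have jb : boundary_at a j by have := eb β; rewrite /boundary_at aj.
have jβ γ : γ != β -> j != Some (γ, e γ).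
  by move=> γβ; apply: contra γβ => /eqP[->].
have iβ γ : γ != β -> i != Some (γ, e γ).
  by move=> γβ; apply: contra γβ => /eqP[->].
have aev l : ~~ odd (a l) -> l = i \/ exists γ, l = Some (γ, e γ).
  case: (eqVneq l i) => [|li al]; [by left|right].
  by apply: ee; rewrite Hi.
(* The block of the freed direction must keep a boundary coordinate. The even coordinates of [a] are
   [i] and the three chosen ones, so only [i] can be freed, or else [j] when [a] is on the boundary
   along [i] as well. *)
have i''P b'' i'' : frees a b'' i'' -> valid b'' ->
    i'' = i \/ (i'' = j /\ boundary_at a i).
  move=> f vb''; have [ai'' bi'' abi'' Hi''] := freesP _ _ _ f.
  have [->|[γ i''E]] := aev _ ai''; first by left.
  have [e'' [eb'' _]] := top_even vb'' (etrans (frees_card f) (congr1 S ca)).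
  have ki'' : Some (γ, e'' γ) != i''.
    by apply: contraTneq bi'' => <-; exact: boundary_even.
  have := eb'' γ; rewrite /boundary_at Hi'' // -/(boundary_at a _) => kb.
  have [kE|[γ' kE]] := aev _ (boundary_even kb).
    right; rewrite -kE; split => //.
    by rewrite i''E /j; case: kE => ->.
  by case: kE i''E ki'' => <- -> ->; rewrite eqxx.
have W0 : 0 < half_width m by [].
(* On a ridge of the cube the two top cells free [i] and [j] respectively, each inward. Otherwise
   [a] is inner along [i] and they are its two neighbours in that direction. *)
case: (boolP (boundary_at a i)) => aib.
- have [x [ox ajx xu]] : exists x : 'I_(half_width m).*2.+1, [/\ odd x,
      (x = (a j).+1 :> nat) \/ (a j = x.+1 :> nat) &
      forall y : 'I_(half_width m).*2.+1,
        (y = (a j).+1 :> nat) \/ (a j = y.+1 :> nat) -> y = x].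
    case/orP: jb => /eqP E; rewrite E.
    + have lt1 : 1 < (half_width m).*2.+1 by move: W0; move: (half_width m); lia.
      exists (Ordinal lt1); split; [by []|by left|].
      by move=> y [yE|//]; apply/val_inj; rewrite /= yE.
    + have lt1 : (half_width m).*2 - 1 < (half_width m).*2.+1 by move: W0; move: (half_width m); lia.
      exists (Ordinal lt1); split; [| right|] => /=; try by move: W0; move: (half_width m); lia.
      move=> y yE; apply/val_inj => /=; have := ltn_ord y; move: yE.
      by move: (nat_of_ord y) W0; move: (half_width m); lia.
  have [] := @top_other a b i e fi vb eb j x β isT ox ajx (boundary_even jb) jβ.
    by exists k.
  exists (setc a j x); split => //.
  + apply/eqP => /ffunP/(_ i); rewrite ffunE (negPf ij) => E.
    by rewrite -E (negPf ai) in bi.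
  + move=> b'' /existsP[i'' f] vb''; have [ai'' bi'' abi'' Hi''] := freesP _ _ _ f.
    have [E|[E _]] := i''P _ _ f vb''; rewrite E in f abi''; [left|right].
      apply: (frees_inj f fi); apply/val_inj => /=.
      exact: (inward_unique aib (ltn_ord _) (ltn_ord _) abi'' abi).
    apply/ffunP => l; rewrite ffunE; case: (eqVneq l j) => [->|lj]; last by rewrite Hi'' ?E.
    exact: xu.
- have [x [ox aix xb xu]] : exists x : 'I_(half_width m).*2.+1, [/\ odd x,
      (x = (a i).+1 :> nat) \/ (a i = x.+1 :> nat), x != b i &
      forall y : 'I_(half_width m).*2.+1,
        (y = (a i).+1 :> nat) \/ (a i = y.+1 :> nat) -> y = b i \/ y = x].
    move: aib; rewrite /boundary_at => /norP[/eqP n0 /eqP n1].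
    have lt1 : (a i).-1 < (half_width m).*2.+1.
      by have := ltn_ord (a i); move: (nat_of_ord (a i)); move: (half_width m); lia.
    have lt2 : (a i).+1 < (half_width m).*2.+1.
      by have := ltn_ord (a i); move: n1; move: (nat_of_ord (a i)); move: (half_width m); lia.
    case: abi => E.
    + exists (Ordinal lt1); split => /=.
      * by move: ai n0; move: (nat_of_ord (a i)); lia.
      * by right; move: n0; move: (nat_of_ord (a i)); lia.
      * apply/eqP => /(congr1 val) /=; move: E.
        by move: (nat_of_ord (a i)) (nat_of_ord (b i)); lia.
      * move=> y [yE|yE]; [left|right]; apply/val_inj; rewrite /= ?E ?yE //.
    + exists (Ordinal lt2); split => /=.
      * by move: ai; move: (nat_of_ord (a i)); lia.
      * by left.
      * apply/eqP => /(congr1 val) /=; move: E.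
        by move: (nat_of_ord (a i)) (nat_of_ord (b i)); lia.
      * move=> y [yE|yE]; [right|left]; apply/val_inj; rewrite /= ?yE //.
        by move: yE; rewrite E => -[].
  have [] := @top_other a b i e fi vb eb i x β isT ox aix ai iβ.
    by exists (e β).
  exists (setc a i x); split => //.
  + by apply/eqP => /ffunP/(_ i); rewrite ffunE eqxx; apply/eqP.
  + move=> b'' /existsP[i'' f] vb''; have [ai'' bi'' abi'' Hi''] := freesP _ _ _ f.
    have [E|[_ aib']] := i''P _ _ f vb''; last by rewrite aib' in aib.
    rewrite E in f abi''.
    have [E'|E'] := xu _ abi''; [left|right]; first exact: (frees_inj f fi).
    by apply/ffunP => l; rewrite ffunE; case: (eqVneq l i) => [->//|lj]; rewrite Hi'' ?E.
Qed.
End Cells.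

(** * Counting by fibres and by free orbits *)

Section Counting.

Lemma card_fibres (T U : finType) (f : T -> U) (A : {set T}) n :
  (forall x, x \in A -> #|[set x' in A | f x' == f x]%SET| = n) ->
  #|A| = (#|(f @: A)%SET| * n)%N.
Proof.
move=> H; rewrite -sum1_card (partition_big_imset f) /= -sum_nat_const.
apply: eq_bigr => y /imsetP[x xA ->]; rewrite -(H x xA) -sum1_card.
by apply: eq_bigl => x'; rewrite !inE.
Qed.

(** [S] is a disjoint union of orbits of size [#|H|]. The group laws are stated through the action,
    so that the lemma serves both flags and facets. *)
Lemma dvdn_card_free (H T : finType) (act : H -> T -> T) (S : {set T}) :
  (forall h x, x \in S -> act h x \in S) ->
  (exists e, forall x, act e x = x) ->
  (forall h h', exists h'', forall x, act h (act h' x) = act h'' x) ->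
  (forall h, exists h', forall x, act h' (act h x) = x) ->
  (forall x, x \in S -> injective (act^~ x)) ->
  #|H| %| #|S|.
Proof.
move=> actS [e eE] actM actV actI.
pose orb x : {set T} := [set act h x | h in H]%SET.
have orbE x y : y \in orb x -> orb y = orb x.
  move=> /imsetP[h _ ->]; apply/setP => z; apply/imsetP/imsetP => -[h' _ ->].
    by have [h'' ->] := actM h' h; exists h''.
  have [g gh] := actV h; have [h'' E] := actM h' g; exists h'' => //.
  by rewrite -E gh.
have mem_orb x : x \in orb x by apply/imsetP; exists e.
rewrite (@card_fibres _ _ orb S #|H|) ?dvdn_mull // => x xS.
have -> : [set x' in S | orb x' == orb x]%SET = orb x.
  apply/setP => y; rewrite inE; apply/andP/idP => [[_ /eqP <-]//|yx].
  split; last by rewrite (orbE _ _ yx).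
  by case/imsetP: yx => h _ ->; exact: actS.
by rewrite card_imset //; exact: actI.
Qed.
End Counting.

(** * The symmetry group of order 16 *)

Definition r0 : 'I_3 := @Ordinal 3 0 isT.
Definition r1 : 'I_3 := @Ordinal 3 1 isT.
Definition r2 : 'I_3 := @Ordinal 3 2 isT.

Lemma ord3P (P : 'I_3 -> Prop) : P r0 -> P r1 -> P r2 -> forall b, P b.
Proof.
move=> p0 p1 p2 [[|[|[|//]]] lb].
- by have -> : Ordinal lb = r0 by apply/val_inj.
- by have -> : Ordinal lb = r1 by apply/val_inj.
- by have -> : Ordinal lb = r2 by apply/val_inj.
Qed.

(* Sign changes of the three hyperplanes and the exchange of the first two. *)
Definition symm : finType := ({ffun 'I_3 -> bool} * bool)%type.

Definition sw (w : bool) (b : 'I_3) : 'I_3 :=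
  if w then (if b == r0 then r1 else if b == r1 then r0 else b) else b.

Definition mulh (h g : symm) : symm :=
  ([ffun b => h.1 b (+) g.1 (sw h.2 b)], h.2 (+) g.2).
Definition invh (h : symm) : symm := ([ffun b => h.1 (sw h.2 b)], h.2).
Definition oneh : symm := ([ffun=> false], false).

Lemma swD w w' b : sw w (sw w' b) = sw (w (+) w') b.
Proof. by case: w; case: w'; elim/ord3P: b. Qed.

Lemma card_symm : #|symm| = 16.
Proof. by rewrite card_prod card_ffun card_ord card_bool. Qed.

(** * The symmetries on cells and flags, and the parity of boundary facets *)

Section Flags.
Variable m : nat.
Implicit Types (c a b : cell m) (h g : symm).

(** A sign change of a block is the central reflection of its cube, that is, the reversal of its
    doubled coordinates. *)
Definition actc h c : cell m := [ffun i : idx =>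
  if i is Some (b, k) then
    if h.1 b then rev_ord (c (Some (sw h.2 b, k))) else c (Some (sw h.2 b, k))
  else c None].

Lemma actcM h g c : actc h (actc g c) = actc (mulh h g) c.
Proof.
apply/ffunP => -[[b k]|]; rewrite /actc /mulh !ffunE //= ?ffunE swD [h.2 (+) _]addbC.
by case: (h.1 b); case: (g.1 _) => //=; rewrite rev_ordK.
Qed.

Lemma actc1 c : actc oneh c = c.
Proof. by apply/ffunP => -[[b k]|]; rewrite /actc ffunE //= ffunE. Qed.

Lemma invhK h : mulh (invh h) h = oneh.
Proof. by rewrite /mulh /oneh /= addbb; congr pair; apply/ffunP => b; rewrite !ffunE /= addbb. Qed.

Lemma actcK h c : actc (invh h) (actc h c) = c.
Proof. by rewrite actcM invhK actc1. Qed.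

Lemma rev_half (x : 'I_(half_width m).*2.+1) : odd (rev_ord x) = odd x.
Proof. by rewrite /= subSS oddB ?odd_double // -ltnS. Qed.

Lemma odd_actc h c i : odd (actc h c i) =
  odd (c (if i is Some (b, k) then Some (sw h.2 b, k) else None)).
Proof.
rewrite ffunE; case: i => [[b k]|//]; case: (h.1 b) => //.
by rewrite rev_half.
Qed.

Definition act_idx h (i : idx) : idx := if i is Some (b, k) then Some (sw h.2 b, k) else None.

Lemma act_idxK h : involutive (act_idx h).
Proof. by case=> [[b k]|//] /=; rewrite swD addbb. Qed.

Lemma odd_set_actc h c : odd_set (actc h c) = (act_idx h @^-1: odd_set c)%SET.
Proof. by apply/setP => i; rewrite !inE odd_actc; case: i => [[]|]. Qed.

Lemma card_odd_set_actc h c : #|odd_set (actc h c)| = #|odd_set c|.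
Proof.
rewrite odd_set_actc on_card_preimset //; apply: onW_bij.
exact: inv_bij (act_idxK h).
Qed.

Lemma frees_actc h a b i : frees a b i -> frees (actc h a) (actc h b) (act_idx h i).
Proof.
have ki := act_idxK h i.
case/freesP => ai bi ab H; apply/freesP; rewrite !odd_actc -!/(act_idx h _) ki; split => //.
- move: ab; rewrite !ffunE; case: i ki {H} ai bi => [[β k]|//] /= [->] ai bi.
  case: (h.1 _) => //=; rewrite !subSS.
  have := ltn_ord (a (Some (β, k))); have := ltn_ord (b (Some (β, k))).
  by move: (nat_of_ord (a _)) (nat_of_ord (b _)); move: (half_width m); lia.
- move=> j ji; rewrite !ffunE; case: j ji => [[β k]|] ji.
  + rewrite H //; apply: contra ji => /eqP <-.
    by rewrite /= swD addbb.
  + by rewrite H //; case: (i) ji => // -[].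
Qed.

Lemma cover_actc h a b : cover a b -> cover (actc h a) (actc h b).
Proof. by case/existsP => i f; apply/existsP; exists (act_idx h i); exact: frees_actc. Qed.

Lemma boundary_actc h c (b : 'I_3) (k : 'I_6) :
  boundary_at (actc h c) (Some (b, k)) = boundary_at c (Some (sw h.2 b, k)).
Proof.
rewrite /boundary_at ffunE; case: (h.1 b) => //=.
have := ltn_ord (c (Some (sw h.2 b, k))); rewrite subSS.
by move: (nat_of_ord _); move: (half_width m); lia.
Qed.

Lemma valid_actc h c : valid c -> valid (actc h c).
Proof.
case/andP => /forallP v t; apply/andP; split; last by rewrite ffunE.
apply/forallP => b; have /existsP[k vk] := v (sw h.2 b).
by apply/existsP; exists k; rewrite boundary_actc.
Qed.

(* Simplices of maximal dimension of the barycentric subdivision. *)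
Definition flagT : finType := {ffun 'I_17 -> cell m}.
Implicit Types (C D : flagT).

Definition vert C n : cell m := C (inord n).

Definition flag C : bool := [&& odd_set (vert C 0) == finset.set0,
  [forall k : 'I_16, cover (vert C k) (vert C k.+1)] & valid (vert C 16)].

Lemma flag_cover C n : flag C -> n < 16 -> cover (vert C n) (vert C n.+1).
Proof. by case/and3P => _ /forallP H _ ln; exact: (H (Ordinal ln)). Qed.

Lemma flag_card C n : flag C -> n <= 16 -> #|odd_set (vert C n)| = n.
Proof.
move=> fC; elim: n => [_|n IH ln]; first by case/and3P: fC => /eqP->; rewrite cards0.
by rewrite (cover_card (flag_cover fC ln)) IH // ltnW.
Qed.

Lemma flag_valid C n : flag C -> n <= 16 -> valid (vert C n).
Proof.
move=> fC ln; rewrite -(subKn ln); elim: (16 - n) (leq_subr n 16) => [_|k IH lk].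
  by case/and3P: fC.
have E : ((16 - k.+1).+1 = 16 - k)%N by lia.
by apply: valid_cover (IH (ltnW lk)); rewrite -E; apply: flag_cover; lia.
Qed.

Definition upd C (k : 'I_17) c : flagT := [ffun j => if j == k then c else C j].

(** The part of the flag condition that involves the [k]-th cell, with [c] in its place. *)
Definition fits C (k : 'I_17) c : bool :=
  [&& (k == 0 :> nat) ==> (odd_set c == finset.set0),
      (0 < k) ==> cover (vert C k.-1) c,
      (k < 16) ==> cover c (vert C k.+1) & (k == 16 :> nat) ==> valid c].

Lemma vert_upd C k c n : n <= 16 ->
  vert (upd C k c) n = if n == k then c else vert C n.
Proof. by move=> ln; rewrite /vert ffunE -val_eqE /= inordK. Qed.

Lemma fits_flag C k : flag C -> fits C k (C k).
Proof.
move=> fC; have vk : C k = vert C k by rewrite /vert inord_val.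
apply/and4P; rewrite vk; split; apply/implyP.
- by move=> /eqP->; case/and3P: fC.
- by case: (k : nat) (ltn_ord k) => // n ln _; apply: flag_cover.
- by move=> lk; apply: flag_cover.
- by move=> /eqP->; case/and3P: fC.
Qed.

Lemma flag_upd C k c : flag C -> fits C k c -> flag (upd C k c).
Proof.
move=> fC /and4P[/implyP f0 /implyP f1 /implyP f2 /implyP f3]; apply/and3P; split.
- by rewrite vert_upd //; case: ifP => [/eqP k0|_]; [apply: f0; rewrite -k0|case/and3P: fC].
- apply/forallP => j; have lj := ltn_ord j; rewrite !vert_upd //; last exact: ltnW.
  case: (eqVneq (j : nat) k) => [E|n].
    have -> : (j.+1 == k :> nat) = false by apply/eqP; lia.
    by rewrite E; apply: f2; rewrite -E.
  case: (eqVneq j.+1 (k : nat)) => [E|n']; first by have := f1; rewrite -E; apply.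
  exact: flag_cover.
- by rewrite vert_upd //; case: ifP => [/eqP k0|_]; [apply: f3; rewrite -k0|case/and3P: fC].
Qed.

Lemma fits_agree C D k : (forall j, j != k -> D j = C j) -> flag D -> fits C k (D k).
Proof.
move=> DC /fits_flag -/(_ k).
have vE n : n <= 16 -> n <> k -> vert D n = vert C n.
  by move=> ln nk; rewrite /vert DC // -val_eqE /= inordK //; apply/eqP.
have lk := ltn_ord k; rewrite /fits.
case/and4P => f0 /implyP f1 /implyP f2 f3; apply/and4P; split => //; apply/implyP => H.
- by rewrite -vE ?f1 //; lia.
- by rewrite -vE ?f2 //; lia.
Qed.

(** The facet opposite vertex [k] lies at an end of the time interval exactly when its largest cell
    has dimension 15 and a fixed time. *)
Definition on_boundary C (k : 'I_17) : bool :=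
  (k == 16 :> nat) && ~~ odd (vert C 15 None).

(** An inner facet lies in exactly two flags: [bottom], [middle] and [top] treat the first, an
    intermediate and the last cell. *)
Lemma other_fit C k : flag C -> ~~ on_boundary C k -> exists c,
  [/\ c != C k, fits C k c & forall c', fits C k c' -> c' = C k \/ c' = c].
Proof.
move=> fC nb; have lk := ltn_ord k.
have vk : C k = vert C k by rewrite /vert inord_val.
have := fits_flag k fC; rewrite /fits => /and4P[/implyP f0 /implyP f1 /implyP f2 /implyP f3].
case: (posnP k) => [k0|k0].
  have c01 : cover (C k) (vert C 1) by have := f2; rewrite k0; apply.
  have [c [cC c0 cc cu]] := bottom (eqP (f0 (introT eqP k0))) c01 (@flag_valid C 1 fC isT).
  exists c; split => //; first by rewrite /fits k0 /= c0 eqxx cc.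
  by move=> c'; rewrite /fits k0 /= => /and3P[/eqP c'0 c'c _]; apply: cu.
case: (ltnP k 16) => k16.
  have [c [cC c0 cc cu]] := middle (f1 k0) (f2 k16).
  exists c; split => //; first by rewrite /fits c0 cc ltn_eqF.
  by move=> c' /and4P[_ h1 h2 _]; apply: cu.
have kE : k = 16 :> nat by lia.
rewrite /on_boundary kE /= negbK in nb.
have h1 : cover (vert C 15) (C k) by have := f1 k0; rewrite kE.
have [c [cC c0 cc cu]] := top (@flag_card C 15 fC isT) nb h1 (f3 (introT eqP kE)).
exists c; split => //; first by rewrite /fits kE /= c0 cc.
by move=> c'; rewrite /fits kE /= => /andP[c'0 c'c]; apply: cu.
Qed.

Lemma card_fibre C k : flag C -> ~~ on_boundary C k ->
  #|[set D | flag D & [forall j, (j != k) ==> (D j == C j)]]%SET| = 2.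
Proof.
move=> fC nb; have [c [cC fc cu]] := other_fit fC nb.
have -> : [set D | flag D & [forall j, (j != k) ==> (D j == C j)]]%SET = [set C; upd C k c]%SET.
  apply/setP => D; rewrite !inE; apply/andP/orP => [[fD /forallP DC]|[/eqP->|/eqP->]].
  - have {}DC j : j != k -> D j = C j by move=> jk; apply/eqP; exact: (implyP (DC j)).
    case: (cu _ (fits_agree DC fD)) => E; [left|right]; apply/eqP/ffunP => j; rewrite ?ffunE.
      by case: (eqVneq j k) => [->//|/DC].
    by case: (eqVneq j k) => [->//|/DC].
  - by split => //; apply/forallP => j; apply/implyP.
  - split; first exact: flag_upd.
    by apply/forallP => j; apply/implyP; rewrite ffunE => /negPf->.
rewrite cards2; suff -> : C != upd C k c by [].
by apply: contra cC => /eqP/ffunP/(_ k); rewrite ffunE eqxx => ->.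
Qed.

Definition actf h C : flagT := [ffun k => actc h (C k)].

Lemma flag_actf h C : flag C -> flag (actf h C).
Proof.
have vE n : vert (actf h C) n = actc h (vert C n) by rewrite /vert ffunE.
case/and3P => o /forallP cv v; apply/and3P; rewrite !vE; split.
- by rewrite -cards_eq0 card_odd_set_actc cards_eq0.
- by apply/forallP => k; rewrite !vE; exact: cover_actc.
- exact: valid_actc.
Qed.

Definition free_cell c : bool := [forall h, forall g, (actc h c == actc g c) ==> (h == g)].

Lemma free_cellP c h g : free_cell c -> actc h c = actc g c -> h = g.
Proof. by move=> /forallP/(_ h)/forallP/(_ g)/implyP H /eqP/H/eqP. Qed.

Variable ZF : flagT -> 'I_17 -> bool.
Hypothesis ZF_ext : forall C D k, (forall j, j != k -> C j = D j) -> ZF C k = ZF D k.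
Hypothesis ZF_act : forall h C k, ZF (actf h C) k = ZF C k.
Hypothesis ZF_free : forall C k j, flag C -> ZF C k -> free_cell (C j).
Hypothesis ZF_two : forall C k, flag C -> ZF C k -> #|[pred j | ZF C j]| = 2.

(** Double counting of the pairs of a flag and a zero facet of it. Each flag that occurs has two
    such facets and each inner facet lies in two flags; flags and facets both come in free orbits of
    size 16. Hence 32 divides the number of all pairs and of the inner pairs, and so that of the
    boundary pairs. *)
Theorem boundary_parity :
  32 %| #|[set C | [&& flag C, ZF C ord_max & ~~ odd (vert C 15 None)]]%SET|.
Proof.
pose A := [set p : flagT * 'I_17 | flag p.1 && ZF p.1 p.2]%SET.
pose Ab := [set p in A | on_boundary p.1 p.2]%SET.
pose Ai := (A :\: Ab)%SET.
(* A facet is a flag with one cell erased, which retains just what the flags through it share. *)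
pose fac (p : flagT * 'I_17) : 'I_17 * {ffun 'I_17 -> option (cell m)} :=
  (p.2, [ffun j => if j == p.2 then None else Some (p.1 j)]).
have AiE p : (p \in Ai) = [&& flag p.1, ZF p.1 p.2 & ~~ on_boundary p.1 p.2].
  by rewrite !inE; case: (flag _); case: (ZF _ _) => //=; rewrite andbT.
have h1 : #|A| = (#|(fst @: A)%SET| * 2)%N.
  apply: card_fibres => -[C k]; rewrite inE /= => /andP[fC zC].
  apply: etrans (ZF_two fC zC); rewrite -[RHS](card_imset _ (f := pair C)); last by move=> ? ? [].
  apply: eq_card => -[D j]; rewrite !inE /=; apply/andP/imsetP => [[/andP[fD zD] /eqP E]|[j' + [-> ->]]].
    by exists j; rewrite ?inE E in zD *.
  by rewrite inE eqxx => ->; rewrite fC.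
have h2 : #|Ai| = (#|(fac @: Ai)%SET| * 2)%N.
  apply: card_fibres => -[C k]; rewrite AiE /= => /and3P[fC zC nb].
  apply: etrans (card_fibre fC nb); rewrite -[RHS](card_imset _ (f := pair^~ k)); last by move=> ? ? [].
  apply: eq_card => -[D j]; rewrite inE AiE /=; apply/andP/imsetP.
    move=> [/and3P[fD zD nbD] /eqP[E1 /ffunP E2]]; exists D; rewrite ?E1 // inE fD /=.
    apply/forallP => i; apply/implyP => ik; have := E2 i.
    by rewrite !ffunE E1 (negPf ik) => -[->].
  move=> [D']; rewrite inE => /andP[fD /forallP E] [-> ->].
  have {}E i : i != k -> D' i = C i by move=> ik; apply/eqP; exact: (implyP (E i)).
  rewrite fD (ZF_ext E) zC /=; split.
    move: nb; rewrite /on_boundary; case: eqP => //= kE.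
    by rewrite /vert E // -val_eqE /= inordK // kE.
  apply/eqP; congr pair; apply/ffunP => i; rewrite !ffunE.
  by case: eqVneq => // /E->.
have d1 : #|symm| %| #|(fst @: A)%SET|.
  apply: (dvdn_card_free (act := actf)).
  - move=> h C /imsetP[[D k]]; rewrite inE /= => /andP[fD zD] ->.
    by apply/imsetP; exists (actf h D, k); rewrite // inE /= flag_actf // ZF_act.
  - by exists oneh => C; apply/ffunP => k; rewrite ffunE actc1.
  - by move=> h g; exists (mulh h g) => C; apply/ffunP => k; rewrite !ffunE actcM.
  - by move=> h; exists (invh h) => C; apply/ffunP => k; rewrite !ffunE actcK.
  - move=> C /imsetP[[D k]]; rewrite inE /= => /andP[fD zD] -> h g /ffunP/(_ ord0).
    by rewrite !ffunE; apply: free_cellP; apply: ZF_free zD.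
have d2 : #|symm| %| #|(fac @: Ai)%SET|.
  pose act h (q : 'I_17 * {ffun 'I_17 -> option (cell m)}) :=
    (q.1, [ffun j => omap (actc h) (q.2 j)]).
  apply: (dvdn_card_free (act := act)).
  - move=> h q /imsetP[[D k]]; rewrite AiE /= => /and3P[fD zD nb] ->.
    apply/imsetP; exists (actf h D, k); rewrite ?AiE /=.
      by rewrite flag_actf // ZF_act zD /on_boundary /vert !ffunE.
    by congr pair; apply/ffunP => j; rewrite !ffunE; case: eqP.
  - exists oneh => -[k f]; congr pair; apply/ffunP => j; rewrite ffunE /=.
    by case: (f j) => //= c; rewrite actc1.
  - move=> h g; exists (mulh h g) => -[k f]; congr pair; apply/ffunP => j; rewrite !ffunE /=.
    by case: (f j) => //= c; rewrite actcM.
  - move=> h; exists (invh h) => -[k f]; congr pair; apply/ffunP => j; rewrite !ffunE /=.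
    by case: (f j) => //= c; rewrite actcK.
  - move=> q /imsetP[[D k]]; rewrite AiE /= => /and3P[fD zD _] -> h g [/ffunP E].
    have [j jk] : exists j : 'I_17, j != k.
      by case: (eqVneq ord0 k) => [<-|]; [exists ord_max|exists ord0].
    have := E j; rewrite !ffunE /= (negPf jk) /= => -[].
    by apply: free_cellP; apply: ZF_free zD.
have -> : #|[set C | [&& flag C, ZF C ord_max & ~~ odd (vert C 15 None)]]%SET| = #|Ab|.
  rewrite -[LHS](card_imset _ (f := fun C : flagT => (C, ord_max : 'I_17))); last by move=> ? ? [].
  apply: eq_card => -[C k]; rewrite !inE /on_boundary /=; apply/imsetP/idP => [[D]|].
    by rewrite inE => /and3P[fD zD oD] [-> ->]; rewrite fD zD oD.
  case/andP => /andP[fC zC] /andP[/eqP kE oC].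
  have kE' : k = ord_max by apply/val_inj.
  rewrite kE' in zC *.
  by exists C; rewrite // inE fC oC zC.
have AbA : Ab \subset A by apply/fintype.subsetP => p; rewrite inE => /andP[].
have : (#|Ab| + #|Ai|)%N = #|A| by rewrite -(cardsID Ab A) (finset.setIidPr AbA).
rewrite card_symm in d1 d2; rewrite h1 h2; case/dvdnP: d1 => u ->; case/dvdnP: d2 => v -> E.
by apply/dvdnP; exists (u - v)%N; rewrite mulnBl; lia.
Qed.
End Flags.

Local Open Scope ring_scope.

(** * Equivariant maps in general position *)

(* The blocks on whose signs the j-th test function depends. *)
Definition ty (j : 'I_15) (b : 'I_3) : bool :=
  nth false (nth [::]
    [:: [:: true; false; false]; [:: false; true; false];
        [:: true; false; false]; [:: false; true; false];
        [:: true; false; true]; [:: false; true; true];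
        [:: true; false; true]; [:: false; true; true];
        [:: false; false; true]; [:: false; false; true];
        [:: true; true; false]; [:: true; true; false];
        [:: true; true; true]; [:: true; true; true]; [:: true; true; true]] j) b.

Lemma swap_test_subproof (j : 'I_15) :
  ((if j < 8 then (if odd j then j.-1 else j.+1) else j) < 15)%N.
Proof. by have := ltn_ord j; move: (nat_of_ord j) => k; case: ifP => // ?; case: ifP => //; lia. Qed.

(** The first eight test functions come in consecutive pairs that the exchange of the first two
    hyperplanes interchanges; the others are fixed. *)
Definition swap_test (w : bool) (j : 'I_15) : 'I_15 :=
  if w then Ordinal (swap_test_subproof j) else j.

Lemma ty_swap w j b : ty (swap_test w j) b = ty j (sw w b).
Proof.
case: w => //; case: j; do 15![case; first by case: b => [[|[|[|//]]] ?]].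
by [].
Qed.

Lemma swap_testD w w' j : swap_test w (swap_test w' j) = swap_test (w (+) w') j.
Proof.
case: w; case: w' => //; apply/val_inj; case: j => /=.
by do 15![case; first by []].
Qed.

Definition flip_test (h : symm) (j : 'I_15) : bool :=
  (ty j r0 && h.1 r0) (+) (ty j r1 && h.1 r1) (+) (ty j r2 && h.1 r2).

Lemma flip_testM h g j :
  flip_test (mulh h g) j = flip_test h j (+) flip_test g (swap_test h.2 j).
Proof.
case: h => s w; rewrite /flip_test /mulh !ffunE !ty_swap /=; case: w => /=.
  by do 3!case: (ty j _); do 3!case: (s _); do 3!case: (g.1 _).
by do 3!case: (ty j _); do 3!case: (s _); do 3!case: (g.1 _).
Qed.

Lemma mulKh (g h : symm) : mulh (invh g) (mulh g h) = h.
Proof.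
case: h => s w; rewrite /mulh /invh /= addKb; congr pair; apply/ffunP => b.
by rewrite !ffunE swD addbb /= addKb.
Qed.

Lemma mulhK (g h : symm) : mulh g (mulh (invh g) h) = h.
Proof.
case: h => s w; rewrite /mulh /invh /= addKb; congr pair; apply/ffunP => b.
by rewrite !ffunE !swD addbb /= addKb.
Qed.

Section Equivariant.
Variables (R : realFieldType) (m : nat).
Implicit Types (F P : cell m -> 'rV[R]_15) (C : flagT m) (c : cell m) (h g : symm).

Definition rho h (v : 'rV[R]_15) : 'rV[R]_15 :=
  \row_j ((-1) ^+ flip_test h j * v 0 (swap_test h.2 j)).

Lemma rhoM h g v : rho h (rho g v) = rho (mulh h g) v.
Proof.
by apply/rowP => j; rewrite !mxE flip_testM signr_addb mulrA swap_testD addbC.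
Qed.

Lemma rho1 v : rho oneh v = v.
Proof.
apply/rowP => j; rewrite !mxE /flip_test !ffunE !andbF /= mul1r.
by congr (v _ _); apply/val_inj.
Qed.

Lemma rhoK h v : rho (invh h) (rho h v) = v.
Proof. by rewrite rhoM invhK rho1. Qed.

Lemma rho_is_linear h : linear (rho h).
Proof. by move=> a u v; apply/rowP => j; rewrite !mxE; ring. Qed.
HB.instance Definition _ h :=
  GRing.isLinear.Build R 'rV[R]_15 'rV[R]_15 _ (rho h) (rho_is_linear h).

Definition equivariant F := forall h c, F (actc h c) = rho h (F c).

Lemma zero_facet_actf F h C k : equivariant F ->
  zero_facet (fun j => F (actf h C j)) k <-> zero_facet (fun j => F (C j)) k.
Proof.
move=> eF; have E l : \sum_j l j *: F (actf h C j) = rho h (\sum_j l j *: F (C j)).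
  by rewrite linear_sum; apply: eq_bigr => j _; rewrite linearZ ffunE eF.
split=> -[l [l0 lk lex lv]]; exists l; split=> //; last by rewrite E lv linear0.
by rewrite -(rhoK h (\sum_j _)) -E lv linear0.
Qed.

Definition minor F C (f : {ffun 'I_15 -> 'I_17}) : R :=
  \det (\matrix_(i, j) F (C (f i)) 0 j).

(** A relation supported on 15 of the 17 vectors is killed by the inverse of their matrix. *)
Lemma general_position_minor F C :
  (forall f : {ffun 'I_15 -> 'I_17}, injective f -> minor F C f != 0) ->
  general_position (fun k => F (C k)).
Proof.
move=> H i j l ij _ li lj lv.
have [j' jE _] := unlift_some ij.
pose f : {ffun 'I_15 -> 'I_17} := [ffun k => lift i (lift j' k)].
have fi : injective f.
  by move=> k k'; rewrite !ffunE => /lift_inj/lift_inj.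
have lf : forall k, l (f k) = 0.
  pose u : 'rV[R]_15 := \row_k l (f k).
  have : u *m (\matrix_(i, j) F (C (f i)) 0 j) = 0.
    apply/rowP => q; have /rowP/(_ q) := lv; rewrite summxE [RHS]mxE => lvq.
    rewrite mxE [RHS]mxE -[RHS]lvq (bigD1_ord i) //= (bigD1_ord j') //=.
    rewrite -jE li lj !scale0r !mxE !add0r.
    by apply: eq_bigr => k _; rewrite !mxE ffunE.
  move=> /(congr1 (mulmx^~ (invmx (\matrix_(i, j) F (C (f i)) 0 j)))).
  rewrite mulmxK ?unitmxE ?unitfE ?H // mul0mx => /rowP u0 k.
  by have := u0 k; rewrite !mxE.
move=> k; case: (unliftP i k) => [k' ->|->//].
case: (unliftP j' k') => [k'' ->|->]; last by rewrite -jE.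
by have := lf k''; rewrite ffunE.
Qed.

(** Prescribe the standard basis on the chosen cells and extend by symmetry. The values do not
    interfere: the cells have different dimensions, hence different orbits, and trivial
    stabilisers. *)
Lemma equivariant_minor C (f : {ffun 'I_15 -> 'I_17}) : flag C ->
  (forall k, free_cell (C k)) -> injective f ->
  exists2 P, equivariant P & minor P C f = 1.
Proof.
move=> fC frC fi.
pose P c : 'rV[R]_15 :=
  \sum_h \sum_(i < 15 | actc h (C (f i)) == c) rho h (delta_mx 0 i).
exists P.
  move=> g c; rewrite /P (reindex (mulh g)) /=; last first.
    by exists (mulh (invh g)) => h _; rewrite ?mulKh ?mulhK.
  rewrite linear_sum; apply: eq_bigr => h _.
  rewrite linear_sum; apply: eq_big => [i|i _]; last by rewrite -rhoM.
  rewrite -actcM; apply/eqP/eqP => [|->//].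
  by move=> /(congr1 (actc (invh g))); rewrite !actcK.
rewrite /minor -[RHS](det1 R 15); congr (\det _); apply/matrixP => i j; rewrite !mxE.
have card_C k : #|odd_set (C k)| = k.
  by have := @flag_card _ C k fC; rewrite /vert inord_val; apply; rewrite -ltnS.
have E h i' : (actc h (C (f i')) == C (f i)) = (h == oneh) && (i' == i).
  apply/eqP/andP => [E|[/eqP-> /eqP->]]; last by rewrite actc1.
  have ii : i' = i.
    apply/fi/val_inj; rewrite /= -card_C -[RHS]card_C -E.
    by rewrite card_odd_set_actc.
  split; last exact/eqP.
  by apply/eqP; apply: (free_cellP (frC (f i))); rewrite actc1 -{1}ii.
rewrite /P (bigD1 oneh) //= [X in _ + X]big1 ?addr0; last first.
  by move=> h /negPf h1; rewrite big_pred0 // => i'; rewrite E h1.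
under eq_bigl do rewrite E eqxx /=.
by rewrite big_pred1_eq rho1 mxE eqxx eq_sym.
Qed.

Lemma exists_nonroot (p : {poly R}) (d : R) : p != 0 -> 0 < d ->
  exists t, [/\ 0 < t, t < d & p.[t] != 0].
Proof.
(* These are [size p] distinct points strictly between 0 and [d], more than a nonzero [p] has
   roots. *)
move=> p0 d0; pose rs := [seq d / k.+2%:R | k <- iota 0 (size p)].
have : ~~ all (root p) rs.
  apply/negP => rp; have := max_poly_roots p0 rp.
  rewrite size_map size_iota ltnn => H; suff : false by []; apply: H.
  rewrite map_inj_uniq ?iota_uniq // => k k' /(mulfI (lt0r_neq0 d0))/invr_inj/eqP.
  by rewrite eqr_nat => /eqP[].
case/allPn => t /mapP[k _ ->]; rewrite /root => H.
exists (d / k.+2%:R); split => //; first by rewrite divr_gt0 // ltr0n.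
by rewrite ltr_pdivrMr ?ltr0n // ltr_pMr // ltr1n.
Qed.

Definition segment F P (t : R) c := (1 - t) *: F c + t *: P c.

Lemma minor_segment F P C f : exists q : {poly R},
  forall t, q.[t] = minor (segment F P t) C f.
Proof.
exists (\det (\matrix_(i, j) ((F (C (f i)) 0 j)%:P * (1 - 'X) + (P (C (f i)) 0 j)%:P * 'X))).
move=> t; rewrite -[LHS]/(horner_eval t _) -det_map_mx; congr (\det _).
apply/matrixP => i j; rewrite !mxE /= /horner_eval !hornerE.
ring.
Qed.

(** The minors are made nonzero one by one, by a short move along the segment towards a map for
    which the new minor is 1. Half of the error is kept for the remaining minors. *)
Lemma generic_perturbation_seq F (s : seq (flagT m * {ffun 'I_15 -> 'I_17})) (e : R) :
  equivariant F -> 0 < e ->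
  (forall p, p \in s -> [/\ flag p.1, forall k, free_cell (p.1 k) & injective p.2]) ->
  exists F', [/\ equivariant F', forall c j, `|F' c 0 j - F c 0 j| <= e &
    forall p, p \in s -> minor F' p.1 p.2 != 0].
Proof.
move=> eF; elim: s e => [|[C f] s IH] e e0 H.
  by exists F; split => // c j; rewrite subrr normr0 ltW.
have e20 : 0 < e / 2 by rewrite divr_gt0.
have [|F' [eF' FF' F's]] := IH _ e20.
  by move=> p ps; apply: H; rewrite inE ps orbT.
have [fC0 frC0 fi0] := H (C, f) (mem_head _ _).
have [P eP Pm] := equivariant_minor fC0 frC0 fi0.
pose q p := sval (boolp.cid (minor_segment F' P p.1 p.2)).
have qE p t : (q p).[t] = minor (segment F' P t) p.1 p.2.
  exact: (svalP (boolp.cid (minor_segment F' P p.1 p.2))).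
have seg0 : segment F' P 0 = F'.
  by apply: boolp.funext => c; rewrite /segment subr0 scale1r scale0r addr0.
have seg1 : segment F' P 1 = P.
  by apply: boolp.funext => c; rewrite /segment subrr scale1r scale0r add0r.
(* Each factor is a nonzero polynomial: the new one does not vanish at 1, the earlier ones do not
   vanish at 0. *)
have Q0 : \prod_(p <- (C, f) :: s) q p != 0.
  rewrite prodf_seq_neq0; apply/allP => p /=; rewrite inE => /orP[/eqP->|ps].
    by apply: contra_eq_neq (qE (C, f) 1) => ->; rewrite horner0 seg1 Pm eq_sym oner_neq0.
  by apply: contra_eq_neq (qE p 0) => ->; rewrite horner0 seg0 eq_sym F's.
pose M := 1 + \sum_c \sum_(j < 15) `|P c 0 j - F' c 0 j|.
have S0 : 0 <= \sum_c \sum_(j < 15) `|P c 0 j - F' c 0 j|.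
  by apply: sumr_ge0 => c _; apply: sumr_ge0.
have M0 : 0 < M by rewrite /M; lra.
have ME c j : `|P c 0 j - F' c 0 j| <= M.
  rewrite /M (bigD1 c) //= (bigD1 j) //=.
  have := @sumr_ge0 _ _ (index_enum (cell m)) (fun i => i != c)
    (fun c => \sum_(j < 15) `|P c 0 j - F' c 0 j|) _.
  have := @sumr_ge0 _ _ (index_enum 'I_15) (fun i => i != j)
    (fun j => `|P c 0 j - F' c 0 j|) _.
  move=> /(_ (fun _ _ => normr_ge0 _)) h1.
  move=> /(_ (fun _ _ => sumr_ge0 _ (fun _ _ => normr_ge0 _))) h2.
  move: h1 h2; lra.
have [t [t0 td qt]] := exists_nonroot Q0 (divr_gt0 e20 M0).
exists (segment F' P t); split.
- move=> h c; rewrite /segment eF' eP linearD !linearZ.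
  by [].
- move=> c j; rewrite /segment !mxE.
  have -> : (1 - t) * F' c 0 j + t * P c 0 j - F c 0 j =
    t * (P c 0 j - F' c 0 j) + (F' c 0 j - F c 0 j) by ring.
  apply: le_trans (ler_normD _ _) _.
  have -> : e = e / 2 + e / 2 by field.
  apply: lerD => //; rewrite normrM (gtr0_norm t0).
  apply: (@le_trans _ _ (t * M)); first by rewrite ler_wpM2l // ltW.
  by rewrite -ler_pdivlMr // ltW.
- move=> p ps; rewrite -qE; apply: contraNneq qt => E.
  by rewrite horner_prod (big_rem p) //= E mul0r.
Qed.

Lemma generic_perturbation F (e : R) : equivariant F -> 0 < e ->
  exists F', [/\ equivariant F', forall c j, `|F' c 0 j - F c 0 j| <= e &
    forall C, flag C -> (forall k, free_cell (C k)) ->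
      general_position (fun k => F' (C k))].
Proof.
move=> eF e0.
pose T : finType := (flagT m * {ffun 'I_15 -> 'I_17})%type.
pose s := seq.filter (fun p : T =>
  [&& flag p.1, [forall k, free_cell (p.1 k)] & injectiveb p.2]) (enum T).
have [|F' [eF' FF' Fs]] := @generic_perturbation_seq F s e eF e0.
  by move=> p; rewrite mem_filter => /andP[/and3P[? /forallP ? /injectiveP ?] _].
exists F'; split => // C fC frC; apply: general_position_minor => f fi.
apply: (Fs (C, f)); rewrite mem_filter mem_enum inE fC /= andbT.
by apply/andP; split; [apply/forallP|apply/injectiveP].
Qed.

Theorem facet_parity F : equivariant F ->
  (forall C, flag C -> (forall k, free_cell (C k)) -> general_position (fun k => F (C k))) ->
  (forall C k, flag C -> ~ (forall k, free_cell (C k)) ->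
    ~ zero_facet (fun k => F (C k)) k) ->
  (32 %| #|[set C | [&& flag C, `[< zero_facet (fun k => F (C k)) ord_max >] &
     ~~ odd (vert C 15 None)]]%SET|)%N.
Proof.
move=> eF gF nF.
apply: (@boundary_parity m (fun C k => `[< zero_facet (fun k => F (C k)) k >])).
- move=> C D k CD; apply: boolp.asbool_equiv_eq.
  have E l : l k = 0 -> \sum_j l j *: F (C j) = \sum_j l j *: F (D j).
    move=> lk; apply: eq_bigr => j _.
    by case: (eqVneq j k) => [->|/CD->//]; rewrite lk !scale0r.
  by split=> -[l [l0 lk lex lv]]; exists l; split => //; [rewrite -E|rewrite E].
- by move=> h C k; apply: boolp.asbool_equiv_eq; exact: zero_facet_actf.
- move=> C k j fC /asboolP zC.
  have [fr|/nF H] := pselect (forall k, free_cell (C k)); first exact: fr.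
  by case: (H k fC zC).
- move=> C k fC /asboolP zC; apply: card_zero_facets; last by exists k.
  apply: gF => //; apply: boolp.contrapT => /nF H; exact: (H k fC zC).
Qed.
End Equivariant.

(** * The model map and its zeros *)

Definition c0 : 'I_6 := @Ordinal 6 0 isT.
Definition c1 : 'I_6 := @Ordinal 6 1 isT.
Definition c2 : 'I_6 := @Ordinal 6 2 isT.
Definition c3 : 'I_6 := @Ordinal 6 3 isT.
Definition c4 : 'I_6 := @Ordinal 6 4 isT.
Definition c5 : 'I_6 := @Ordinal 6 5 isT.

Lemma ord6P (P : 'I_6 -> Prop) :
  P c0 -> P c1 -> P c2 -> P c3 -> P c4 -> P c5 -> forall k, P k.
Proof.
move=> p0 p1 p2 p3 p4 p5 [[|[|[|[|[|[|//]]]]]] lk].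
- by have -> : Ordinal lk = c0 by apply/val_inj.
- by have -> : Ordinal lk = c1 by apply/val_inj.
- by have -> : Ordinal lk = c2 by apply/val_inj.
- by have -> : Ordinal lk = c3 by apply/val_inj.
- by have -> : Ordinal lk = c4 by apply/val_inj.
- by have -> : Ordinal lk = c5 by apply/val_inj.
Qed.

Section Model.
Variable R : realFieldType.
Implicit Types (x : 'M[R]_(3, 6)) (u : 'I_3) (k : 'I_6) (s : R).

Definition actm (h : symm) x : 'M[R]_(3, 6) :=
  \matrix_(b, k) ((-1) ^+ h.1 b * x (sw h.2 b) k).

(* Odd, fixing 1 and -1, and 0 near 0: this makes the model affine near its zeros. *)
Definition thr s : R := Num.max (2 * s - 1) 0 - Num.max (- (2 * s) - 1) 0.
(** Truncation to [-1, 1] keeps the zeros of its argument but is locally constant where the argument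
    is large, as [2 * cross x] is near the zeros of the model. *)
Definition clamp s : R := Num.max (-1) (Num.min 1 s).

Lemma thrN s : thr (- s) = - thr s.
Proof. by rewrite /thr mulrN opprK opprB. Qed.

Lemma thr_sign (b : bool) s : thr ((-1) ^+ b * s) = (-1) ^+ b * thr s.
Proof. by case: b; rewrite ?expr1 ?expr0 ?mulN1r ?mul1r ?thrN. Qed.

Lemma clampN s : clamp (- s) = - clamp s.
Proof.
rewrite /clamp !maxEle !minEle.
by case: (leP 1 (- s)) => ?; case: (leP 1 s) => ?; do ?case: leP => ?; lra.
Qed.

Lemma thr_small s : `|s| <= 1 / 2 -> thr s = 0.
Proof.
rewrite ler_norml => /andP[h1 h2]; rewrite /thr !maxEle.
by case: leP => ?; case: leP => ?; lra.
Qed.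

Lemma thr1 : thr 1 = 1.
Proof. by rewrite /thr !maxEle; case: leP => ?; case: leP => ?; lra. Qed.

Lemma thr_bound s : `|s| <= 1 -> `|thr s| <= 1.
Proof.
rewrite !ler_norml => /andP[h1 h2]; rewrite /thr !maxEle.
by case: (leP (2 * s - 1) 0) => ?; case: (leP (- (2 * s) - 1) 0) => ?; apply/andP; split; lra.
Qed.

Lemma thr_ge0 s : 0 <= s -> 0 <= thr s.
Proof. by move=> s0; rewrite /thr !maxEle; case: (leP (2 * s - 1) 0) => ?; case: (leP (- (2 * s) - 1) 0) => ?; lra. Qed.

Lemma mul_thr_ge0 s r : 0 <= r -> 0 <= s * thr (r * s).
Proof.
move=> r0; case: (leP 0 s) => s0; first by rewrite mulr_ge0 // thr_ge0 // mulr_ge0.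
rewrite -(opprK s) mulrN thrN mulrNN mulr_ge0 ?thr_ge0 ?mulr_ge0 //; lra.
Qed.

Definition zt x k := thr (x r2 k).
(* With [z] the thresholded third row as a quaternion: the inner products of
   row [u] with [z], [i z], [j z] and [k z]. *)
Definition form1 u x := x u c0 * zt x c0 + x u c1 * zt x c1 + x u c2 * zt x c2 + x u c3 * zt x c3.
Definition formi u x := - x u c0 * zt x c1 + x u c1 * zt x c0 - x u c2 * zt x c3 + x u c3 * zt x c2.
Definition formj u x := - x u c0 * zt x c2 + x u c1 * zt x c3 + x u c2 * zt x c0 - x u c3 * zt x c1.
Definition formk u x := - x u c0 * zt x c3 - x u c1 * zt x c2 + x u c2 * zt x c1 + x u c3 * zt x c0.
(** A substitute for the inner product of the first two rows, symmetric in them, odd in each and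
    affine near the zeros of the model. *)
Definition near_inner x := \sum_k (x r0 k * thr (x r1 k) + thr (x r0 k) * x r1 k).
(** A permanent rather than a determinant: it must be invariant under the exchange of the two
    rows. *)
Definition cross x := formj r0 x * formk r1 x + formk r0 x * formj r1 x.

(** The factor [clamp (2 * cross x)] makes the last three entries odd in all three rows;
    [model_zeros] shows that it cannot vanish at a zero. *)
Definition model_main x : seq R :=
  [:: x r0 c4; x r1 c4; x r0 c5; x r1 c5; form1 r0 x; form1 r1 x;
      formi r0 x; formi r1 x; x r2 c4; x r2 c5;
      near_inner x; formj r0 x * formj r1 x;
      clamp (2 * cross x) * x r2 c1; clamp (2 * cross x) * x r2 c2;
      clamp (2 * cross x) * x r2 c3].

(* The zeros of the model are grid points; the offsets move them into the
   interior of a single flag, determined by the order of the shifts. *)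
Definition shift (j : nat) : R := (15 - j)%:R / 16.
(** Up to sign this is [a] for a row at the quaternion j and [b] for one at k. So the two rows get
    different offsets without breaking the exchange symmetry. *)
Definition mix (a b : R) u x := a * thr (x u c2) + b * thr (x u c3).
Definition pair_sign x := thr (x r0 c2) * thr (x r1 c3) + thr (x r0 c3) * thr (x r1 c2).

(** The products of thresholded coordinates restore equivariance. Entry 10 has a sum of two shifts
    because [near_inner] is, near the base point, a sum of two chart coordinates. *)
Definition model_offset x : seq R :=
  [:: mix (shift 0) (shift 1) r0 x; mix (shift 0) (shift 1) r1 x;
      mix (shift 2) (shift 3) r0 x; mix (shift 2) (shift 3) r1 x;
      mix (shift 4) (shift 5) r0 x * zt x c0; mix (shift 4) (shift 5) r1 x * zt x c0;
      mix (shift 6) (shift 7) r0 x * zt x c0; mix (shift 6) (shift 7) r1 x * zt x c0;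
      shift 8 * zt x c0; shift 9 * zt x c0;
      (shift 10 + shift 11) * pair_sign x; shift 11 * pair_sign x;
      shift 12 * (pair_sign x * zt x c0); shift 13 * (pair_sign x * zt x c0);
      shift 14 * (pair_sign x * zt x c0)].

Definition model (e : R) x : 'rV[R]_15 :=
  \row_j ((model_main x)`_j - e * (model_offset x)`_j).

Lemma zt_actm h x k : zt (actm h x) k = (-1) ^+ h.1 r2 * zt x k.
Proof.
rewrite /zt mxE thr_sign; congr (_ * thr (x _ _)).
by case: h => s [].
Qed.

Lemma form_actm h x u :
  [/\ form1 u (actm h x) = (-1) ^+ h.1 u * (-1) ^+ h.1 r2 * form1 (sw h.2 u) x,
      formi u (actm h x) = (-1) ^+ h.1 u * (-1) ^+ h.1 r2 * formi (sw h.2 u) x,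
      formj u (actm h x) = (-1) ^+ h.1 u * (-1) ^+ h.1 r2 * formj (sw h.2 u) x &
      formk u (actm h x) = (-1) ^+ h.1 u * (-1) ^+ h.1 r2 * formk (sw h.2 u) x].
Proof.
by rewrite /form1 /formi /formj /formk !zt_actm !mxE; split; ring.
Qed.

Lemma sw_r0 w : sw w r0 = if w then r1 else r0. Proof. by case: w. Qed.
Lemma sw_r1 w : sw w r1 = if w then r0 else r1. Proof. by case: w. Qed.
Lemma sw_r2 w : sw w r2 = r2. Proof. by case: w. Qed.

Lemma near_inner_actm h x :
  near_inner (actm h x) = (-1) ^+ h.1 r0 * (-1) ^+ h.1 r1 * near_inner x.
Proof.
rewrite /near_inner mulr_sumr; apply: eq_bigr => k _.
rewrite !mxE !thr_sign sw_r0 sw_r1; case: h.2; ring.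
Qed.

Lemma cross_actm h x : cross (actm h x) = (-1) ^+ h.1 r0 * (-1) ^+ h.1 r1 * cross x.
Proof.
rewrite /cross; have [_ _ -> ->] := form_actm h x r0; have [_ _ -> ->] := form_actm h x r1.
rewrite sw_r0 sw_r1; case: (h.1 r2); case: h.2; ring.
Qed.

Lemma pair_sign_actm h x :
  pair_sign (actm h x) = (-1) ^+ h.1 r0 * (-1) ^+ h.1 r1 * pair_sign x.
Proof.
rewrite /pair_sign !mxE !thr_sign sw_r0 sw_r1; case: h.2; ring.
Qed.

Lemma clamp_cross_actm h x : clamp (2 * cross (actm h x)) =
  (-1) ^+ h.1 r0 * (-1) ^+ h.1 r1 * clamp (2 * cross x).
Proof.
rewrite cross_actm.
by case: (h.1 r0); case: (h.1 r1);
  rewrite ?expr1 ?expr0 ?mulrNN ?mul1r ?mulN1r ?mulr1 ?mulNr ?mul1r ?mulrN ?clampN.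
Qed.

Lemma mix_actm a b u h x : mix a b u (actm h x) = (-1) ^+ h.1 u * mix a b (sw h.2 u) x.
Proof. rewrite /mix !mxE !thr_sign; ring. Qed.

Lemma model_actm e h x : model e (actm h x) = rho h (model e x).
Proof.
have [f10 fi0 fj0 _] := form_actm h x r0.
have [f11 fi1 fj1 _] := form_actm h x r1.
apply/rowP => j; rewrite !mxE /model_main /model_offset.
rewrite f10 fi0 fj0 f11 fi1 fj1 near_inner_actm clamp_cross_actm pair_sign_actm.
rewrite !mix_actm !zt_actm !mxE sw_r0 sw_r1 sw_r2 /flip_test /ty.
case: h {f10 fi0 fj0 f11 fi1 fj1} => s w /=.
move: (s r0) (s r1) (s r2) => s0 s1 s2.
case: j; do 15![case; first by case: w; case: s0; case: s1; case: s2 => /= ?; ring].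
by [].
Qed.

End Model.

(** * The zeros of the model form a single orbit *)

Section ModelZeros.
Variable R : realFieldType.
Implicit Types (x : 'M[R]_(3, 6)) (u : 'I_3) (k : 'I_6) (s : R).

(* The zero x0 = j, x1 = k, z = 1 of the model. *)
Definition is_base u k : bool :=
  [|| (u == r0) && (k == c2), (u == r1) && (k == c3) | (u == r2) && (k == c0)].

(* Near its zero at the base point the model consists of these coordinates,
   up to adding coordinate 11 to coordinate 10. *)
Definition chart (j : nat) : 'I_3 * 'I_6 := nth (r0, c0)
  [:: (r0, c4); (r1, c4); (r0, c5); (r1, c5); (r0, c0); (r1, c0); (r0, c1);
      (r1, c1); (r2, c4); (r2, c5); (r0, c3); (r1, c2); (r2, c1); (r2, c2);
      (r2, c3)] j.

Lemma sum6 (F : 'I_6 -> R) :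
  \sum_k F k = F c0 + F c1 + F c2 + F c3 + F c4 + F c5.
Proof.
rewrite !big_ord_recl big_ord0 addr0 !addrA.
by congr (_ + _ + _ + _ + _ + _); congr F; apply/val_inj.
Qed.

(** There [thr] takes exactly the values 0 and 1, and [cross x] is at least 1/2, so that the clamped
    factor equals 1. *)
Lemma model_near_base (e : R) x :
  (forall u k, is_base u k -> x u k = 1) ->
  (forall u k, ~~ is_base u k -> `|x u k| <= 1 / 2) ->
  forall j : 'I_15, model e x 0 j =
    x (chart j).1 (chart j).2 - e * shift R j +
    (if j == 10 :> nat then x r1 c2 - e * shift R 11 else 0).
Proof.
move=> xb xs j.
have T u k : thr (x u k) = (is_base u k)%:R.
  by case: (boolP (is_base u k)) => b; [rewrite xb // thr1|rewrite thr_small ?xs].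
have x02 : x r0 c2 = 1 by rewrite xb.
have x13 : x r1 c3 = 1 by rewrite xb.
have C : clamp (2 * cross x) = 1.
  have -> : cross x = 1 + x r0 c3 * x r1 c2.
    rewrite /cross /formj /formk /zt !T /= x02 x13; ring.
  have h1 : `|x r0 c3 * x r1 c2| <= 1 / 2.
    rewrite normrM -[1 / 2]mul1r ler_pM ?xs //.
    by apply: le_trans (xs _ _ _) _ => //; lra.
  move: h1; rewrite ler_norml => /andP[h1 h2].
  by rewrite /clamp min_l ?max_r //; lra.
have N : near_inner x = x r0 c3 + x r1 c2.
  rewrite /near_inner sum6 !T /=; ring.
rewrite mxE /model_main /model_offset C N /form1 /formi /formj /mix /pair_sign /zt !T.
rewrite x02 x13; case: j.
by do 15![case; first by move=> ? /=; ring].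
Qed.

(** No summand is negative, since [thr] preserves weak signs, and a coordinate of absolute value 1
    gives a positive one. *)
Lemma near_inner_gt0 x (r : R) : 0 < r -> (forall k, x r0 k = r * x r1 k) ->
  (exists k, `|x r1 k| = 1) -> 0 < near_inner x.
Proof.
move=> r0' xr [k xk]; rewrite /near_inner (bigD1 k) //=.
have T j : 0 <= x r0 j * thr (x r1 j) + thr (x r0 j) * x r1 j.
  rewrite xr addr_ge0 //.
    by rewrite -mulrA mulr_ge0 ?(ltW r0') //; have := @mul_thr_ge0 R (x r1 j) 1 ler01; rewrite mul1r.
  by rewrite mulrC mul_thr_ge0 // ltW.
rewrite ltr_pwDl //; last by apply: sumr_ge0 => j _.
rewrite ltr_pwDl //.
  rewrite xr -mulrA mulr_gt0 //.
  move: xk; case: (lerP 0 (x r1 k)) => [x0|x0 xk].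
    by rewrite ger0_norm // => ->; rewrite thr1 mulr1.
  have -> : x r1 k = - 1 by move: xk; rewrite ltr0_norm // => <-; rewrite opprK.
  by rewrite thrN thr1 mulrNN mulr1.
by rewrite xr mulrC mul_thr_ge0 // ltW.
Qed.

Lemma near_inner_neq0 x (r : R) : r != 0 -> (forall k, x r0 k = r * x r1 k) ->
  (exists k, `|x r1 k| = 1) -> near_inner x != 0.
Proof.
move=> rn xr ex; case: (ltrgtP r 0) rn => // rs _; last by rewrite gt_eqF ?(near_inner_gt0 rs).
pose h : symm := ([ffun b => b == r0], false).
have := @near_inner_gt0 (actm h x) (- r); rewrite oppr_gt0 => /(_ rs) H.
have : 0 < near_inner (actm h x).
  apply: H => [k|]; first by rewrite !mxE !ffunE /= xr; ring.
  by case: ex => k xk; exists k; rewrite !mxE !ffunE /= mul1r.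
by rewrite near_inner_actm !ffunE /= => /lt0r_neq0; rewrite mulf_eq0 => /norP[].
Qed.

Lemma clamp_eq0 s : clamp s = 0 -> s = 0.
Proof.
rewrite /clamp !maxEle !minEle.
by case: (leP 1 s) => ?; do ?case: leP => ?; lra.
Qed.

Lemma thr_norm1 s : `|s| = 1 -> thr s = s.
Proof.
case: (lerP 0 s) => s0; first by rewrite ger0_norm // => ->; rewrite thr1.
rewrite ltr0_norm // => e; have -> : s = - 1 by rewrite -e opprK.
by rewrite thrN thr1.
Qed.

Lemma add_thr_eq0 s : s + thr s = 0 -> s = 0.
Proof.
case: (lerP 0 s) => s0; first by have := thr_ge0 s0; lra.
by have := @thr_ge0 R (- s); rewrite thrN; lra.
Qed.

Lemma model_zeros x : (forall u, exists k, `|x u k| = 1) -> model 0 x = 0 ->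
  exists h, forall u k, actm h x u k = (is_base u k)%:R.
Proof.
move=> sx /rowP E.
have {}E n (ln : (n < 15)%N) : (model_main x)`_n = 0.
  by have := E (Ordinal ln); rewrite !mxE mul0r subr0.
have := E 0%N isT; have := E 1%N isT; have := E 2%N isT; have := E 3%N isT.
have := E 4%N isT; have := E 5%N isT; have := E 6%N isT; have := E 7%N isT.
have := E 8%N isT; have := E 9%N isT; have := E 10%N isT; have := E 11%N isT.
have := E 12%N isT; have := E 13%N isT; have := E 14%N isT.
have n01 : (0 : R) = 1 -> False by move/eqP; rewrite eq_sym oner_eq0.
rewrite /= => e14 e13 e12 e11 e10 e9 e8 e7 e6 e5 e4 e3 e2 e1 e0 {E}.
(* The squared norm of the thresholded quaternion z; z is nonzero because an entry of absolute value
   1 survives [thr] and entries 4 and 5 vanish. *)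
pose D := zt x c0 ^+ 2 + zt x c1 ^+ 2 + zt x c2 ^+ 2 + zt x c3 ^+ 2.
have D0 : D != 0.
  have H s : `|s| = 1 -> thr s ^+ 2 = 1 by move=> s1; rewrite thr_norm1 // -real_normK ?s1 ?expr1n ?num_real.
  apply: lt0r_neq0; have [k] := sx r2; move: k.
  have s0 := sqr_ge0 (zt x c0); have s1 := sqr_ge0 (zt x c1).
  have s2 := sqr_ge0 (zt x c2); have s3 := sqr_ge0 (zt x c3).
  apply: ord6P; rewrite ?e8 ?e9 ?normr0 => h; rewrite /D; try (by move: h; lra).
  - by have := H _ h; rewrite -/(zt x c0); lra.
  - by have := H _ h; rewrite -/(zt x c1); lra.
  - by have := H _ h; rewrite -/(zt x c2); lra.
  - by have := H _ h; rewrite -/(zt x c3); lra.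
(* Expansion in the orthogonal basis z, i z, j z, k z, whose members all have squared norm [D]; the
   first two coefficients vanish. *)
have X u : form1 u x = 0 -> formi u x = 0 -> [/\
   D * x u c0 = - formj u x * zt x c2 - formk u x * zt x c3,
   D * x u c1 = formj u x * zt x c3 - formk u x * zt x c2,
   D * x u c2 = formj u x * zt x c0 + formk u x * zt x c1 &
   D * x u c3 = - formj u x * zt x c1 + formk u x * zt x c0].
  move=> h1 hi; split.
  - transitivity (form1 u x * zt x c0 - formi u x * zt x c1 - formj u x * zt x c2 - formk u x * zt x c3).
      by rewrite /D /form1 /formi /formj /formk; ring.
    by rewrite h1 hi; ring.
  - transitivity (form1 u x * zt x c1 + formi u x * zt x c0 + formj u x * zt x c3 - formk u x * zt x c2).
      by rewrite /D /form1 /formi /formj /formk; ring.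
    by rewrite h1 hi; ring.
  - transitivity (form1 u x * zt x c2 - formi u x * zt x c3 + formj u x * zt x c0 + formk u x * zt x c1).
      by rewrite /D /form1 /formi /formj /formk; ring.
    by rewrite h1 hi; ring.
  - transitivity (form1 u x * zt x c3 + formi u x * zt x c2 - formj u x * zt x c1 + formk u x * zt x c0).
      by rewrite /D /form1 /formi /formj /formk; ring.
    by rewrite h1 hi; ring.
have X0 := X r0 e4 e6; have X1 := X r1 e5 e7.
have nz u : form1 u x = 0 -> formi u x = 0 -> x u c4 = 0 -> x u c5 = 0 ->
    formj u x = 0 -> formk u x = 0 -> False.
  move=> h1 hi h4 h5 hj hk; have [k] := sx u; have := X u h1 hi; rewrite hj hk.
  rewrite oppr0 !mul0r subr0 add0r => -[/eqP x0 /eqP x1 /eqP x2 /eqP x3].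
  move: x0 x1 x2 x3; rewrite !mulf_eq0 (negPf D0) /= => /eqP x0 /eqP x1 /eqP x2 /eqP x3.
  by move: k; apply: ord6P; rewrite ?x0 ?x1 ?x2 ?x3 ?h4 ?h5 normr0 => /n01.
(* If the permanent vanished too, both rows would be multiples of k z, hence parallel, against the
   vanishing of [near_inner]. *)
have cr : cross x != 0.
  apply/eqP => cr; move: cr e11 nz X0 X1; rewrite /cross => cr e11 nz X0 X1.
  have par : formj r0 x = 0 /\ formj r1 x = 0.
    move/eqP: e11; rewrite mulf_eq0 => /orP[] /eqP j0; move: cr; rewrite j0 ?mul0r ?mulr0 ?add0r ?addr0 => /eqP;
      rewrite mulf_eq0 => /orP[] /eqP k0 //.
    - by case: (nz r0).
    - by case: (nz r1).
  case: par => j0 j1; rewrite j0 j1 in X0 X1.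
  have k0 : formk r0 x != 0 by apply/eqP => k0; case: (nz r0).
  have k1 : formk r1 x != 0 by apply/eqP => k1; case: (nz r1).
  have := @near_inner_neq0 x (formk r0 x / formk r1 x); rewrite e10 eqxx => H.
  have : false; last by [].
  apply: H; [by rewrite mulf_neq0 ?invr_neq0| |exact: sx].
  case: X0 => a0 a1 a2 a3; case: X1 => b0 b1 b2 b3.
  apply: ord6P; rewrite ?e0 ?e1 ?e2 ?e3 ?mulr0 //; apply: (mulfI D0).
  - by rewrite a0 mulrCA b0; field.
  - by rewrite a1 mulrCA b1; field.
  - by rewrite a2 mulrCA b2; field.
  - by rewrite a3 mulrCA b3; field.
have cl : clamp (2 * cross x) != 0.
  apply/eqP => /clamp_eq0 /eqP; rewrite mulf_eq0 (negPf cr) orbF.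
  by rewrite pnatr_eq0.
have z1 : x r2 c1 = 0 by apply/eqP; move/eqP: e12; rewrite mulf_eq0 (negPf cl).
have z2 : x r2 c2 = 0 by apply/eqP; move/eqP: e13; rewrite mulf_eq0 (negPf cl).
have z3 : x r2 c3 = 0 by apply/eqP; move/eqP: e14; rewrite mulf_eq0 (negPf cl).
have thr0 : thr (0 : R) = 0 by apply: thr_small; rewrite normr0; lra.
have z0 : `|x r2 c0| = 1.
  by have [k] := sx r2; move: k; apply: ord6P; rewrite ?z1 ?z2 ?z3 ?e8 ?e9 ?normr0 // => /n01.
have zn : x r2 c0 != 0 by rewrite -normr_eq0 z0 oner_neq0.
have Z0 : zt x c0 = x r2 c0 by exact: thr_norm1.
have Z1 : zt x c1 = 0 by rewrite /zt z1.
have Z2 : zt x c2 = 0 by rewrite /zt z2.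
have Z3 : zt x c3 = 0 by rewrite /zt z3.
have xu0 u : form1 u x = 0 -> x u c0 = 0.
  by rewrite /form1 Z0 Z1 Z2 Z3 !mulr0 !addr0 => /eqP; rewrite mulf_eq0 (negPf zn) orbF => /eqP.
have xu1 u : formi u x = 0 -> x u c1 = 0.
  by rewrite /formi Z0 Z1 Z2 Z3 !mulr0 subr0 addr0 add0r => /eqP; rewrite mulf_eq0 (negPf zn) orbF => /eqP.
have x00 := xu0 _ e4; have x10 := xu0 _ e5; have x01 := xu1 _ e6; have x11 := xu1 _ e7.
have J u : formj u x = x u c2 * x r2 c0.
  by rewrite /formj Z0 Z1 Z2 Z3 !mulr0; ring.
have K u : formk u x = x u c3 * x r2 c0.
  by rewrite /formk Z0 Z1 Z2 Z3 !mulr0; ring.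
have crE : x r0 c2 * x r1 c3 + x r0 c3 * x r1 c2 != 0.
  by apply: contraNneq cr => e; rewrite /cross !J !K mulrACA [X in _ + X]mulrACA -mulrDl e mul0r.
have e11' : x r0 c2 * x r1 c2 = 0.
  move/eqP: e11; rewrite !J mulrACA mulf_eq0 => /orP[/eqP//|].
  by rewrite mulf_eq0 (negPf zn).
have ni : near_inner x = x r0 c2 * thr (x r1 c2) + thr (x r0 c2) * x r1 c2 +
    (x r0 c3 * thr (x r1 c3) + thr (x r0 c3) * x r1 c3).
  rewrite /near_inner sum6.
  by rewrite x00 x01 x10 x11 e0 e1 e2 e3 thr0; ring.
rewrite ni in e10.
have one u a b : x u c0 = 0 -> x u c1 = 0 -> x u c4 = 0 -> x u c5 = 0 ->
    (a, b) \in [:: (c2, c3); (c3, c2)] -> x u a = 0 -> `|x u b| = 1.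
  move=> h0 h1 h4 h5 ab ha; have [k] := sx u; move: k.
  by move: ab; rewrite !inE => /orP[] /eqP[aE bE]; move: ha; rewrite aE bE => ha;
    apply: ord6P; rewrite ?h0 ?h1 ?h4 ?h5 ?ha ?normr0 // => /n01.
have sgnP s : `|s| = 1 -> (-1) ^+ (s < 0)%R * s = 1.
  by case: ltrP => s0; [rewrite ltr0_norm // expr1 mulN1r|rewrite ger0_norm // expr0 mul1r].
(* One of the first two rows is, up to sign, j and the other is k; when the second one is j, the
   symmetry has to exchange them. *)
move/eqP: (e11'); rewrite mulf_eq0 => /orP[] /eqP x2.
- have x03 : `|x r0 c3| = 1 by apply: (one r0 c2 c3); rewrite ?inE ?eqxx.
  have x13 : x r1 c3 = 0.
    apply: add_thr_eq0; apply/eqP; have n0 : x r0 c3 != 0 by rewrite -normr_eq0 x03 oner_neq0.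
    have := e10; rewrite x2 thr0 !mul0r !add0r (thr_norm1 x03) -mulrDr => /eqP.
    by rewrite mulf_eq0 (negPf n0) /= addrC.
  have x12 : `|x r1 c2| = 1 by apply: (one r1 c3 c2); rewrite ?inE ?eqxx ?orbT.
  exists ([ffun b : 'I_3 => if b == r0 then x r1 c2 < 0 else if b == r1 then x r0 c3 < 0
    else x r2 c0 < 0], true).
  apply: ord3P; apply: ord6P; rewrite mxE ffunE /= /is_base /=;
    rewrite ?x00 ?x10 ?x01 ?x11 ?e0 ?e1 ?e2 ?e3 ?x2 ?x13 ?z1 ?z2 ?z3 ?e8 ?e9 ?mulr0 //; exact: sgnP.
- have x13 : `|x r1 c3| = 1 by apply: (one r1 c2 c3); rewrite ?inE ?eqxx.
  have x03 : x r0 c3 = 0.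
    apply: add_thr_eq0; apply/eqP; have n0 : x r1 c3 != 0 by rewrite -normr_eq0 x13 oner_neq0.
    have := e10; rewrite x2 thr0 !mulr0 !add0r (thr_norm1 x13) -mulrDl => /eqP.
    by rewrite mulf_eq0 (negPf n0) orbF.
  have x02 : `|x r0 c2| = 1 by apply: (one r0 c3 c2); rewrite ?inE ?eqxx ?orbT.
  exists ([ffun b : 'I_3 => if b == r0 then x r0 c2 < 0 else if b == r1 then x r1 c3 < 0
    else x r2 c0 < 0], false).
  apply: ord3P; apply: ord6P; rewrite mxE ffunE /= /is_base /=;
    rewrite ?x00 ?x10 ?x01 ?x11 ?e0 ?e1 ?e2 ?e3 ?x2 ?x03 ?z1 ?z2 ?z3 ?e8 ?e9 ?mulr0 //; exact: sgnP.
Qed.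

(** The bound 4 is attained by the estimate for entry 10, a sum of two shifts times [pair_sign],
    which is at most 2; the other entries are bounded by 2. *)
Lemma model_offset_bound x (j : 'I_15) : (forall u k, `|x u k| <= 1) ->
  `|(model_offset x)`_j| <= 4.
Proof.
move=> x1.
have T u k : `|thr (x u k)| <= 1 by apply: thr_bound.
have S n : `|shift R n| <= 1.
  rewrite ger0_norm ?divr_ge0 ?ler0n // ler_pdivrMr ?ltr0n // mul1r ler_nat.
  by apply: leq_trans (leq_subr _ _) _.
have M (a b p q : R) : `|a| <= p -> `|b| <= q -> `|a * b| <= p * q.
  by move=> ha hb; rewrite normrM ler_pM.
have A (a b p q : R) : `|a| <= p -> `|b| <= q -> `|a + b| <= p + q.
  by move=> ha hb; apply: le_trans (ler_normD _ _) _; apply: lerD.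
have mixb n n' u : `|mix (shift R n) (shift R n') u x| <= 2.
  by have := A _ _ _ _ (M _ _ _ _ (S n) (T u c2)) (M _ _ _ _ (S n') (T u c3)); rewrite mulr1.
have psb : `|pair_sign x| <= 2.
  by have := A _ _ _ _ (M _ _ _ _ (T r0 c2) (T r1 c3)) (M _ _ _ _ (T r0 c3) (T r1 c2)); rewrite mulr1.
have zb : `|zt x c0| <= 1 by exact: T.
have H : all (fun a => `|a| <= 4) (model_offset x).
  rewrite /model_offset /= !andbT.
  do 4![apply/andP; split; first by apply: le_trans (mixb _ _ _) _; lra].
  do 4![apply/andP; split; first by apply: le_trans (M _ _ _ _ (mixb _ _ _) zb) _; lra].
  do 2![apply/andP; split; first by apply: le_trans (M _ _ _ _ (S _) zb) _; lra].
  apply/andP; split; first by apply: le_trans (M _ _ _ _ (A _ _ _ _ (S _) (S _)) psb) _; lra.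
  apply/andP; split; first by apply: le_trans (M _ _ _ _ (S _) psb) _; lra.
  have pz := M _ _ _ _ psb zb.
  do 2![apply/andP; split; first by apply: le_trans (M _ _ _ _ (S _) pz) _; lra].
  by apply: le_trans (M _ _ _ _ (S _) pz) _; lra.
by move/(all_nthP 0): H; apply; rewrite ltn_ord.
Qed.
End ModelZeros.

(** * The model map on the grid *)

Section Grid.
Variables (R : realFieldType) (m : nat).
Notation w := (half_width m).
Implicit Types (c : cell m) (C : flagT m) (b : 'I_3) (k : 'I_6).

Definition pt c : 'M[R]_(3, 6) := \matrix_(b, k) ((c (Some (b, k)))%:R / w%:R - 1).

Lemma w_gt0 : 0 < w%:R :> R. Proof. by rewrite ltr0n. Qed.
Lemma w_neq0 : w%:R != 0 :> R. Proof. exact: lt0r_neq0 w_gt0. Qed.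

Lemma dblR : w.*2%:R = w%:R + w%:R :> R. Proof. by rewrite -addnn natrD. Qed.

Lemma pt_actc h c : pt (actc h c) = actm h (pt c).
Proof.
apply/matrixP => b k; rewrite !mxE ffunE; case: (h.1 b) => /=; last by rewrite expr0 mul1r.
rewrite subSS natrB; last by rewrite -ltnS.
rewrite dblR expr1.
by field; exact: w_neq0.
Qed.

Lemma pt_bound c b k : `|pt c b k| <= 1.
Proof.
rewrite mxE ler_norml lerBrDr addNr lerBlDr divr_ge0 ?ler0n //=.
rewrite ler_pdivrMr ?w_gt0 // mulrDl mul1r -natrD ler_nat addnn -ltnS.
exact: ltn_ord.
Qed.

Lemma boundary_pt c b k : boundary_at c (Some (b, k)) -> `|pt c b k| = 1.
Proof.
rewrite mxE => /orP[] /eqP ->; first by rewrite mul0r sub0r normrN1.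
by rewrite dblR mulrDl divff ?w_neq0 // addrK normr1.
Qed.

Lemma pt_boundary c b k : pt c b k = 1 -> c (Some (b, k)) = w.*2 :> nat.
Proof.
rewrite mxE => /(congr1 (fun z => (z + 1) * w%:R)).
rewrite subrK divfK ?w_neq0 // mulrDl mul1r -dblR => /eqP.
by rewrite eqr_nat => /eqP.
Qed.

Lemma valid_pt c b : valid c -> exists k, `|pt c b k| = 1.
Proof.
by case/andP => /forallP/(_ b)/existsP[k /boundary_pt]; exists k.
Qed.

(** Along a flag each coordinate changes at most once, from an even value to an adjacent odd one. *)
Lemma flag_even C n i : flag C -> (n <= 16)%N -> ~~ odd (vert C n i) -> vert C n i = vert C 0 i.
Proof.
move=> fC; elim: n => // n IH ln on.
have /existsP[i' f] := flag_cover fC ln; have [h1 h2 h3 h4] := freesP _ _ _ f.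
have ii' : i != i' by apply: contraNneq on => ->.
by rewrite h4 // IH ?(ltnW ln) // -h4.
Qed.

Lemma flag_adj C n i : flag C -> (n <= 16)%N -> odd (vert C n i) ->
  (vert C n i = (vert C 0 i).+1 :> nat) \/ (vert C 0 i = (vert C n i).+1 :> nat).
Proof.
move=> fC; elim: n => [_|n IH ln on].
  case/and3P: fC => /eqP/setP/(_ i); rewrite !inE => e _ _ o.
  by rewrite o in e.
have /existsP[i' f] := flag_cover fC ln; have [h1 h2 h3 h4] := freesP _ _ _ f.
case: (eqVneq i i') => [ii'|ii']; last by rewrite h4 //; apply: IH; rewrite ?(ltnW ln) // -h4.
by rewrite ii' -(flag_even fC (ltnW ln) h1).
Qed.

Lemma flag_odd C n n' i : flag C -> (n <= n')%N -> (n' <= 16)%N ->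
  odd (vert C n i) -> vert C n' i = vert C n i.
Proof.
move=> fC nn' ln' on; elim: n' nn' ln' => [|n' IH]; first by rewrite leqn0 => /eqP->.
rewrite leq_eqVlt => /orP[/eqP->//|nn'] ln'.
have /existsP[i' f] := flag_cover fC ln'; have [h1 h2 h3 h4] := freesP _ _ _ f.
have E := IH nn' (ltnW ln'); rewrite h4 //.
by apply: contraNneq h1 => <-; rewrite E.
Qed.

Lemma nat_close (a b : nat) : (b = a.+1) \/ (a = b.+1) -> `|(b%:R : R) - a%:R| = 1.
Proof.
by case=> ->; rewrite -addn1 natrD; [rewrite addrAC subrr add0r normr1|rewrite opprD addrA subrr add0r normrN1].
Qed.

Lemma pt_flag_close C n b k : flag C -> (n <= 16)%N ->
  `|pt (vert C n) b k - pt (vert C 0) b k| <= w%:R^-1.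
Proof.
move=> fC ln; rewrite !mxE opprB addrA subrK -mulrBl normrM.
rewrite [X in _ * X]ger0_norm ?invr_ge0 ?ler0n // -[leRHS]mul1r ler_pM2r ?invr_gt0 ?w_gt0 //.
case: (boolP (odd (vert C n (Some (b, k))))) => o.
  by rewrite nat_close //; exact: flag_adj.
by rewrite (flag_even fC ln o) subrr normr0.
Qed.

Definition chart_seq : seq ('I_3 * 'I_6) := mkseq chart 15.
Definition chart_rank (p : 'I_3 * 'I_6) : nat := index p chart_seq.

Lemma chart_uniq : uniq chart_seq. Proof. by []. Qed.

Lemma chart_rankK (n : nat) : (n < 15)%N -> chart_rank (chart n) = n.
Proof.
move=> ln; rewrite /chart_rank -[X in index X](nth_mkseq (r0, c0) chart ln).
by rewrite index_uniq ?size_mkseq ?chart_uniq.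
Qed.

Lemma chart_rank_lt (p : 'I_3 * 'I_6) : ~~ is_base p.1 p.2 ->
  (chart_rank p < 15)%N /\ chart (chart_rank p) = p.
Proof.
case: p => b k /= nb; have pin : (b, k) \in chart_seq.
  by move: b k nb; apply: ord3P; apply: ord6P.
have lt : (chart_rank (b, k) < 15)%N by rewrite /chart_rank -[15%N](size_mkseq chart) index_mem.
split => //; have := nth_index (r0, c0) pin.
by rewrite nth_mkseq.
Qed.

Lemma chart_base (n : nat) : (n < 15)%N -> ~~ is_base (chart n).1 (chart n).2.
Proof. by do 15![case: n => [//|n]]. Qed.

(* The flag at the zero of the model: coordinates leave the grid point in the
   order of decreasing shifts. *)
Definition star_value (n : nat) (i : idx) : nat :=
  if i is Some p then (if is_base p.1 p.2 then w.*2 else w + (chart_rank p < n))%N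
  else (if n == 16 then 1 else 2)%N.

Definition star : flagT m := [ffun n : 'I_17 => [ffun i => inord (star_value n i)]].

Lemma star_value_lt n i : (star_value n i < w.*2.+1)%N.
Proof.
have w2 : (2 <= w)%N by rewrite /half_width doubleS.
rewrite /star_value; case: i => [p|]; last by case: ifP => _; move: w2; move: w; lia.
by case: ifP => // _; move: w2; move: w; case: (_ < _)%N; lia.
Qed.

Lemma starE n i : (n <= 16)%N -> vert star n i = star_value n i :> nat.
Proof. by move=> ln; rewrite /vert !ffunE !inordK ?star_value_lt. Qed.

Lemma odd_star n i : (n <= 16)%N -> odd (vert star n i) =
  if i is Some p then ~~ is_base p.1 p.2 && (chart_rank p < n)%N else n == 16.
Proof.
move=> ln; rewrite starE // /star_value; case: i => [p|]; last by case: ifP.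
case: ifP => _; first by rewrite odd_double.
by rewrite oddD /half_width odd_double; case: (_ < _)%N.
Qed.

Lemma star_flag : flag star.
Proof.
apply/and3P; split.
- apply/eqP/setP => i; rewrite !inE odd_star //.
  by case: i => [p|//]; rewrite ltn0 andbF.
- apply/forallP => n; have ln := ltn_ord n; apply/existsP.
  have [n15|n15] := ltnP n 15; last first.
    have nE : n = 15 :> nat by lia.
    exists None; apply/freesP; rewrite nE !odd_star //; split => //.
      by right; rewrite !starE.
    move=> [p _|//]; apply/val_inj; rewrite /= !starE // /star_value.
    case: ifP => // nb; have [lt _] := chart_rank_lt (negbT nb).
    by rewrite lt (ltn_trans lt).
  have nb := chart_base n15.
  exists (Some (chart n)); apply/freesP; rewrite !odd_star ?(ltnW ln) //.
  rewrite chart_rankK // ltnn ltnSn andbF nb; split => //.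
    by left; rewrite !starE ?(ltnW ln) // /star_value (negPf nb) chart_rankK // ltnn ltnSn addn0 addn1.
  move=> i ni; apply/val_inj; rewrite /= !starE ?(ltnW ln) // /star_value.
  case: i ni => [p|] ni; last by rewrite !ltn_eqF // ?(ltn_trans n15).
  case: ifP => // nbp; have [_ cp] := chart_rank_lt (negbT nbp).
  congr (_ + nat_of_bool _)%N; rewrite ltnS [LHS]leq_eqVlt.
  by case: eqP => //= e; move: ni; rewrite -cp e eqxx.
- apply/andP; split; last by rewrite starE.
  apply/forallP => b; apply/existsP.
  exists (if b == r0 then c2 else if b == r1 then c3 else c0).
  rewrite /boundary_at starE // /star_value.
  by apply/orP; right; move: b; apply: ord3P; apply/eqP.
Qed.

Lemma pt_star n b k : (n <= 16)%N -> pt (vert star n) b k =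
  if is_base b k then 1 else (chart_rank (b, k) < n)%N%:R / w%:R.
Proof.
move=> ln; rewrite mxE starE // /star_value /=; case: ifP => _.
  by rewrite dblR mulrDl divff ?w_neq0 // addrK.
by rewrite natrD mulrDl divff ?w_neq0 // addrC addKr.
Qed.

Variable F : cell m -> 'rV[R]_15.
Hypothesis F_close : forall c (j : 'I_15), c None = 2 :> nat ->
  `|F c 0 j - model w%:R^-1 (pt c) 0 j| <= (1000 * w%:R)^-1.

(** All cells of the facet opposite the last vertex are in the region where [model_near_base]
    applies. *)
Definition based C : Prop := forall n, (n <= 15)%N -> [/\
  vert C n None = 2 :> nat,
  forall b k, is_base b k -> pt (vert C n) b k = 1 &
  forall b k, ~~ is_base b k -> `|pt (vert C n) b k| <= 1 / 2].

Definition centred C (j : 'I_17) (i : nat) : R := (C j (Some (chart i)))%:R - w%:R.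

Lemma centredE C j i : w%:R * pt (C j) (chart i).1 (chart i).2 = centred C j i.
Proof. by rewrite mxE -surjective_pairing mulrBr mulr1 mulrC divfK // w_neq0. Qed.

(** In units of the grid the model is a chart coordinate minus its shift, up to the mixing in entry
    10, and [F] differs from it by at most 1/1000. So a relation between the values of [F] nearly
    holds for the coordinates. *)
Lemma relation_estimate C l : based C -> l ord_max = 0 ->
  \sum_j l j *: F (C j) = 0 -> forall i : nat, (i < 15)%N ->
  `|\sum_j l j * (centred C j i - shift R i)| <= (\sum_j `|l j|) / 500.
Proof.
move=> bC l16 lF.
have vC (j : 'I_17) : j != ord_max -> [/\ C j None = 2 :> nat,
  forall b k, is_base b k -> pt (C j) b k = 1 &
  forall b k, ~~ is_base b k -> `|pt (C j) b k| <= 1 / 2].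
  move=> jm; have lj : (j <= 15)%N.
    by have := ltn_ord j; rewrite ltnS leq_eqVlt; case/orP => [/eqP e|//]; case/eqP: jm; apply/val_inj.
  by have := bC j lj; rewrite /vert inord_val.
pose D i (j : 'I_17) := centred C j i - shift R i.
pose A := \sum_j `|l j|.
have H (i : 'I_15) : `|\sum_j l j * (D i j + if i == 10 :> nat then D 11 j else 0)| <= A / 1000.
  have -> : \sum_j l j * (D i j + if i == 10 :> nat then D 11 j else 0) =
      \sum_j l j * (w%:R * (model w%:R^-1 (pt (C j)) 0 i - F (C j) 0 i)).
    have E : \sum_j l j * (w%:R * F (C j) 0 i) = 0.
      have /rowP/(_ i) := lF; rewrite summxE mxE => e.
      under eq_bigr do rewrite mulrCA.
      rewrite -mulr_sumr; have -> : \sum_j l j * F (C j) 0 i = 0 by rewrite -[RHS]e; apply: eq_bigr => j _; rewrite mxE.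
      by rewrite mulr0.
    under [RHS]eq_bigr do rewrite mulrBr mulrBr.
    rewrite sumrB E subr0; apply: eq_bigr => j _.
    case: (eqVneq j ord_max) => [->|jm]; first by rewrite l16 !mul0r.
    congr (_ * _); have [_ h1 h2] := vC j jm.
    rewrite (model_near_base _ h1 h2) mulrDr mulrBr centredE mulrA divff ?w_neq0 // mul1r.
    congr (_ + _); case: ifP => _; last by rewrite mulr0.
    by rewrite mulrBr (centredE C j 11) mulrA divff ?w_neq0 // mul1r.
  apply: le_trans (ler_norm_sum _ _ _) _; rewrite /A mulr_suml; apply: ler_sum => j _.
  case: (eqVneq j ord_max) => [->|jm]; first by rewrite l16 mul0r normr0 mul0r.
  rewrite normrM; apply: ler_wpM2l => //; have [t _ _] := vC j jm.
  rewrite normrM distrC (ger0_norm (ltW w_gt0)).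
  apply: le_trans (ler_wpM2l (ltW w_gt0) (F_close i t)) _.
  by rewrite invfM mulrCA divff ?w_neq0 // mulr1.
move=> i li; have A0 : 0 <= A by apply: sumr_ge0.
have Hi := H (Ordinal li); rewrite /= in Hi.
(* Entry 10 also contains coordinate 11; removing it by means of entry 11 doubles the error to
   1/500. *)
case: (eqVneq i 10) Hi => [->|i10] Hi; last first.
  move: Hi; under eq_bigr do rewrite addr0.
  by move=> Hi; apply: le_trans Hi _; rewrite -/A; lra.
have H11 := H (@Ordinal 15 11 isT); rewrite /= in H11.
move: Hi H11; under eq_bigr do rewrite mulrDr.
under [X in _ -> `|X| <= _ -> _]eq_bigr do rewrite addr0.
rewrite big_split /= -/A; move: (\sum_j l j * D 10 j) (\sum_j l j * D 11 j) => u v.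
by rewrite !ler_norml => /andP[? ?] /andP[? ?]; apply/andP; split; lra.
Qed.

End Grid.

(** * The sixteen captured facets at the model end *)

Section Count.
Variables (R : realFieldType) (m : nat).
Notation w := (half_width m).
Notation pt := (@pt R m).
Implicit Types (c : cell m) (C : flagT m) (b : 'I_3) (k : 'I_6).

Lemma vertE C (j : 'I_17) : C j = vert C j.
Proof. by rewrite /vert inord_val. Qed.

Lemma time_constant C n : flag C -> ~~ odd (vert C 15 None) -> (n <= 15)%N ->
  vert C n None = vert C 15 None.
Proof.
move=> fC e ln; have l16 : (n <= 16)%N by apply: leq_trans ln _.
rewrite (flag_even fC _ e) //; apply: flag_even => //.
by apply: contra e => o; rewrite (flag_odd fC ln _ o).
Qed.

Lemma based_near C : flag C -> vert C 15 None = 2 :> nat -> w%:R^-1 <= 1 / 4 :> R ->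
  (forall b k, `|pt (vert C 0) b k - (is_base b k)%:R| <= 1 / 4) -> based R C.
Proof.
move=> fC t w4 H n ln; have l16 : (n <= 16)%N by apply: leq_trans ln _.
have D b k : `|pt (vert C n) b k - (is_base b k)%:R| <= 1 / 2.
  have := H b k; have := @pt_flag_close R m C n b k fC l16.
  move: (pt _ _ _) (pt _ _ _) => u v; move: w4; rewrite !ler_norml.
  by move=> ? /andP[? ?] /andP[? ?]; apply/andP; split; lra.
split.
- by rewrite (time_constant fC) // t.
(* Each row has an entry of absolute value 1; within 1/2 of the base point it can only be the base
   entry, with a positive sign. *)
- move=> b k bb; have [k' k'1] := @valid_pt R m _ b (flag_valid fC l16).
  case: (eqVneq k' k) k'1 => [->|kk'] h; last first.
    have := D b k'; have -> : is_base b k' = false.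
      by apply: contraNF kk'; move: b k k' bb {h}; apply: ord3P; apply: ord6P => //; apply: ord6P.
    by rewrite subr0 h; lra.
  have := D b k; rewrite bb mulr1n; move: h; case: (lerP 0 (pt (vert C n) b k)) => h0.
    by rewrite ger0_norm // => ->.
  by rewrite ltr0_norm // ler_norml => h /andP[? ?]; exfalso; move: h h0; lra.
- by move=> b k nb; have := D b k; rewrite (negPf nb) subr0.
Qed.

Lemma based_star : based R (star m).
Proof.
move=> n ln; have l16 : (n <= 16)%N by apply: leq_trans ln _.
split=> [|b k bb|b k nb].
- by rewrite starE // /star_value ltn_eqF.
- by rewrite pt_star // bb.
- rewrite pt_star // (negPf nb) ger0_norm ?divr_ge0 ?ler0n //.
  rewrite ler_pdivrMr ?w_gt0 // mulrC mulrA mulr1 ler_pdivlMr ?ltr0n // -natrM ler_nat.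
  by rewrite /half_width doubleS; case: (_ < _)%N.
Qed.

Variable F : cell m -> 'rV[R]_15.
Hypothesis F_close : forall c (j : 'I_15), c None = 2 :> nat ->
  `|F c 0 j - model w%:R^-1 (pt c) 0 j| <= (1000 * w%:R)^-1.

(** The weights average each chart coordinate nearly to its shift. Coordinates go from 0 to 1 along
    the flag, so the decreasing shifts dictate the order in which they do so. *)
Lemma star_unique C : flag C -> based R C ->
  zero_facet (fun j : 'I_17 => F (C j)) ord_max -> C = star m.
Proof.
move=> fC bC [l [l0 l16 [q lq] lF]].
pose A := \sum_j l j.
have A0 : 0 < A.
  by rewrite /A (bigD1 q) //= ltr_pwDl // sumr_ge0.
have AE : \sum_j `|l j| = A by apply: eq_bigr => j _; rewrite ger0_norm.
have lt16 (j : 'I_17) : j != ord_max -> (j <= 15)%N.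
  by move=> jm; have := ltn_ord j; rewrite ltnS leq_eqVlt => /orP[/eqP e|//]; case/eqP: jm; apply/val_inj.
have est i : (i < 15)%N -> `|\sum_j l j * centred R C j i - A * shift R i| <= A / 500.
  move=> li; have := relation_estimate F_close bC l16 lF li; rewrite AE.
  under eq_bigr do rewrite mulrBr.
  by rewrite sumrB -mulr_suml.
have sh i : (i < 15)%N -> 1 / 16 <= shift R i <= 15 / 16.
  move=> li; rewrite /shift !ler_pM2r ?invr_gt0 ?ltr0n //.
  by rewrite (ler_nat R 1) (ler_nat R _ 15) subn_gt0 li leq_subr.
have avg_le i : (i < 15)%N -> (forall j, j != ord_max -> centred R C j i <= 0) -> False.
  move=> li H; have := est i li; have /andP[s1 _] := sh i li.
  have h : \sum_j l j * centred R C j i <= 0.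
    apply: sumr_le0 => j _; case: (eqVneq j ord_max) => [->|jm]; first by rewrite l16 mul0r.
    by rewrite mulr_ge0_le0 // H.
  rewrite ler_norml => /andP[h1 h2].
  have h3 : A * (1 / 16) <= A * shift R i by rewrite ler_wpM2l // ltW.
  by move: h h1 h3 A0; lra.
have avg_ge i : (i < 15)%N -> (forall j, j != ord_max -> 1 <= centred R C j i) -> False.
  move=> li H; have := est i li; have /andP[_ s2] := sh i li.
  have h : A <= \sum_j l j * centred R C j i.
    apply: ler_sum => j _; case: (eqVneq j ord_max) => [->|jm]; first by rewrite l16 mul0r.
    by rewrite -[leLHS]mulr1 ler_wpM2l // H.
  rewrite ler_norml => /andP[h1 h2].
  have h3 : A * shift R i <= A * (15 / 16) by rewrite ler_wpM2l // ltW.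
  by move: h h2 h3 A0; lra.
(* The l-averages of the chart coordinates are close to the shifts, which lie
   strictly between 0 and 1, so a chart coordinate can only move from 0 to 1. *)
have cval i : (i < 15)%N -> forall n, (n <= 15)%N ->
    vert C n (Some (chart i)) = (w + odd (vert C n (Some (chart i))))%N :> nat.
  move=> li; set I := Some (chart i).
  have offN j : centred R C j i = (vert C j I)%:R - w%:R by rewrite /centred vertE.
  have ev0 : ~~ odd (vert C 0 I).
    by case/and3P: fC => /eqP/setP/(_ I); rewrite !inE => ->.
  have wev : ~~ odd w by rewrite odd_double.
  have adj n : (n <= 15)%N -> vert C n I = vert C 0 I \/ odd (vert C n I) /\
      ((vert C n I = (vert C 0 I).+1 :> nat) \/ (vert C 0 I = (vert C n I).+1 :> nat)).
    move=> ln; have l16' : (n <= 16)%N by apply: leq_trans ln _.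
    case: (boolP (odd (vert C n I))) => o; [right|left]; last exact: flag_even.
    by split => //; exact: flag_adj.
  have le0 : (forall n, (n <= 15)%N -> (vert C n I <= w)%N) -> False.
    move=> H; apply: (avg_le i li) => j jm.
    by rewrite offN subr_le0 ler_nat H // lt16.
  have ge1 : (forall n, (n <= 15)%N -> (w < vert C n I)%N) -> False.
    move=> H; apply: (avg_ge i li) => j jm.
    by rewrite offN lerBrDr nat1r ler_nat; apply: H; exact: lt16.
  have c0w : vert C 0 I = w :> nat.
    case: (ltngtP (vert C 0 I) w) => // h; exfalso; [apply: le0|apply: ge1] => n ln.
      case: (adj n ln) => [->|[] o]; first exact: ltnW.
      by move: (nat_of_ord (vert C n I)) o => v o [] e; move: h; [rewrite e|lia].
    (* Both [w] and the starting value are even, so the excess is at least 2, and no later cell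
       comes down to [w]. *)
    have h' : (w.+1 < vert C 0 I)%N.
      rewrite ltn_neqAle h andbT; apply: contraNneq ev0 => <-.
      by rewrite oddS wev.
    case: (adj n ln) => [->|[] o]; first exact: ltnW.
    by move: (nat_of_ord (vert C n I)) o => v o [] e; move: h'; rewrite e ?ltnS // => ?; lia.
  move=> n ln; have l16' : (n <= 16)%N by apply: leq_trans ln _.
  case: (boolP (odd (vert C n I))) => o; last by rewrite (flag_even fC l16' o) c0w addn0.
  rewrite addn1; case: (flag_adj fC l16' o); rewrite c0w // => e.
  exfalso; apply: le0 => j lj; have l16j : (j <= 16)%N by apply: leq_trans lj _.
  case: (boolP (odd (vert C j I))) => oj; last by rewrite (flag_even fC l16j oj) c0w.
  have -> : vert C j I = vert C n I.
    case: (leqP j n) => [jn|/ltnW nj]; first by rewrite (flag_odd fC jn l16' oj).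
    exact: flag_odd.
  by have := leqnSn (vert C n I); rewrite -e.
have offO i (j : 'I_17) : (i < 15)%N -> j != ord_max ->
    centred R C j i = (odd (C j (Some (chart i))))%:R.
  by move=> li jm; rewrite /centred !vertE {1}(cval i li j (lt16 j jm)) natrD addrC addKr.
(* If [i] turned odd first, its average would be at least that of [i'], but the shifts differ by at
   least 1/16 the other way, more than both errors of 1/500. *)
have earlier i i' n : (i < 15)%N -> (i' < i)%N -> (n <= 15)%N ->
    odd (vert C n (Some (chart i))) -> odd (vert C n (Some (chart i'))).
  move=> li ii' ln o; apply: contraT => o'; exfalso.
  have li' : (i' < 15)%N by apply: ltn_trans li.
  have h : \sum_j l j * centred R C j i' <= \sum_j l j * centred R C j i.
    apply: ler_sum => j _; case: (eqVneq j ord_max) => [->|jm]; first by rewrite l16 !mul0r.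
    apply: ler_wpM2l => //; rewrite !offO // ler_nat !vertE.
    have lj := lt16 j jm.
    case: (leqP n j) => nj.
      rewrite (flag_odd fC nj _ o) ?o; last by apply: leq_trans lj _.
      by case: (odd _).
    suff -> : odd (vert C j (Some (chart i'))) = false by [].
    apply: contraNF o' => oj.
    by rewrite (flag_odd fC (ltnW nj) _ oj) //; apply: leq_trans ln _.
  have := est i li; have := est i' li'; rewrite !ler_norml => /andP[h1 h2] /andP[h3 h4].
  have h5 : A * (1 / 16) <= A * shift R i' - A * shift R i.
    rewrite -mulrBr; apply: ler_wpM2l; first exact: ltW.
    have : (15 - i)%:R + 1 <= (15 - i')%:R :> R by rewrite natr1 ler_nat ltn_sub2l.
    by rewrite /shift; move: ((15 - i)%:R : R) ((15 - i')%:R : R) => u v; lra.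
  by move: h h1 h2 h3 h4 h5 A0; lra.
have even_base n b k : (n <= 15)%N -> is_base b k ->
    vert C n (Some (b, k)) = w.*2 :> nat.
  by move=> ln bb; apply: (@pt_boundary R); have [_ -> //] := bC n ln.
have time2 n : (n <= 15)%N -> vert C n None = 2 :> nat by move=> /bC[].
(* The odd chart coordinates form an initial segment, and its length is the dimension [n] of the
   cell. *)
pose im (n : nat) : {set idx} := [set (Some (chart (i : 'I_n)) : idx) | i in 'I_n]%SET.
have oddE n i : (n <= 15)%N -> (i < 15)%N -> odd (vert C n (Some (chart i))) = (i < n)%N.
  move=> ln li; have cn := flag_card fC (leq_trans ln (isT : (15 <= 16)%N)).
  have inj j j' : (j < 15)%N -> (j' < 15)%N -> chart j = chart j' -> j = j'.
    by move=> lj lj' /(congr1 chart_rank); rewrite !chart_rankK.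
  apply/idP/idP => [on|lt].
  - have sub : im i.+1 \subset odd_set (vert C n).
      apply/fintype.subsetP => j /imsetP[u _ ->]; rewrite inE.
      have := ltn_ord u; rewrite ltnS leq_eqVlt => /orP[/eqP->//|ui].
      exact: earlier on.
    have := subset_leq_card sub; rewrite cn card_imset ?card_ord // => u v [] /inj e.
    by apply/val_inj/e; apply: leq_trans (ltn_ord _) _.
  - apply: contraT => o; exfalso.
    have sub : odd_set (vert C n) \subset im i.
      apply/fintype.subsetP => -[[b k]|]; rewrite inE => oj; last by rewrite time2 in oj.
      have nb : ~~ is_base b k by apply: contraTN oj => /(even_base n b k ln)->; rewrite odd_double.
      have [lr cr] := @chart_rank_lt (b, k) nb; rewrite -cr in oj.
      have ri : (chart_rank (b, k) < i)%N.
        rewrite ltnNge leq_eqVlt; apply/negP => /orP[/eqP e|ri].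
          by rewrite -e (negPf o) in oj.
        by move: o; rewrite (earlier _ _ _ lr ri ln oj).
      by apply/imsetP; exists (Ordinal ri) => //=; rewrite cr.
    have := subset_leq_card sub; rewrite cn leqNgt; apply/negP; rewrite negbK.
    by apply: leq_ltn_trans (leq_imset_card _ _) _; rewrite card_ord.
have CS n : (n <= 15)%N -> vert C n = vert (star m) n.
  move=> ln; apply/ffunP => i; apply/val_inj => /=.
  rewrite starE; last by apply: leq_trans ln _.
  rewrite /star_value; case: i => [[b k]|]; last by rewrite time2 // ltn_eqF.
  case: ifP => [|nb]; first exact: even_base.
  have [lr cr] := @chart_rank_lt (b, k) (negbT nb).
  by rewrite -{1}cr cval // cr -{1}cr oddE.
apply/ffunP => j; rewrite !vertE.
have := ltn_ord j; rewrite ltnS leq_eqVlt => /orP[/eqP->|lj]; last exact: CS.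
(* The last cell is forced by the facet, which lies at the end of time. *)
apply: (@top_time m (vert C 15)); rewrite ?time2 //.
- by rewrite (flag_card fC).
- exact: (flag_cover fC).
- by case/and3P: fC.
- by rewrite CS //; apply: (flag_cover (star_flag m)).
- by case/and3P: (star_flag m).
Qed.

(** The shifts are the barycentric averages of the chart coordinates over the 16 cells of the facet.
    So any relation supported there has nearly equal weights, all of one sign. *)
Lemma star_zero : zero_facet (fun j : 'I_17 => F (star m j)) ord_max.
Proof.
have [l [l16 [q lq] lF]] := dependent_rows (fun j : 'I_17 => F (star m j)) ord_max.
pose A := \sum_j `|l j|.
have A0 : 0 < A.
  by rewrite /A (bigD1 q) //= ltr_pwDl ?normr_gt0 // sumr_ge0.
(* Chart coordinate [n] is 1 on exactly the cells [j] with [n < j], so its weighted sum is the tail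
   [U n.+1]. *)
pose U n := \sum_(j < 17 | (n <= j)%N) l j.
pose S := \sum_j l j.
have US (j : 'I_17) : l j = U j - U j.+1.
  rewrite /U (bigD1 j) //= [X in _ = _ + X - _](eq_bigl (fun j' : 'I_17 => (j < j')%N)) ?addrK //.
  by move=> j' /=; rewrite ltn_neqAle andbC eq_sym.
have Uest n : (n <= 16)%N -> `|U n - S * ((16 - n)%:R / 16)| <= A / 500.
  have A5 : 0 <= A / 500 by move: A0; lra.
  case: n => [_|n]; first by rewrite /U /S divff ?pnatr_eq0 // mulr1 subrr normr0.
  rewrite ltnS leq_eqVlt => /orP[/eqP->|ln].
    rewrite subnn mul0r mulr0 subr0 /U big1 ?normr0 // => j lj.
    suff -> : j = ord_max by [].
    by apply/val_inj/eqP; rewrite eqn_leq lj -ltnS ltn_ord.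
  have := relation_estimate F_close based_star l16 lF ln; rewrite -/A.
  under eq_bigr do rewrite mulrBr.
  rewrite sumrB -mulr_suml; congr (`|_ - _| <= _).
  rewrite /U [RHS]big_mkcond /=; apply: eq_bigr => j _.
  rewrite /centred vertE starE; last by rewrite -ltnS.
  rewrite /star_value (negPf (chart_base ln)) chart_rankK // natrD addrC addKr.
  by case: (_ < _)%N; rewrite ?mulr1 ?mulr0.
have lest (j : 'I_17) : j != ord_max -> `|l j - S / 16| <= A / 250.
  move=> jm; have lj : (j <= 15)%N.
    by have := ltn_ord j; rewrite ltnS leq_eqVlt => /orP[/eqP e|//]; case/eqP: jm; apply/val_inj.
  have := Uest j (leq_trans lj (isT : (15 <= 16)%N)); have := Uest j.+1 lj.
  have -> : ((16 - j)%:R : R) = (16 - j.+1)%:R + 1 by rewrite natr1; congr (_%:R); lia.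
  rewrite US; move: (U j) (U j.+1) ((16 - j.+1)%:R : R) => u v z.
  by rewrite !ler_norml => /andP[? ?] /andP[? ?]; apply/andP; split; lra.
(* Sixteen errors of [A / 250] add up to this; in particular the sum [S] is not zero. *)
have AS : A <= `|S| + A * (8 / 125).
  rewrite /A big_ord_recr /= l16 normr0 addr0.
  apply: (@le_trans _ _ (\sum_(j < 16) (`|S| / 16 + A / 250))).
    apply: ler_sum => j _; have := lest (widen_ord (leqnSn 16) j).
    have -> : widen_ord (leqnSn 16) j != ord_max.
      by rewrite -val_eqE /= ltn_eqF.
    move=> /(_ isT); have := ler_normD (l (widen_ord (leqnSn 16) j) - S / 16) (S / 16).
    have n16 : `|16^-1| = 16^-1 :> R by rewrite ger0_norm // invr_ge0 ler0n.
    rewrite subrK normrM n16.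
    by move: (`|l _|) (`|S|) (`|_ - _|) => u v z; lra.
  rewrite sumr_const card_ord -mulr_natl /A big_ord_recr /= l16 normr0 addr0; lra.
have S0 : S != 0 by apply/eqP => S0; move: AS A0; rewrite S0 normr0; lra.
pose l' j := Num.sg S * l j.
have l'pos j : j != ord_max -> 0 < l' j.
  move=> jm; have := lest j jm; rewrite /l'.
  case: (ltrgtP S 0) S0 AS => // sS _ AS.
    rewrite ltr0_sg // ler_norml => /andP[_ h].
    by move: AS h; rewrite ltr0_norm //; lra.
  rewrite gtr0_sg // ler_norml => /andP[h _].
  by move: AS h; rewrite gtr0_norm //; lra.
exists l'; split.
- move=> j; case: (eqVneq j ord_max) => [->|jm]; last exact/ltW/l'pos.
  by rewrite /l' l16 mulr0.
- by rewrite /l' l16 mulr0.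
- by exists ord0; apply: l'pos.
- under eq_bigr do rewrite -scalerA.
  by rewrite -scaler_sumr lF scaler0.
Qed.

(** A symmetry moves any captured facet near the base point, where it belongs to [star]; the orbit
    of [star] has 16 members by freeness. *)
Lemma card_model_zeros : equivariant F -> w%:R^-1 <= 1 / 4 :> R ->
  (forall j, free_cell (star m j)) ->
  (forall C, flag C -> vert C 15 None = 2 :> nat ->
    zero_facet (fun j : 'I_17 => F (C j)) ord_max ->
    exists h, forall b k, `|actm h (pt (vert C 0)) b k - (is_base b k)%:R| <= 1 / 4) ->
  #|[set C | [&& flag C, `[< zero_facet (fun j : 'I_17 => F (C j)) ord_max >] &
     vert C 15 None == 2 :> nat]]%SET| = 16.
Proof.
move=> eF w4 fr near.
have -> : [set C | [&& flag C, `[< zero_facet (fun j : 'I_17 => F (C j)) ord_max >] &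
     vert C 15 None == 2 :> nat]]%SET = [set actf h (star m) | h in symm]%SET.
  apply/setP => C; rewrite inE; apply/and3P/imsetP => [[fC /asboolP zC /eqP t]|[h _ ->]].
    have [h nh] := near C fC t zC; exists (invh h) => //.
    rewrite -(@star_unique (actf h C)).
    - by apply/ffunP => j; rewrite !ffunE actcK.
    - exact: flag_actf.
    - apply: based_near => //; first exact: flag_actf.
        by rewrite /vert !ffunE.
      by move=> b k; have := nh b k; rewrite -pt_actc /vert ffunE.
    - exact/(zero_facet_actf h C ord_max eF).
  split; first exact/flag_actf/star_flag.
    apply/asboolP; apply/(zero_facet_actf h _ _ eF); exact: star_zero.
  by rewrite /vert ffunE ffunE -/(vert (star m) 15) starE.
rewrite card_imset ?card_symm // => h g /ffunP/(_ ord0); rewrite [LHS]ffunE [RHS]ffunE.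
exact: free_cellP (fr ord0).
Qed.
End Count.

(** * Continuity *)

Section Continuity.
Variable R : realFieldType.
Implicit Types (x : 'M[R]_(3, 6)) (f g : 'M[R]_(3, 6) -> R).

Definition within_radius (r : R) x x' := forall b k, `|x' b k - x b k| <= r.

Definition cts f x := forall e : R, 0 < e ->
  exists2 r, 0 < r & forall x', within_radius r x x' -> `|f x' - f x| < e.

Lemma within_radius_le (r s : R) x x' : r <= s -> within_radius r x x' -> within_radius s x x'.
Proof. by move=> rs H b k; apply: le_trans rs. Qed.

Lemma cts_ext f g x : (forall y, f y = g y) -> cts g x -> cts f x.
Proof. by move=> fg cg e /cg[r r0 H]; exists r => // x' /H; rewrite !fg. Qed.

Lemma cts_cst a x : cts (fun=> a) x.
Proof. by move=> e e0; exists 1 => // x' _; rewrite subrr normr0. Qed.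

Lemma cts_coord b k x : cts (fun y => y b k) x.
Proof.
move=> e e0; exists (e / 2); first by rewrite divr_gt0.
by move=> x' H; apply: le_lt_trans (H b k) _; lra.
Qed.

Lemma cts2 (op : R -> R -> R) f g x : cts f x -> cts g x ->
  (forall e, 0 < e -> exists2 d, 0 < d & forall s t, `|s - f x| < d -> `|t - g x| < d ->
     `|op s t - op (f x) (g x)| < e) -> cts (fun y => op (f y) (g y)) x.
Proof.
move=> cf cg H e e0; have [d d0 Hd] := H e e0.
have [r r0 Hr] := cf d d0; have [s s0 Hs] := cg d d0.
exists (Num.min r s); first by rewrite lt_min r0 s0.
move=> x' xx'; apply: Hd; [apply: Hr|apply: Hs]; apply: within_radius_le xx'.
  by rewrite ge_min lexx.
by rewrite ge_min lexx orbT.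
Qed.

Lemma ctsD f g x : cts f x -> cts g x -> cts (fun y => f y + g y) x.
Proof.
move=> cf cg; apply: (cts2 (op := fun a b => a + b) cf cg) => e e0.
exists (e / 2); first by rewrite divr_gt0.
move=> s t sf tg; rewrite opprD addrACA; apply: le_lt_trans (ler_normD _ _) _; lra.
Qed.

Lemma ctsM f g x : cts f x -> cts g x -> cts (fun y => f y * g y) x.
Proof.
move=> cf cg; apply: (cts2 (op := fun a b => a * b) cf cg) => e e0.
pose K := 1 + `|f x| + `|g x|.
have K0 : 0 < K by rewrite /K -addrA ltr_pwDl // addr_ge0.
exists (Num.min 1 (e / (2 * K))); first by rewrite lt_min ltr01 divr_gt0 ?mulr_gt0.
move=> s t; rewrite !lt_min => /andP[s1 se] /andP[t1 te].
have -> : s * t - f x * g x = (s - f x) * t + f x * (t - g x) by ring.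
have tK : `|t| <= K.
  have := ler_normD (t - g x) (g x); rewrite subrK /K; have := normr_ge0 (f x); lra.
have fK : `|f x| <= K by rewrite /K; have := normr_ge0 (g x); lra.
have E : e = e / (2 * K) * K + K * (e / (2 * K)) by field; rewrite gt_eqF.
apply: le_lt_trans (ler_normD _ _) _; rewrite !normrM [ltRHS]E.
apply: ltr_leD; last by rewrite ler_pM // ltW.
apply: le_lt_trans (ler_wpM2l (normr_ge0 _) tK) _.
by rewrite ltr_pM2r.
Qed.

Lemma cts_lipschitz (p : R -> R) (K : R) f x : 0 < K ->
  (forall s t, `|p s - p t| <= K * `|s - t|) -> cts f x -> cts (fun y => p (f y)) x.
Proof.
move=> K0 H cf e e0; have [r r0 Hr] := cf (e / K) (divr_gt0 e0 K0).
exists r => // x' /Hr h; apply: le_lt_trans (H _ _) _.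
by rewrite mulrC -ltr_pdivlMr.
Qed.

Lemma ctsN f x : cts f x -> cts (fun y => - f y) x.
Proof.
apply: (@cts_lipschitz (fun s => - s) 1) => // s t.
by rewrite mul1r opprK addrC distrC.
Qed.

Lemma monotone_lipschitz (p : R -> R) (K : R) :
  (forall s t, s <= t -> 0 <= p t - p s <= K * (t - s)) ->
  forall s t, `|p s - p t| <= K * `|s - t|.
Proof.
move=> H s t; case: (lerP s t) => st.
  have /andP[h1 h2] := H s t st.
  by rewrite distrC ger0_norm // distrC ger0_norm // subr_ge0.
have /andP[h1 h2] := H t s (ltW st).
by rewrite ger0_norm // ger0_norm // subr_ge0 ltW.
Qed.

Lemma thr_lipschitz (s t : R) : `|thr s - thr t| <= 4 * `|s - t|.
Proof.
apply: monotone_lipschitz => {}s {}t st; rewrite /thr !maxEle.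
by case: (leP (2 * s - 1) 0) => ?; case: (leP (- (2 * s) - 1) 0) => ?;
  case: (leP (2 * t - 1) 0) => ?; case: (leP (- (2 * t) - 1) 0) => ?;
  apply/andP; split; lra.
Qed.

Lemma clampE (s : R) : clamp s = if 1 <= s then 1 else if s <= -1 then -1 else s.
Proof.
rewrite /clamp; case: (leP 1 s) => s1; first by rewrite max_r //; lra.
case: (leP s (-1)) => s2; first by rewrite ?max_l.
by rewrite ?max_r // ltW.
Qed.

Lemma clamp_lipschitz (s t : R) : `|clamp s - clamp t| <= 1 * `|s - t|.
Proof.
apply: monotone_lipschitz => {}s {}t st; rewrite !clampE.
by case: (leP 1 s) => ?; case: (leP s (-1)) => ?; case: (leP 1 t) => ?;
  case: (leP t (-1)) => ?; apply/andP; split; lra.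
Qed.

Lemma cts_thr f x : cts f x -> cts (fun y => thr (f y)) x.
Proof. by apply: (@cts_lipschitz _ 4) => //; exact: thr_lipschitz. Qed.

Lemma cts_clamp f x : cts f x -> cts (fun y => clamp (f y)) x.
Proof. by apply: (@cts_lipschitz _ 1) => //; exact: clamp_lipschitz. Qed.

Lemma cts_sum (I : Type) (s : seq I) (F : I -> 'M[R]_(3, 6) -> R) x :
  (forall i, cts (F i) x) -> cts (fun y => \sum_(i <- s) F i y) x.
Proof.
move=> H; elim: s => [|i s IH].
  by under boolp.eq_fun do rewrite big_nil; exact: cts_cst.
by under boolp.eq_fun do rewrite big_cons; exact: ctsD.
Qed.

Lemma model_cts (j : 'I_15) x : cts (fun y => model 0 y 0 j) x.
Proof.
have cz k : cts (fun y => zt y k) x by apply/cts_thr/cts_coord.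
have c1 u : cts (form1 u) x.
  by repeat first [exact: cz|exact: cts_coord|apply: ctsD|apply: ctsM].
have ci u : cts (formi u) x.
  by repeat first [exact: cz|exact: cts_coord|apply: ctsD|apply: ctsM|apply: ctsN].
have cj u : cts (formj u) x.
  by repeat first [exact: cz|exact: cts_coord|apply: ctsD|apply: ctsM|apply: ctsN].
have ck u : cts (formk u) x.
  by repeat first [exact: cz|exact: cts_coord|apply: ctsD|apply: ctsM|apply: ctsN].
have cn : cts (@near_inner R) x.
  apply: cts_sum => k; apply: ctsD; apply: ctsM;
    first [exact: cts_coord|exact: cts_thr (cts_coord _ _ _)].
have cc : cts (fun y => clamp (2 * cross y)) x.
  apply: cts_clamp; apply: ctsM; first exact: cts_cst.
  by apply: ctsD; apply: ctsM.
apply: (@cts_ext _ (fun y => (model_main y)`_j)) => [y|].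
  by rewrite mxE mul0r subr0.
move: j; case; do 4![case; first by move=> ? /=; exact: cts_coord].
do 2![case; first by move=> ? /=; exact: c1].
do 2![case; first by move=> ? /=; exact: ci].
do 2![case; first by move=> ? /=; exact: cts_coord].
case; first by move=> ? /=; exact: cn.
case; first by move=> ? /=; exact: (ctsM (cj r0) (cj r1)).
do 3![case; first by move=> ? /=; apply: (ctsM cc); exact: cts_coord].
by [].
Qed.
End Continuity.

Local Open Scope classical_set_scope.
Local Open Scope ring_scope.

(** * Sign integrals of a continuous measure *)

Section Moments.
Variable R : realType.
Notation pnt := (borel_rV R 5).
Implicit Types (x : 'M[R]_(3, 6)) (b : 'I_3) (p : pnt) (a : pred 'I_3)
  (mu : {finite_measure set pnt -> \bar R}).

(** A row consists of the five entries of a normal followed by minus the offset. *)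
Definition row_normal x b : 'rV[R]_5 := \row_i x b (widen_ord (leqnSn 5) i).
Definition aff x b p : R := dotp (row_normal x b) p + x b ord_max.
Definition prodsg a x p : R := \prod_(b | a b) Num.sg (aff x b p).
(** A Fourier coefficient, on the group of sign patterns, of the masses of the eight orthants. *)
Definition mom mu a x : R := \int[mu]_(p in setT) prodsg a x p.

Lemma measurable_open_pnt (A : set pnt) : open (A : set 'rV[R]_5) -> measurable A.
Proof. by move=> oA; apply: sub_sigma_algebra. Qed.

Lemma aff_continuous x b : continuous (aff x b : 'rV[R]_5 -> R).
Proof.
move=> p; have := @dotp_continuous R 5 (row_normal x b) p.
by move=> /cvgD/(_ (cvg_cst (x b ord_max))).
Qed.

Lemma open_aff_gt0 x b : open [set p : 'rV[R]_5 | 0 < aff x b p].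
Proof.
apply: (@open_comp _ _ (aff x b) [set y | 0 < y]); last exact: open_gt.
by move=> p _; exact: aff_continuous.
Qed.

Lemma open_aff_lt0 x b : open [set p : 'rV[R]_5 | aff x b p < 0].
Proof.
apply: (@open_comp _ _ (aff x b) [set y | y < 0]); last exact: open_lt.
by move=> p _; exact: aff_continuous.
Qed.

Lemma measurable_sg_aff x b : measurable_fun setT (fun p => Num.sg (aff x b p)).
Proof.
have -> : (fun p => Num.sg (aff x b p)) =
    (fun p => (\1_[set p : pnt | 0 < aff x b p] p - \1_[set p : pnt | aff x b p < 0] p)%R).
  apply/funext => p; rewrite !indicE.
  have -> : (p \in [set p : pnt | 0 < aff x b p]) = (0 < aff x b p).
    by apply/idP/idP; rewrite inE.
  have -> : (p \in [set p : pnt | aff x b p < 0]) = (aff x b p < 0).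
    by apply/idP/idP; rewrite inE.
  case: (ltrgtP (aff x b p) 0) => h; first by rewrite ltr0_sg // sub0r.
    by rewrite gtr0_sg // subr0.
  by rewrite h sgr0 subrr.
apply: measurable_funB; apply: measurable_indic; apply: measurable_open_pnt.
  exact: open_aff_gt0.
exact: open_aff_lt0.
Qed.

Lemma measurable_prodsg a x : measurable_fun setT (prodsg a x).
Proof.
rewrite /prodsg; under eq_fun do rewrite big_mkcond /=.
apply: measurable_prod => b _; case: (a b); last exact: measurable_cst.
exact: measurable_sg_aff.
Qed.

Lemma norm_sg_le1 (y : R) : `|Num.sg y| <= 1.
Proof. by rewrite normr_sg; case: eqP. Qed.

Lemma prodsg_le1 a x p : `|prodsg a x p| <= 1.
Proof.
by rewrite /prodsg normr_prod; apply: prodr_ile1 => b _; rewrite normr_ge0 norm_sg_le1.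
Qed.

Lemma finite_mu mu : (mu setT < +oo)%E.
Proof. by rewrite -ge0_fin_numE // fin_num_measure. Qed.

Lemma bounded_integrable mu (f : pnt -> R) (M : R) : measurable_fun setT f ->
  (forall p, `|f p| <= M) -> mu.-integrable setT (EFin \o f).
Proof.
move=> mf fM; apply: measurable_bounded_integrable => //; first exact: finite_mu.
exists M; split; first exact: num_real.
by move=> M' MM' p _ /=; apply: le_trans (fM p) (ltW MM').
Qed.

Lemma integrable_prodsg mu a x : mu.-integrable setT (EFin \o prodsg a x).
Proof. exact: bounded_integrable (measurable_prodsg a x) (prodsg_le1 a x). Qed.

(** Either the row defines a genuine hyperplane, which is null, or its form is a nonzero
    constant. *)
Lemma null_aff mu x b : continuous_measure mu -> (exists k, x b k != 0) ->
  {ae mu, forall p, aff x b p != 0}.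
Proof.
move=> cmu [k xk]; case: (eqVneq (row_normal x b) 0) => [n0|n0].
  apply: aeW => p; rewrite /aff n0 /dotp big1 ?add0r; last first.
    by move=> i _; rewrite mxE mul0r.
  have <- : k = ord_max; last by [].
  apply/val_inj => /=; apply/eqP; apply: contraNT xk => k5.
  have lk : (k < 5)%N by have := ltn_ord k; rewrite ltnS leq_eqVlt (negPf k5).
  have /rowP/(_ (Ordinal lk)) := n0; rewrite !mxE => <-; apply/eqP.
  by congr (x _ _); apply/val_inj.
pose h := OrientedHyperplane (- x b ord_max) n0.
exists (hyperplane_set h); split; [exact: measurable_hyperplane_set|exact: cmu|].
move=> p /= /negP; rewrite negbK /aff => /eqP e.
by rewrite /hyperplane_set /=; apply/eqP; rewrite -subr_eq0 opprK e.
Qed.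

Lemma null_all_aff mu x : continuous_measure mu ->
  (forall b, exists k, x b k != 0) ->
  {ae mu, forall p, forall b, aff x b p != 0}.
Proof.
move=> cmu nx.
have := null_aff cmu (nx r0); have := null_aff cmu (nx r1); have := null_aff cmu (nx r2).
by apply: filterS3 => p h2 h1 h0; apply: ord3P.
Qed.

Lemma sg_close (u v : R) : `|v - u| < `|u| -> Num.sg v = Num.sg u.
Proof.
case: (ltrgtP u 0) => [u0|u0|->]; last by rewrite normr0 ltNge normr_ge0.
- rewrite (ltr0_norm u0) ltr_norml => /andP[_ h].
  by rewrite !ltr0_sg //; lra.
- rewrite (gtr0_norm u0) ltr_norml => /andP[h _].
  by rewrite !gtr0_sg //; lra.
Qed.

Lemma aff_close x x' b p (r : R) : (forall c k, `|x' c k - x c k| <= r) ->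
  `|aff x' b p - aff x b p| <= r * (\sum_i `|p 0 i| + 1).
Proof.
move=> xx; rewrite /aff opprD addrACA mulrDr mulr1.
apply: le_trans (ler_normD _ _) _; apply: lerD; last exact: xx.
rewrite /dotp -sumrB mulr_sumr; apply: le_trans (ler_norm_sum _ _ _) _.
apply: ler_sum => i _; rewrite !mxE -mulrBl normrM.
by apply: ler_wpM2r.
Qed.

(** Dominated convergence: at almost every point none of the three forms vanishes, so their signs
    are eventually constant along the sequence. *)
Lemma mom_cvg mu a x (y : nat -> 'M[R]_(3, 6)) : continuous_measure mu ->
  (forall b, exists k, x b k != 0) ->
  (forall n b k, `|y n b k - x b k| <= n.+1%:R^-1) ->
  mom mu a (y n) @[n --> \oo] --> mom mu a x.
Proof.
move=> cmu nx yx.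
have [] := @dominated_convergence _ pnt R mu setT measurableT
  (fun n p => (prodsg a (y n) p)%:E) (fun p => (prodsg a x p)%:E) (cst 1%E).
- by move=> n; apply/measurable_EFinP; exact: measurable_prodsg.
- by apply/measurable_EFinP; exact: measurable_prodsg.
- have := null_all_aff cmu nx; apply: filterS => p np _.
  apply: cvg_near_cst.
  have [d d0 dP] : exists2 d : R, 0 < d & forall b, d <= `|aff x b p|.
    exists (Num.min `|aff x r0 p| (Num.min `|aff x r1 p| `|aff x r2 p|)).
      by rewrite !lt_min !normr_gt0 !np.
    by apply: ord3P; rewrite !ge_min lexx ?orbT.
  pose S := \sum_i `|p 0 i| + 1.
  have S0 : 0 < S by rewrite ltr_wpDl // sumr_ge0.
  near=> n; congr (_%:E); rewrite /prodsg; apply: eq_bigr => b _.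
  apply: sg_close; apply: lt_le_trans (dP b).
  apply: le_lt_trans (aff_close b p (yx n)) _.
  rewrite -/S -ltr_pdivlMr //.
  near: n; exact: (near_infty_natSinv_lt (PosNum (divr_gt0 d0 S0))).
- exact: finite_measure_integrable_cst.
- by apply: aeW => p n _ /=; rewrite lee_fin prodsg_le1.
move=> _ _ H.
have fin z : (\int[mu]_(p in setT) (prodsg a z p)%:E)%E \is a fin_num.
  exact: integrable_fin_num (integrable_prodsg mu a z).
by move: H; rewrite -(fineK (fin x)) => /fine_cvg.
Unshelve. all: by end_near. Qed.

Lemma mom_near mu a x (e : R) : continuous_measure mu ->
  (forall b, exists k, x b k != 0) -> 0 < e ->
  exists2 r : R, 0 < r & forall x', (forall b k, `|x' b k - x b k| <= r) ->
    `|mom mu a x' - mom mu a x| < e.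
Proof.
move=> cmu nx e0; apply: contrapT => nr.
have /choice[y yP] : forall n : nat, exists x',
    (forall b k, `|x' b k - x b k| <= n.+1%:R^-1) /\ e <= `|mom mu a x' - mom mu a x|.
  move=> n; apply: contrapT => nx'; apply: nr; exists n.+1%:R^-1 => // x' h.
  by rewrite ltNge; apply/negP => h'; apply: nx'; exists x'.
have := @mom_cvg mu a x y cmu nx (fun n => (yP n).1).
move=> /cvgrPdist_lt/(_ e e0)[N _ /(_ N (leqnn N))] /=.
by rewrite distrC ltNge (yP N).2.
Qed.

Lemma mom_actm mu a h x :
  mom mu a (actm h x) = \prod_(b | a b) (-1) ^+ h.1 b * mom mu (fun b => a (sw h.2 b)) x.
Proof.
have E p : prodsg a (actm h x) p =
    \prod_(b | a b) (-1) ^+ h.1 b * prodsg (fun b => a (sw h.2 b)) x p.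
  rewrite /prodsg [X in _ = _ * X](reindex (sw h.2)) /=; last first.
    by exists (sw h.2) => b _; rewrite swD addbb.
  under [X in _ = _ * X]eq_bigl do rewrite swD addbb.
  rewrite -big_split /=; apply: eq_bigr => b _.
  have -> : aff (actm h x) b p = (-1) ^+ h.1 b * aff x (sw h.2 b) p.
    rewrite /aff /dotp mulrDr mulr_sumr !mxE; congr (_ + _).
    by apply: eq_bigr => i _; rewrite !mxE mulrA.
  by rewrite sgrM; congr (_ * _); case: (h.1 b); rewrite ?expr0 ?expr1 ?sgrN sgr1.
rewrite /mom; under eq_Rintegral do rewrite E.
by rewrite RintegralZl //; exact: integrable_prodsg.
Qed.

Lemma eq_mom mu a a' x : a =1 a' -> mom mu a x = mom mu a' x.
Proof. by move=> aa; apply: eq_Rintegral => p _; apply: eq_bigl. Qed.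

Lemma ae_eq_Rintegral mu (f g : pnt -> R) : measurable_fun setT f -> measurable_fun setT g ->
  {ae mu, forall p, f p = g p} -> \int[mu]_(p in setT) f p = \int[mu]_(p in setT) g p.
Proof.
move=> mf mg fg; congr fine; apply: ae_eq_integral => //; try exact/measurable_EFinP.
by apply: filterS fg => p -> .
Qed.

(** The product of the first two signs is constant almost everywhere. This keeps zeros with parallel
    rows out for a measure of positive mass. *)
Lemma mom_parallel mu x (s : bool) : continuous_measure mu ->
  (forall b, exists k, x b k != 0) ->
  (forall k, x r0 k = (-1) ^+ s * x r1 k) ->
  mom mu (fun b => b != r2) x = (-1) ^+ s * fine (mu setT).
Proof.
move=> cmu nx xx.
rewrite -(Rintegral_cst mu measurableT) /mom; apply: ae_eq_Rintegral => //.
- exact: measurable_prodsg.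
- have := null_all_aff cmu nx; apply: filterS => p np.
  rewrite /prodsg (bigD1 r0) //= (bigD1 r1) //= big1 ?mulr1; last by apply: ord3P.
  have -> : aff x r0 p = (-1) ^+ s * aff x r1 p.
    rewrite /aff /dotp mulrDr mulr_sumr xx; congr (_ + _).
    by apply: eq_bigr => i _; rewrite !mxE xx mulrA.
  rewrite sgrM -mulrA -expr2 sqr_sg np mulr1.
  by case: (s); rewrite ?expr0 ?expr1 ?sgrN sgr1.
Qed.

Lemma mom_degenerate mu x b : (exists k, x b k != 0) -> row_normal x b = 0 ->
  mom mu (pred1 b) x = 0 -> fine (mu setT) = 0.
Proof.
move=> [k xk] n0.
have xm : x b ord_max != 0.
  have <- : k = ord_max; last by [].
  apply/val_inj => /=; apply/eqP; apply: contraNT xk => k5.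
  have lk : (k < 5)%N by have := ltn_ord k; rewrite ltnS leq_eqVlt (negPf k5).
  have /rowP/(_ (Ordinal lk)) := n0; rewrite !mxE => <-; apply/eqP.
  by congr (x _ _); apply/val_inj.
have E p : prodsg (pred1 b) x p = Num.sg (x b ord_max).
  rewrite /prodsg big_pred1_eq /aff n0 /dotp big1 ?add0r // => i _.
  by rewrite mxE mul0r.
rewrite /mom; under eq_Rintegral do rewrite E.
by rewrite Rintegral_cst // => /eqP; rewrite mulf_eq0 sgr_eq0 (negPf xm) => /eqP.
Qed.
End Moments.

(** * From vanishing sign integrals to equipartitions and bisectors *)

Section Partition.
Variable R : realType.
Notation pnt := (borel_rV R 5).
Implicit Types (x : 'M[R]_(3, 6)) (b : 'I_3) (p : pnt) (a : pred 'I_3)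
  (mu : {finite_measure set pnt -> \bar R}).

Definition hyperplanes x (n0 : forall b, row_normal x b != 0) b :
  oriented_hyperplane R 5 := OrientedHyperplane (- x b ord_max) (n0 b).

Lemma halfspaceE x n0 b s p : halfspace (@hyperplanes x n0 b) s p <->
  is_true (if s then 0 <= aff x b p else aff x b p <= 0).
Proof.
rewrite /halfspace /aff; case: s => /=; move: (dotp _ _) (x b ord_max) => u v.
  by split=> h; move: h; lra.
by split=> h; move: h; lra.
Qed.

Lemma Rintegral_indic mu (A : set pnt) : measurable A ->
  \int[mu]_(p in setT) (\1_A p : R) = fine (mu A).
Proof. by move=> mA; rewrite /Rintegral integral_indic // setIT. Qed.

Lemma normal_neq0_entry x b : row_normal x b != 0 -> exists k, x b k != 0.
Proof.
by case/rV0Pn => i; rewrite mxE => xi; exists (widen_ord (leqnSn 5) i).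
Qed.

(** The sign is the difference of the indicators of the two closed half-spaces, which cancel on the
    hyperplane itself. *)
Lemma bisector_mom mu x n0 b : mom mu (pred1 b) x = 0 -> bisector mu (@hyperplanes x n0 b).
Proof.
pose H s := halfspace (hyperplanes n0 b) s.
have mH s : measurable (H s) by exact: measurable_halfspace.
have I s : mu.-integrable setT (EFin \o (\1_(H s) : pnt -> R)) by exact: integrable_indic.
have -> : mom mu (pred1 b) x = fine (mu (H true)) - fine (mu (H false)).
  rewrite -(Rintegral_indic mu (mH true)) -(Rintegral_indic mu (mH false)).
  rewrite -(RintegralB measurableT (I true) (I false)); apply: eq_Rintegral => p _.
  rewrite /prodsg big_pred1_eq !indicE.
  have E s : (p \in H s) = (if s then 0 <= aff x b p else aff x b p <= 0).
    apply/idP/idP => [|h]; first by rewrite inE => /halfspaceE.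
    by rewrite inE; apply/halfspaceE.
  rewrite !E; case: (ltrgtP (aff x b p) 0) => h.
  - by rewrite ltr0_sg // sub0r.
  - by rewrite gtr0_sg // subr0.
  - by rewrite h sgr0 subrr.
move=> /eqP; rewrite subr_eq0 => /eqP e.
have f s : mu (H s) \is a fin_num by exact: fin_num_measure.
by rewrite /bisector -/(H true) -/(H false) -(fineK (f true)) e fineK.
Qed.

Lemma Rintegral_sum mu (I : Type) (s : seq I) (f : I -> pnt -> R) :
  (forall i, mu.-integrable setT (EFin \o f i)) ->
  \int[mu]_(p in setT) (\sum_(i <- s) f i p) = \sum_(i <- s) \int[mu]_(p in setT) f i p.
Proof.
move=> fI; elim: s => [|i s IH].
  under eq_Rintegral do rewrite big_nil.
  by rewrite big_nil Rintegral_cst // mul0r.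
under eq_Rintegral do rewrite big_cons.
rewrite big_cons -IH RintegralD //.
have -> : EFin \o (fun p => \sum_(i0 <- s) f i0 p) =
    (fun p => (\sum_(i0 <- s) (EFin \o f i0) p)%E).
  by apply/funext => p /=; rewrite sumEFin.
exact: integrable_sum.
Qed.

(** Fourier inversion: off the hyperplanes the indicator of an orthant is the product of the factors
    (1 + [y b p]) / 2. After expansion and integration only the trivial character remains, and it
    gives one eighth of the mass. *)
Lemma equipartition_mom mu x n0 : continuous_measure mu ->
  (forall f : {ffun 'I_3 -> bool}, (exists b, f b) -> mom mu f x = 0) ->
  equipartition mu (@hyperplanes x n0).
Proof.
move=> cmu m0 e; set O := hyperorthant _ _.
have mO : measurable O by exact: measurable_hyperorthant.
have nx b : exists k, x b k != 0 by exact: normal_neq0_entry.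
pose y b p : R := (if e b then 1 else -1) * Num.sg (aff x b p).
pose c (f : {ffun 'I_3 -> bool}) : R := 1 / 2 ^+ 3 * \prod_(b | f b) (if e b then 1 else -1).
have mf (f : {ffun 'I_3 -> bool}) : mu.-integrable setT (EFin \o (fun p => c f * prodsg f x p)).
  have -> : EFin \o (fun p => c f * prodsg f x p) =
      (fun p => ((c f)%:E * (EFin \o prodsg f x) p)%E).
    by apply/funext => p /=; rewrite EFinM.
  by apply: integrableZl => //; exact: integrable_prodsg.
have E p : (forall b, aff x b p != 0) ->
    \1_O p = \sum_(f : {ffun 'I_3 -> bool}) c f * prodsg f x p.
  move=> np.
  transitivity (\prod_(b < 3) ((1 + y b p) / 2)).
    have hE b : halfspace (hyperplanes n0 b) (e b) p <-> y b p = 1.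
      rewrite halfspaceE /y; case: (e b).
        case: (ltrgtP (aff x b p) 0) (np b) => // h _.
          by rewrite ltr0_sg // mul1r; split => // h'; exfalso; lra.
        by rewrite gtr0_sg // mul1r.
      case: (ltrgtP (aff x b p) 0) (np b) => // h _.
        by rewrite ltr0_sg // mulrNN mulr1.
      by rewrite gtr0_sg // mulr1; split => // h'; exfalso; lra.
    rewrite indicE; case: (boolP (p \in O)) => pO.
      rewrite big1 // => b _; move: pO; rewrite inE => /(_ b I)/hE ->.
      by rewrite -mulr2n divff // pnatr_eq0.
    have [b yb] : exists b, y b p = - 1.
      apply: contrapT => ny; move/negP: pO; apply; rewrite inE => b _; apply/hE.
      have : y b p = 1 \/ y b p = -1.
        rewrite /y; case: (ltrgtP (aff x b p) 0) (np b) => // h _.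
          by rewrite ltr0_sg //; case: (e b); [right|left]; rewrite ?mul1r ?mulrNN ?mulr1.
        by rewrite gtr0_sg //; case: (e b); [left|right]; rewrite ?mul1r ?mulr1.
      by case=> // yb; case: ny; exists b.
    by rewrite (bigD1 b) //= yb subrr !mul0r.
  transitivity (\prod_(b < 3) \sum_(j : bool) ((if j then y b p else 1) / 2)).
    by apply: eq_bigr => b _; rewrite big_bool /= -mulrDl addrC.
  rewrite bigA_distr_bigA /=; apply: eq_bigr => f _.
  rewrite big_split /= prodr_const card_ord mulrC /c /prodsg -[RHS]mulrA; congr (_ * _).
    by rewrite mul1r exprVn.
  rewrite -big_split /= [RHS]big_mkcond /=; apply: eq_bigr => b _.
  by case: (f b).
have fO : mu O \is a fin_num by exact: fin_num_measure.
have fT : mu setT \is a fin_num by exact: fin_num_measure.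
rewrite -(fineK fO) -(fineK fT) -EFinM; congr (_%:E).
rewrite -Rintegral_indic //.
rewrite (@ae_eq_Rintegral R mu _ (fun p => \sum_(f : {ffun 'I_3 -> bool}) c f * prodsg f x p)).
- rewrite Rintegral_sum // (bigD1 [ffun=> false]) //= [X in _ + X]big1 ?addr0.
    rewrite RintegralZl //; last exact: integrable_prodsg.
    have E0 p : prodsg (fun b => [ffun=> false] b) x p = 1.
      by rewrite /prodsg big_pred0 // => b; rewrite ffunE.
    under eq_Rintegral do rewrite E0.
    rewrite Rintegral_cst // mul1r /c big_pred0 ?mulr1 // => b.
    by rewrite ffunE.
  move=> f f0; rewrite RintegralZl //; last exact: integrable_prodsg.
  rewrite -/(mom mu f x) m0 ?mulr0 //.
  apply: contrapT => nf; case/eqP: f0; apply/ffunP => b; rewrite ffunE.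
  by apply/negP => fb; apply: nf; exists b.
- exact: measurable_indic.
- apply: measurable_sum => f; apply: measurable_funM => //.
  exact: measurable_prodsg.
- by have := null_all_aff cmu nx; apply: filterS => p; exact: E.
Qed.

(** Among the first fourteen entries, each measure receives each of the seven nonempty types of [ty]
    once. *)
Definition first_measure (j : 'I_15) : bool := nth false
  [:: true; true; false; false; true; true; false; false; true; false; true;
      false; true; false; false] j.

(* The 15 conditions: all the character integrals of the two measures to be
   equipartitioned, and a product that vanishes iff some hyperplane bisects
   the third one. *)
Definition measure_map mu1 mu2 mu3 x : 'rV[R]_15 := \row_j
  if j == 14 :> nat then \prod_(b < 3) mom mu3 (pred1 b) x
  else mom (if first_measure j then mu1 else mu2) (ty j) x.

Lemma measure_map_actm mu1 mu2 mu3 h x :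
  measure_map mu1 mu2 mu3 (actm h x) = rho h (measure_map mu1 mu2 mu3 x).
Proof.
have T j : \prod_(b | ty j b) (-1) ^+ h.1 b = (-1) ^+ flip_test h j :> R.
  rewrite big_mkcond /= !big_ord_recl big_ord0 /flip_test !signr_addb mulr1 mulrA.
  have -> : lift ord0 (lift ord0 ord0) = r2 :> 'I_3 by apply/val_inj.
  have -> : lift ord0 ord0 = r1 :> 'I_3 by apply/val_inj.
  have -> : ord0 = r0 :> 'I_3 by apply/val_inj.
  by do 3!case: (ty j _).
apply/rowP => j; rewrite !mxE.
have j14 : (swap_test h.2 j == 14 :> nat) = (j == 14 :> nat).
  by case: h.2 => //; move: (j); case; do 15![case; first by []].
have jf : first_measure (swap_test h.2 j) = first_measure j.
  by case: h.2 => //; move: (j); case; do 15![case; first by []].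
rewrite j14 jf; case: (eqVneq (j : nat) 14) => j14'.
- have tj b : ty j b by rewrite /ty j14'; move: b; apply: ord3P.
  rewrite -T (eq_bigl predT) => [|b]; last by rewrite tj.
  rewrite [X in _ = _ * X](reindex (sw h.2)) /=; last first.
    by exists (sw h.2) => b _; rewrite swD addbb.
  rewrite -big_split /=; apply: eq_bigr => b _.
  rewrite mom_actm big_pred1_eq; congr (_ * _); apply: eq_mom => c /=.
  by apply/eqP/eqP => [<-|->]; rewrite swD addbb.
- rewrite mom_actm T; congr (_ * _); apply: eq_mom => b.
  by rewrite ty_swap.
Qed.

Lemma prod3_close (a a' b b' c c' M d : R) : 0 < M ->
  `|a' - a| < d -> `|b' - b| < d -> `|c' - c| < d ->
  `|a| <= M -> `|b| <= M -> `|b'| <= M -> `|c'| <= M ->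
  `|a' * b' * c' - a * b * c| < 3 * M ^+ 2 * d.
Proof.
move=> M0 Ha Hb Hc Ma Mb Mb' Mc'.
have -> : a' * b' * c' - a * b * c = (a' - a) * b' * c' + (a * (b' - b) * c' + a * b * (c' - c)).
  by ring.
have -> : 3 * M ^+ 2 * d = d * (M * M) + (M * d * M + M * M * d) by ring.
apply: le_lt_trans (ler_normD _ _) _; apply: ltr_leD; last first.
  apply: le_trans (ler_normD _ _) _; rewrite !normrM; apply: lerD.
    by rewrite !ler_pM ?mulr_ge0 // ltW.
  by rewrite !ler_pM ?mulr_ge0 // ltW.
rewrite !normrM; apply: (@le_lt_trans _ _ (`|a' - a| * (M * M))).
  by rewrite -mulrA ler_wpM2l // ler_pM.
by rewrite ltr_pM2r // mulr_gt0.
Qed.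

Lemma measure_map_near mu1 mu2 mu3 x j (e : R) :
  continuous_measure mu1 -> continuous_measure mu2 -> continuous_measure mu3 ->
  (forall b, exists k, x b k != 0) -> 0 < e ->
  exists2 r : R, 0 < r & forall x', (forall b k, `|x' b k - x b k| <= r) ->
    `|measure_map mu1 mu2 mu3 x' 0 j - measure_map mu1 mu2 mu3 x 0 j| < e.
Proof.
move=> cm1 cm2 cm3 nx e0.
have le1 mu a z : continuous_measure mu -> `|mom mu a z| <= fine (mu setT).
  move=> _; apply: le_trans (le_normr_Rintegral measurableT (integrable_prodsg mu a z)) _.
  rewrite -[leRHS]mul1r -(Rintegral_cst mu measurableT); apply: le_Rintegral => //.
  - apply: (@bounded_integrable _ _ _ 1) => [|p]; last by rewrite normr_id prodsg_le1.
    by apply: measurableT_comp => //; exact: measurable_prodsg.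
  - exact: finite_measure_integrable_cst.
  - by move=> p _; exact: prodsg_le1.
case: (eqVneq (j : nat) 14) => j14; last first.
  have cm : continuous_measure (if first_measure j then mu1 else mu2) by case: ifP.
  have [r r0 H] := @mom_near R _ (ty j) x e cm nx e0.
  by exists r => // x' xx'; rewrite !mxE (negPf j14); exact: H.
(* The added 1 keeps the bound positive when [mu3] is null. *)
pose M := 1 + fine (mu3 setT).
have M1 : 1 <= M by rewrite lerDl fine_ge0.
have M0 : 0 < M by apply: lt_le_trans M1.
have Mb b z : `|mom mu3 (pred1 b) z| <= M.
  by apply: le_trans (le1 _ _ _ cm3) _; rewrite lerDr.
pose d := e / (3 * M ^+ 2).
have d0 : 0 < d by rewrite divr_gt0 // mulr_gt0 // exprn_gt0.
have [ra ra0 Ha] := @mom_near R mu3 (pred1 r0) x d cm3 nx d0.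
have [rb rb0 Hb] := @mom_near R mu3 (pred1 r1) x d cm3 nx d0.
have [rc rc0 Hc] := @mom_near R mu3 (pred1 r2) x d cm3 nx d0.
exists (Num.min ra (Num.min rb rc)); first by rewrite !lt_min ra0 rb0 rc0.
move=> x' xx'; rewrite !mxE j14 eqxx.
have P z : \prod_(b < 3) mom mu3 (pred1 b) z =
    mom mu3 (pred1 r0) z * mom mu3 (pred1 r1) z * mom mu3 (pred1 r2) z.
  rewrite !big_ord_recl big_ord0 mulr1 mulrA.
  by congr (mom _ (pred1 _) _ * mom _ (pred1 _) _ * mom _ (pred1 _) _); apply/val_inj.
rewrite !P.
have {}Ha : `|mom mu3 (pred1 r0) x' - mom mu3 (pred1 r0) x| < d.
  by apply: Ha => b k; apply: le_trans (xx' b k) _; rewrite ge_min lexx.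
have {}Hb : `|mom mu3 (pred1 r1) x' - mom mu3 (pred1 r1) x| < d.
  by apply: Hb => b k; apply: le_trans (xx' b k) _; rewrite !ge_min lexx ?orbT.
have {}Hc : `|mom mu3 (pred1 r2) x' - mom mu3 (pred1 r2) x| < d.
  by apply: Hc => b k; apply: le_trans (xx' b k) _; rewrite !ge_min lexx ?orbT.
have -> : e = 3 * M ^+ 2 * d by rewrite /d; field; rewrite gt_eqF.
exact: prod3_close.
Qed.
End Partition.

(** * The limit of fine grids *)

Section Main.
Variable R : realType.
Notation pnt := (borel_rV R 5).
Implicit Types (x : 'M[R]_(3, 6)) (b : 'I_3) (k : 'I_6) (mu : {finite_measure set pnt -> \bar R}).
Notation w m := (half_width m).

Lemma small_mesh (e : R) : 0 < e ->
  exists m0, forall m, (m0 <= m)%N -> (w m)%:R^-1 <= e :> R.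
Proof.
move=> e0; have e1 : 0 <= e^-1 by rewrite invr_ge0 ltW.
exists (Num.bound e^-1) => m mm; rewrite -[leRHS]invrK lef_pV2 ?posrE ?invr_gt0 ?w_gt0 //.
apply: le_trans (ltW (archi_boundP e1)) _; rewrite ler_nat.
by apply: leq_trans mm _; rewrite /half_width; lia.
Qed.

(** A coordinate with one strict sign on the facet separates it from the origin. *)
Lemma no_zero_facet_sign (v : 'I_17 -> 'rV[R]_15) (k : 'I_17) (j : 'I_15) (s : R) :
  (forall i, i != k -> 0 < s * v i 0 j) -> ~ zero_facet v k.
Proof.
move=> H [l [l0 lk [q lq] lv]].
have qk : q != k by apply: contraTneq lq => ->; rewrite lk ltxx.
have : 0 < \sum_i l i * (s * v i 0 j).
  rewrite (bigD1 q) //=; apply: ltr_pwDl; first by rewrite mulr_gt0 // H.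
  apply: sumr_ge0 => i _.
  by case: (eqVneq i k) => [->|ik]; rewrite ?lk ?mul0r // mulr_ge0 // ltW // H.
have -> : \sum_i l i * (s * v i 0 j) = s * (\sum_i l i *: v i) 0 j.
  by rewrite summxE mulr_sumr; apply: eq_bigr => i _; rewrite mxE mulrCA.
by rewrite lv mxE mulr0 ltxx.
Qed.

Lemma finite_min (I : finType) (f : I -> R) : (forall i, 0 < f i) ->
  exists2 d, 0 < d & forall i, d <= f i.
Proof.
move=> f0; pose S := \sum_i (f i)^-1.
have S0 : 0 <= S by apply: sumr_ge0 => i _; rewrite invr_ge0 ltW.
have S1 : 0 < 1 + S by rewrite ltr_pwDl.
exists (1 + S)^-1; first by rewrite invr_gt0.
move=> i; rewrite -[leRHS]invrK lef_pV2 ?posrE ?invr_gt0 //.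
have : (f i)^-1 <= S.
  rewrite /S (bigD1 i) //= lerDl. by apply: sumr_ge0 => j _; rewrite invr_ge0 ltW.
by lra.
Qed.

(** Two symmetries with the same image of [c] must differ in the exchange, because no row is zero;
    comparing their first rows shows that rows 0 and 1 agree up to sign. *)
Lemma nonfree_parallel m (c : cell m) : valid c -> ~~ free_cell c ->
  exists s : bool, forall k, pt R c r0 k = (-1) ^+ s * pt R c r1 k.
Proof.
move=> vc; rewrite negb_forall => /existsP[h]; rewrite negb_forall => /existsP[g].
rewrite negb_imply => /andP[/eqP E hg].
have {}E b k : (-1) ^+ h.1 b * pt R c (sw h.2 b) k = (-1) ^+ g.1 b * pt R c (sw g.2 b) k.
  have := congr1 (fun c => pt R c b k) E; rewrite !pt_actc.
  by rewrite [LHS]mxE [X in _ = X -> _]mxE.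
case: (eqVneq h.2 g.2) => [e2|n2]; last first.
  exists (h.1 r0 (+) g.1 r0) => k; have := E r0 k.
  rewrite signr_addb; move: n2; case: h.2; case: g.2 => //= _.
    by move=> e; rewrite mulrAC e mulrAC -signr_addb addbb mul1r.
  by move=> e; rewrite -mulrA -e mulrA -signr_addb addbb mul1r.
case/negP: hg; apply/eqP; case: h g e2 E => [s t] [s' t'] /= <- E; congr pair.
apply/ffunP => b; have [k ak] := @valid_pt R m c (sw t b) vc.
have := E b k; case: (s b); case: (s' b) => //; rewrite ?expr0 ?expr1 ?mulN1r ?mul1r => e; exfalso.
  have z : pt R c (sw t b) k = 0 by lra.
  by move: ak; rewrite z normr0 => /eqP; rewrite eq_sym oner_eq0.
have z : pt R c (sw t b) k = 0 by lra.
by move: ak; rewrite z normr0 => /eqP; rewrite eq_sym oner_eq0.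
Qed.

Section Fixed.
Variables mu1 mu2 mu3 : {finite_measure set pnt -> \bar R}.
Hypotheses (cm1 : continuous_measure mu1) (cm2 : continuous_measure mu2)
  (cm3 : continuous_measure mu3) (mu1_gt0 : 0 < fine (mu1 setT)).
Notation H := (measure_map mu1 mu2 mu3).

Definition unit_rows x := forall b, exists k, `|x b k| = 1.

(* Time 0 carries the map of the measures, times 1 and 2 the model. *)
Definition base_map m (c : cell m) : 'rV[R]_15 :=
  if c None == 0 :> nat then H (pt R c) else model (w m)%:R^-1 (pt R c).

Lemma base_map_equivariant m : equivariant (@base_map m).
Proof.
move=> h c; rewrite /base_map {1}/actc ffunE pt_actc.
by case: ifP => _; [exact: measure_map_actm|exact: model_actm].
Qed.

Definition close_map m (F : cell m -> 'rV[R]_15) := forall c (j : 'I_15),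
  `|F c 0 j - base_map c 0 j| <= (1000 * (w m)%:R)^-1.

Lemma error_mesh m : (1000 * (w m)%:R)^-1 <= (w m)%:R^-1 :> R.
Proof.
have := w_gt0 R m; move: ((w m)%:R : R) => z z0.
by rewrite lef_pV2 ?posrE; lra.
Qed.

Lemma sign_measure x (j : 'I_15) (s : R) : unit_rows x -> `|s| = 1 -> 0 < s * H x 0 j ->
  exists2 r, 0 < r & exists m0, forall m, (m0 <= m)%N -> forall F, close_map F ->
    forall c : cell m, within_radius r x (pt R c) -> c None = 0 :> nat -> 0 < s * F c 0 j.
Proof.
move=> ux s1 sH; set d := s * H x 0 j in sH.
have nx b : exists k, x b k != 0.
  by have [k xk] := ux b; exists k; rewrite -normr_eq0 xk oner_neq0.
have d2 : 0 < d / 2 by rewrite divr_gt0.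
have [r r0' Hr] := measure_map_near j cm1 cm2 cm3 nx d2.
have d4 : 0 < d / 4 by rewrite divr_gt0.
have [m0 Hm] := small_mesh d4.
exists r => //; exists m0 => m mm F cF c cx c0.
have h1 := Hr _ cx; have h2 := cF c j; rewrite /base_map c0 eqxx in h2.
have h3 := Hm m mm; have h4 := error_mesh m.
have K u v : `|u - v| = `|s * u - s * v| by rewrite -mulrBr normrM s1 mul1r.
move: h1 h2; rewrite K [X in _ -> X <= _ -> _]K -/d.
move: (s * H (pt R c) 0 j) (s * F c 0 j) => u v.
rewrite ltr_norml ler_norml => /andP[? ?] /andP[? ?]; lra.
Qed.

(** Of the margin [d], one half pays for continuity, one quarter for the offsets and one sixteenth
    for the perturbation. *)
Lemma sign_model x (j : 'I_15) (s : R) : `|s| = 1 -> 0 < s * model 0 x 0 j ->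
  exists2 r, 0 < r & exists m0, forall m, (m0 <= m)%N -> forall F, close_map F ->
    forall c : cell m, within_radius r x (pt R c) -> c None <> 0 :> nat -> 0 < s * F c 0 j.
Proof.
move=> s1 sH; set d := s * model 0 x 0 j in sH.
have d2 : 0 < d / 2 by rewrite divr_gt0.
have [r r0' Hr] := @model_cts R j x _ d2.
have d4 : 0 < d / 16 by rewrite divr_gt0.
have [m0 Hm] := small_mesh d4.
exists r => //; exists m0 => m mm F cF c cx c0.
have h1 := Hr _ cx; have h2 := cF c j; rewrite /base_map (introF eqP c0) in h2.
have h3 := Hm m mm; have h4 := error_mesh m.
have h5 : `|model (w m)%:R^-1 (pt R c) 0 j - model 0 (pt R c) 0 j| <= 4 * (w m)%:R^-1.
  rewrite !mxE mul0r subr0 addrAC subrr add0r normrN normrM mulrC.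
  rewrite [X in _ * X]ger0_norm ?invr_ge0 ?ler0n // ler_wpM2r ?invr_ge0 ?ler0n //.
  by apply: model_offset_bound => u k; exact: pt_bound.
have K u v : `|u - v| = `|s * u - s * v| by rewrite -mulrBr normrM s1 mul1r.
move: h1 h2 h5; rewrite K [X in _ -> X <= _ -> _]K [X in _ -> _ -> X <= _ -> _]K -/d.
move: (s * model 0 (pt R c) 0 j) (s * model (w m)%:R^-1 (pt R c) 0 j) (s * F c 0 j) => u u' v.
rewrite ltr_norml !ler_norml => /andP[? ?] /andP[? ?] /andP[? ?]; lra.
Qed.

Lemma sign_of (y : R) : y != 0 -> exists2 s : R, `|s| = 1 & 0 < s * y.
Proof.
move=> y0; exists (Num.sg y); first by rewrite normr_sg y0.
by rewrite -normrEsg normr_gt0.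
Qed.

Definition near_flag m (r : R) x (C : flagT m) := forall j, within_radius r x (pt R (C j)).

Lemma good_measure x : unit_rows x -> H x != 0 ->
  exists2 r, 0 < r & exists m0, forall m, (m0 <= m)%N -> forall F, close_map F ->
    forall C : flagT m, flag C -> near_flag r x C -> vert C 15 None = 0 :> nat ->
    ~ zero_facet (fun j => F (C j)) ord_max.
Proof.
move=> ux /rV0Pn[j /sign_of[s s1 sj]].
have [r r0' [m0 Hm]] := sign_measure ux s1 sj.
exists r => //; exists m0 => m mm F cF C fC nC t; apply: (@no_zero_facet_sign _ _ j s) => i im.
apply: (Hm m mm F cF _ (nC i)); rewrite vertE (time_constant fC) ?t //.
by have := ltn_ord i; rewrite ltnS leq_eqVlt => /orP[/eqP e|//]; case/eqP: im; apply/val_inj.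
Qed.

Lemma good_model x : unit_rows x ->
  exists2 r, 0 < r & exists m0, forall m, (m0 <= m)%N -> forall F, close_map F ->
    forall C : flagT m, flag C -> near_flag r x C -> vert C 15 None = 2 :> nat ->
    zero_facet (fun j => F (C j)) ord_max ->
    exists h, forall b k, `|actm h (pt R (vert C 0)) b k - (is_base b k)%:R| <= 1 / 4.
Proof.
move=> ux; case: (eqVneq (model 0 x) 0) => [/(model_zeros ux)[h hx]|/rV0Pn[j /sign_of[s s1 sj]]].
  exists (1 / 4) => //; exists 0%N => m _ F _ C fC nC _ _; exists h => b k.
  rewrite -hx [actm h x b k]mxE [actm _ _ b k]mxE -mulrBr normrM normr_sign mul1r.
  by have := nC (inord 0) (sw h.2 b) k; rewrite !mul1r.
have [r r0' [m0 Hm]] := sign_model s1 sj.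
exists r => //; exists m0 => m mm F cF C fC nC t z; exfalso; move: z.
apply: (@no_zero_facet_sign _ _ j s) => i im.
apply: (Hm m mm F cF _ (nC i)); rewrite vertE (time_constant fC) ?t //.
by have := ltn_ord i; rewrite ltnS leq_eqVlt => /orP[/eqP e|//]; case/eqP: im; apply/val_inj.
Qed.

(** The pair equation has the same strict sign for both maps, so it excludes parallel rows during
    the whole homotopy. *)
Lemma parallel_signs x (s : bool) : unit_rows x ->
  (forall k, x r0 k = (-1) ^+ s * x r1 k) ->
  0 < (-1) ^+ s * H x 0 (@Ordinal 15 10 isT) /\
  0 < (-1) ^+ s * model 0 x 0 (@Ordinal 15 10 isT).
Proof.
move=> ux xs.
have nx b : exists k, x b k != 0.
  by have [k xk] := ux b; exists k; rewrite -normr_eq0 xk oner_neq0.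
split.
  rewrite mxE /= (@eq_mom R mu1 _ (fun b => b != r2)); last by apply: ord3P.
  by rewrite (mom_parallel cm1 nx xs) mulrA -signr_addb addbb mul1r.
rewrite mxE mul0r subr0 /=.
pose h : symm := ([ffun b => (b == r0) && s], false).
have := @near_inner_gt0 R (actm h x) 1 ltr01; rewrite near_inner_actm !ffunE /= mulr1.
apply; last by have [k xk] := ux r1; exists k; rewrite mxE !ffunE /= mul1r.
by move=> k; rewrite !mxE !ffunE /= xs !mul1r mulrA -signr_addb addbb mul1r.
Qed.

(** Near a point with parallel rows the pair equation excludes zero facets at all times; near any
    other point all cells are free. *)
Lemma good_free x : unit_rows x ->
  exists2 r, 0 < r & exists m0, forall m, (m0 <= m)%N -> forall F, close_map F ->
    forall C : flagT m, flag C -> near_flag r x C ->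
    ~ (forall j, free_cell (C j)) -> forall k : 'I_17, ~ zero_facet (fun j => F (C j)) k.
Proof.
move=> ux.
have [[s xs]|np] := pselect (exists s : bool, forall k, x r0 k = (-1) ^+ s * x r1 k).
  have [s1 s2] := parallel_signs ux xs.
  have ns : `|(-1) ^+ s| = 1 :> R by rewrite normr_sign.
  have [r r0' [m0 Hm]] := sign_measure ux ns s1.
  have [r' r0'' [m0' Hm']] := sign_model ns s2.
  exists (Num.min r r'); first by rewrite lt_min r0' r0''.
  exists (maxn m0 m0') => m mm F cF C fC nC _ k.
  apply: (@no_zero_facet_sign _ _ (@Ordinal 15 10 isT) ((-1) ^+ s)) => i _.
  case: (eqVneq (C i None : nat) 0%N) => [t0|/eqP t0].
    apply: (Hm m (leq_trans (leq_maxl _ _) mm) F cF) => //.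
    by apply: within_radius_le (nC i); rewrite ge_min lexx.
  apply: (Hm' m (leq_trans (leq_maxr _ _) mm) F cF) => //.
  by apply: within_radius_le (nC i); rewrite ge_min lexx orbT.
have nps (s : bool) : exists k, x r0 k != (-1) ^+ s * x r1 k.
  apply: contrapT => nk; apply: np; exists s => k; apply/eqP; apply: contrapT => /negP h.
  by apply: nk; exists k.
have {nps}/choice[kk kP] := nps.
have fpos s : 0 < `|x r0 (kk s) - (-1) ^+ s * x r1 (kk s)|.
  by rewrite normr_gt0 subr_eq0.
have [d d0 dP] := finite_min fpos.
exists (d / 4); first by rewrite divr_gt0.
exists 0%N => m _ F _ C fC nC nf k _; apply: nf => j; apply: contrapT => /negP nfj.
have vj : valid (C j) by rewrite vertE; apply: flag_valid => //; rewrite -ltnS.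
have [s ps] := nonfree_parallel vj nfj.
have h0 := nC j r0 (kk s); have h1 := nC j r1 (kk s).
have := dP s; have -> : x r0 (kk s) - (-1) ^+ s * x r1 (kk s) =
    - (pt R (C j) r0 (kk s) - x r0 (kk s)) +
    (-1) ^+ s * (pt R (C j) r1 (kk s) - x r1 (kk s)) by rewrite ps; ring.
apply/negP; rewrite -ltNge; apply: le_lt_trans (ler_normD _ _) _.
by rewrite normrN normrM normr_sign mul1r; lra.
Qed.

Definition good_flag m (F : cell m -> 'rV[R]_15) (C : flagT m) : Prop :=
  [/\ ~ (forall j, free_cell (C j)) -> forall k : 'I_17, ~ zero_facet (fun j => F (C j)) k,
      vert C 15 None = 0 :> nat -> ~ zero_facet (fun j => F (C j)) ord_max &
      vert C 15 None = 2 :> nat -> zero_facet (fun j => F (C j)) ord_max ->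
        exists h, forall b k, `|actm h (pt R (vert C 0)) b k - (is_base b k)%:R| <= 1 / 4].

Lemma good_flag_local x : (forall b k, `|x b k| <= 1) ->
  (forall y, unit_rows y -> H y != 0) ->
  exists2 r, 0 < r & exists m0, forall m, (m0 <= m)%N -> forall F, close_map F ->
    forall C : flagT m, flag C -> within_radius r x (pt R (vert C 0)) -> good_flag F C.
Proof.
move=> x1 noz; have [ux|nux] := pselect (unit_rows x); last first.
  (* Away from the product of the cube boundaries there are no nearby flags, since every row of a
     valid cell has an entry of absolute value 1. *)
  have [b nb] : exists b, forall k, `|x b k| != 1.
    apply: contrapT => nb; apply: nux => b; apply: contrapT => nk; apply: nb; exists b => k.
    by apply/eqP => e; apply: nk; exists k.
  have fpos k : 0 < 1 - `|x b k| by rewrite subr_gt0 lt_neqAle nb x1.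
  have [d d0 dP] := finite_min fpos.
  exists (d / 2); first by rewrite divr_gt0.
  exists 0%N => m _ F _ C fC nC; exfalso.
  have [k pk] := @valid_pt R m _ b (flag_valid fC (isT : (0 <= 16)%N)).
  have := nC b k; have := dP k; have := ler_normD (pt R (vert C 0) b k - x b k) (x b k).
  by rewrite subrK pk; lra.
have [ra ra0 [ma Ha]] := good_free ux.
have [rb rb0 [mb Hb]] := good_measure ux (noz x ux).
have [rc rc0 [mc Hc]] := good_model ux.
pose r := Num.min ra (Num.min rb rc).
have r0' : 0 < r by rewrite !lt_min ra0 rb0 rc0.
have r2 : 0 < r / 2 by rewrite divr_gt0.
have [m0 Hm] := small_mesh r2.
exists (r / 2) => //; exists (maxn m0 (maxn ma (maxn mb mc))) => m.
rewrite !geq_max => /and4P[m0m mam mbm mcm] F cF C fC xC.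
have nC : near_flag r x C.
  move=> j b k; have lj : (j <= 16)%N by rewrite -ltnS.
  have := xC b k; have := @pt_flag_close R m C j b k fC lj; have := Hm m m0m.
  rewrite -vertE; have := ler_normD (pt R (C j) b k - pt R (vert C 0) b k) (pt R (vert C 0) b k - x b k).
  by rewrite addrA subrK; lra.
have n' (r' : R) : r <= r' -> near_flag r' x C.
  by move=> rr j; apply: within_radius_le (nC j).
split.
- by apply: (Ha m mam F cF C fC); apply: n'; rewrite /r ge_min lexx.
- by apply: (Hb m mbm F cF C fC); apply: n'; rewrite /r !ge_min lexx !orbT.
- by apply: (Hc m mcm F cF C fC); apply: n'; rewrite /r !ge_min lexx !orbT.
Qed.

(** Compactness of the cube of all 18 coordinates turns the local mesh bounds into a single one. *)
Lemma good_flag_uniform : (forall y, unit_rows y -> H y != 0) ->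
  exists m0, forall m, (m0 <= m)%N -> forall F, close_map F ->
    forall C : flagT m, flag C -> good_flag F C.
Proof.
move=> noz.
pose K := [set v : 'rV[R]_(3 * 6) | forall i, `[-1, 1]%classic (v ord0 i)].
have cK : compact K.
  apply: (@rV_compact _ _ (fun=> `[(-1 : R), 1]%classic)) => _.
  exact: segment_compact.
pose P (m : nat) (v : 'rV[R]_(3 * 6)) := forall F, close_map F ->
  forall C : flagT m, flag C -> pt R (vert C 0) = vec_mx v -> good_flag F C.
have [] := (@compact_near_coveringP _ K).1 cK nat \oo P _.
  move=> v Kv; have x1 b k : `|vec_mx v b k| <= 1.
    by rewrite mxE ler_norml; have := Kv (mxvec_index b k); rewrite /= in_itv.
  have [r r0' [m0 Hm]] := good_flag_local x1 noz.
  exists (ball v r, [set m | (m0 <= m)%N]).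
    by split; [exact: nbhsx_ballx|exists m0].
  move=> [v' m] /= [bv mm] F cF C fC E; apply: (Hm m mm F cF C fC) => b k.
  rewrite E !mxE; have [_ /(_ ord0 (mxvec_index b k))] := bv.
  by rewrite /ball /= => /ltW; rewrite distrC.
move=> m0 _ Hm; exists m0 => m mm F cF C fC.
apply: (Hm m mm (mxvec (pt R (vert C 0)))) => //; last by rewrite mxvecK.
move=> i /=; case/mxvec_indexP: i => b k; rewrite mxvecE in_itv /=.
by rewrite -ler_norml; exact: pt_bound.
Qed.

(** Without a zero, on a fine mesh no facet at time 0 captures the origin, so the boundary count
    would be the 16 of the model end, which 32 does not divide. *)
Theorem measure_map_zero : exists2 x, unit_rows x & H x = 0.
Proof.
apply: contrapT => nz.
have noz y : unit_rows y -> H y != 0.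
  by move=> uy; apply/eqP => Hy; apply: nz; exists y.
have [m0 Hm] := good_flag_uniform noz.
have q4 : 0 < 1 / 4 :> R by [].
have [m1 Hm1] := small_mesh q4.
pose m := maxn m0 m1.
have {}Hm := Hm m (leq_maxl _ _); have {}Hm1 := Hm1 m (leq_maxr _ _).
have e0 : 0 < (1000 * (w m)%:R)^-1 :> R by rewrite invr_gt0; have := w_gt0 R m; move: ((w m)%:R : R) => z; lra.
have [F [eF cF gF]] := generic_perturbation (@base_map_equivariant m) e0.
have {}Hm := Hm F cF.
have F_close (c : cell m) (j : 'I_15) : c None = 2 :> nat ->
    `|F c 0 j - model (w m)%:R^-1 (pt R c) 0 j| <= (1000 * (w m)%:R)^-1.
  by move=> c2; have := cF c j; rewrite /base_map c2.
(* [star] has a zero facet for the perturbed map, which a good flag with a cell that is not free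
   cannot have. *)
have fr j : free_cell (star m j).
  have [h _ _] := Hm _ (star_flag m).
  apply: contrapT => nf; apply: (h _ ord_max); first by move=> /(_ j).
  exact: star_zero F_close.
have card16 := card_model_zeros F_close eF Hm1 fr.
have par := facet_parity eF gF (fun C (k : 'I_17) fC nf => let: And3 h _ _ := Hm C fC in h nf k).
move: par; have -> : [set C | [&& flag C, `[< zero_facet (fun j : 'I_17 => F (C j)) ord_max >] &
     ~~ odd (vert C 15 None)]]%SET =
   [set C | [&& flag C, `[< zero_facet (fun j : 'I_17 => F (C j)) ord_max >] &
     vert C 15 None == 2 :> nat]]%SET.
  apply/setP => C; rewrite !inE; apply/and3P/and3P => [[fC zC e]|[fC zC /eqP e]].
    split => //; have /andP[_] := flag_valid fC (isT : (15 <= 16)%N).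
    have [_ h _] := Hm C fC; move: e (h) zC => + /[swap] /asboolP.
    case: (vert C 15 None : nat) => [|[|[|]]] //= _ zC h0.
    by case: (h0 erefl).
  by rewrite e.
by rewrite card16 // => C fC t z; have [_ _ h] := Hm C fC; exact: h.
Qed.
End Fixed.
End Main.

(** * Reading hyperplanes off a zero, and the case of null measures *)

Lemma ty_surj (t : bool) (f : {ffun 'I_3 -> bool}) : (exists b, f b) ->
  exists j : 'I_15, [/\ (j : nat) <> 14, first_measure j = t & ty j =1 f].
Proof.
move=> [b fb].
have H (n : nat) (ln : (n < 15)%N) : first_measure (Ordinal ln) = t -> n <> 14 ->
    [/\ ty (Ordinal ln) r0 = f r0, ty (Ordinal ln) r1 = f r1 & ty (Ordinal ln) r2 = f r2] ->
    exists j : 'I_15, [/\ (j : nat) <> 14, first_measure j = t & ty j =1 f].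
  by move=> h1 h2 [e0 e1 e2]; exists (Ordinal ln); split => //; apply: ord3P.
case: (boolP (f r0)) (boolP (f r1)) (boolP (f r2)) H => f0 [] f1 [] f2 H.
- by case: t H => H; [apply: (H 12%N isT)|apply: (H 13%N isT)].
- by case: t H => H; [apply: (H 10%N isT)|apply: (H 11%N isT)].
- by case: t H => H; [apply: (H 4%N isT)|apply: (H 6%N isT)].
- by case: t H => H; [apply: (H 0%N isT)|apply: (H 2%N isT)].
- by case: t H => H; [apply: (H 5%N isT)|apply: (H 7%N isT)].
- by case: t H => H; [apply: (H 1%N isT)|apply: (H 3%N isT)].
- by case: t H => H; [apply: (H 8%N isT)|apply: (H 9%N isT)].
- exfalso; move: b fb; apply: ord3P; exact/negP.
Qed.

Section Final.
Variable R : realType.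
Notation pnt := (borel_rV R 5).
Implicit Types mu : {finite_measure set pnt -> \bar R}.

Lemma partition_of_positive mu1 mu2 mu3 : continuous_measure mu1 ->
  continuous_measure mu2 -> continuous_measure mu3 -> 0 < fine (mu1 setT) ->
  exists h : 'I_3 -> oriented_hyperplane R 5,
    [/\ equipartition mu1 h, equipartition mu2 h & exists i : 'I_3, bisector mu3 (h i)].
Proof.
move=> cm1 cm2 cm3 p1.
have [x ux /rowP zx] := measure_map_zero cm1 cm2 cm3 p1.
have M (t : bool) (f : {ffun 'I_3 -> bool}) : (exists b, f b) ->
    mom (if t then mu1 else mu2) f x = 0.
  move=> /(ty_surj t)[j [j14 jt jf]]; have := zx j; rewrite !mxE (introF eqP j14) jt.
  by rewrite (eq_mom _ _ jf).
(* With a zero normal the sign of the form would be constant and its integral plus or minus the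
   positive mass of [mu1]. *)
have n0 b : row_normal x b != 0.
  apply/eqP => nb; have nx : exists k, x b k != 0.
    by have [k xk] := ux b; exists k; rewrite -normr_eq0 xk oner_neq0.
  have := mom_degenerate nx nb; move=> /(_ mu1) H.
  have : fine (mu1 setT) = 0.
    apply: H; rewrite -(M true [ffun c => c == b]); last by exists b; rewrite ffunE eqxx.
    by apply: eq_mom => c; rewrite /= ffunE.
  by move: p1 => /[swap] ->; rewrite ltxx.
exists (hyperplanes n0); split.
- by apply: equipartition_mom => // f ef; exact: (M true).
- by apply: equipartition_mom => // f ef; exact: (M false).
- have := zx (@Ordinal 15 14 isT); rewrite !mxE /= => /eqP/prodf_eq0[b _ /eqP mb].
  by exists b; exact: bisector_mom.
Qed.

Lemma null_equipartition mu (h : 'I_3 -> oriented_hyperplane R 5) :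
  mu setT = 0%E -> equipartition mu h.
Proof.
move=> m0 e; rewrite m0 mule0; apply: subset_measure0 m0 => //.
exact: measurable_hyperorthant.
Qed.

Lemma fine_mass_gt0 mu : mu setT <> 0%E -> 0 < fine (mu setT).
Proof.
move=> m0; apply: fine_gt0; apply/andP; split; last exact: finite_mu.
by rewrite lt0e measure_ge0 andbT; apply/eqP.
Qed.
End Final.

Theorem theorem2 (R : realType)
    (mu1 mu2 mu3 : {finite_measure set (borel_rV R 5) -> \bar R}) :
  continuous_measure mu1 -> continuous_measure mu2 -> continuous_measure mu3 ->
  exists h : 'I_3 -> oriented_hyperplane R 5,
    [/\ equipartition mu1 h,
        equipartition mu2 h &
        exists i : 'I_3, bisector mu3 (h i)].
Proof.
move=> cm1 cm2 cm3.
(* Any hyperplanes equipartition a null measure, so its place can be given to a measure of positive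
   mass: [mu2] replaces a null [mu1], and [mu3] replaces both if [mu2] is null too. *)
have [z1|/fine_mass_gt0 p1] := pselect (mu1 setT = 0%E); last exact: partition_of_positive.
have [z2|/fine_mass_gt0 p2] := pselect (mu2 setT = 0%E); last first.
  have [h [_ h2 h3]] := partition_of_positive cm2 cm2 cm3 p2.
  by exists h; split => //; exact: null_equipartition.
have [z3|/fine_mass_gt0 p3] := pselect (mu3 setT = 0%E); last first.
  have [h [_ _ h3]] := partition_of_positive cm3 cm3 cm3 p3.
  by exists h; split => //; exact: null_equipartition.
have n0 : const_mx 1 != 0 :> 'rV[R]_5.
  by apply/eqP => /rowP/(_ ord0)/eqP; rewrite !mxE oner_eq0.
exists (fun=> OrientedHyperplane 0 n0); split; [exact: null_equipartition..|].
have zs s : mu3 (halfspace (OrientedHyperplane 0 n0) s) = 0%E.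
  by apply: subset_measure0 z3 => //; exact: measurable_halfspace.
by exists ord0; rewrite /bisector !zs.
Qed.
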